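(* Let $\tau\in C^2(\mathbb{R})$ and suppose there are constants $a,b,\gamma>0$ such that $$\Big|\frac{d^\ell}{dx^\ell}\tau(x)\Big|\le a+b|x|^\gamma\qquad\text{for all }x\in\mathbb{R},\ \ell=0,1,2.$$ Let $\{w_j,w_j^{(0)}:j\ge1\}$ be independent identically distributed $\mathcal{N}(0,1)$ random variables and, for $n\ge1$, define $$f_n(x)=\frac{1}{n^{1/2}}\sum_{j=1}^nw_j\,\tau\big(xw_j^{(0)}\big),\qquad x\in\mathbb{R}.$$ Let $\nu$ be a finite measure on $\mathbb{R}$ without any atom such that $\int_{\mathbb{R}}|x|^{2\gamma+4}\,\nu(dx)<\infty$. Let $\{B(x):x\in\mathbb{R}\}$ be a centered Gaussian field with covariance function $$\mathcal{C}(x,y)=\mathbb{E}[\tau(xZ)\tau(yZ)],\qquad Z\sim\mathcal{N}(0,1).$$ Then, viewing $f_n$ and $B$ as random elements of $K=L^2(\mathbb{R},d\nu)$, $$d_2(f_n,B)\le C\,n^{-1/2},$$ where $C$ is a finite constant that depends on $\nu,a,b$ and $\gamma$.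
   Context: For $K$-valued random variables $F,G$ ($K$ a real separable Hilbert space), $d_2(F,G)=\sup_\phi|\mathbb{E}[\phi(F)]-\mathbb{E}[\phi(G)]|$, the supremum running over all twice Fréchet differentiable $\phi:K\to\mathbb{R}$ with $\max_{j=1,2}\sup_{v\in K}\|\nabla^j\phi(v)\|_{K^{\otimes j}}\le1$, where $\nabla^j$ is the $j$-th Fréchet derivative and $K^{\otimes j}$ the $j$-th Hilbert tensor power. The function $f_n$ is the output of a shallow Gaussian neural network of width $n$ with activation function $\tau$; its covariance function is $\mathbb{E}[f_n(x)f_n(y)]=\mathcal{C}(x,y)$ for every $n$. *)

(* Defs.v *)
From HB Require Import structures.
From mathcomp Require Import all_boot all_order all_algebra.
From mathcomp Require Import all_classical all_reals all_analysis.
From mathcomp Require Import measurable_realfun ess_sup_inf.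

Set Implicit Arguments.
Unset Strict Implicit.
Unset Printing Implicit Defensive.

Import Order.TTheory GRing.Theory Num.Theory.
Import numFieldNormedType.Exports.

Local Open Scope classical_set_scope.
Local Open Scope ring_scope.

(* The library's [LspaceType mu p1] (classes of p-integrable functions modulo
   equality mu-a.e.) carries no algebraic structure; the instances below make it
   a normed module. Operations are computed on representatives. *)
Section Lspace_normed_module.
Context d (T : measurableType d) (R : realType).
Variables (mu : {measure set T -> \bar R}) (p : \bar R) (p1 : (1 <= p)%E).
Local Open Scope quotient_scope.
Local Notation Q := ({mfun_ mu, T >-> measurableTypeR R}).
Local Notation L := (LspaceType mu p1).
Implicit Types f g h : L.
Implicit Types u v : LfunType mu p1.

HB.instance Definition _ := gen_eqMixin L.
HB.instance Definition _ := gen_choiceMixin L.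

Lemma ae_eq_Lnorm (u v : T -> R) : measurable_fun setT u ->
  measurable_fun setT v -> u = v %[ae mu] ->
  'N[mu]_p[EFin \o u]%E = 'N[mu]_p[EFin \o v]%E.
Proof.
move=> mu_ mv uv; rewrite unlock /Lnorm; case: p p1 => [r _| _ |//].
- congr (_ `^ _)%E; apply: ge0_ae_eq_integral => //.
  + exact/measurable_EFinP/(@measurableT_comp _ _ _ _ _ _ (@powR R ^~ r))
      /measurableT_comp.
  + exact/measurable_EFinP/(@measurableT_comp _ _ _ _ _ _ (@powR R ^~ r))
      /measurableT_comp.
  + by move=> x _; rewrite poweR_ge0.
  + by move=> x _; rewrite poweR_ge0.
  + by apply: filterS uv => x /= + _ => ->.
- case: ifPn => // _; apply: eq_ess_sup.
  by apply: filterS uv => x /= /(_ I) ->.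
Qed.

Lemma Lspace_repr_subproof f : (f : T -> R) \in Lfun mu p.
Proof.
apply/andP; split; rewrite inE /=; last exact: (@Lebesgue_finite _ _ _ _ _ _ f).
exact: (@measurable_funPT _ _ T (measurableTypeR R)
  (repr (f : Q))).
Qed.

Definition Lspace_repr f : LfunType mu p1 :=
  Lfun_Sub p1 (Lspace_repr_subproof f).

(* [measurableTypeR R] and [R] have the same measurable sets but different
   displays, hence the repackaging. *)
Definition Lspace_mfun u : {mfun T >-> measurableTypeR R} :=
  HB.pack (u : T -> R) (@isMeasurableFun.Build _ _ T (measurableTypeR R) u
    (@measurable_funPT _ _ T R u)).

Definition Lspace_class u : Q := \pi_Q (Lspace_mfun u).

Lemma Lspace_class_ae u : (Lspace_class u : T -> R) = u %[ae mu].
Proof.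
have /eqmodP/asboolP := reprK (Lspace_class u).
exact.
Qed.

Lemma Lspace_class_finite u : finite_norm mu p (Lspace_class u).
Proof.
have mu' : measurable_fun setT (Lspace_class u : T -> R).
  exact: (@measurable_funPT _ _ T (measurableTypeR R) (repr (Lspace_class u))).
have E := ae_eq_Lnorm mu' (@measurable_funPT _ _ T R u) (Lspace_class_ae u).
rewrite /finite_norm E; exact: Lfunction_finite.
Qed.

Definition Lspace_pi u : L :=
  HB.pack (Lspace_class u)
    (@isFinLebesgue.Build _ _ _ mu p p1 _ (Lspace_class_finite u)).

Lemma Lspace_piE u : (Lspace_pi u : T -> R) = u %[ae mu].
Proof. exact: Lspace_class_ae. Qed.

Lemma Lspace_eqP f g : f = g <-> (f : T -> R) = g %[ae mu].
Proof.
split=> [->|]; first exact/aeW.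
case: f g => f [[Hf]] [g [[Hg]]] /= fg.
have E : f = g.
  by rewrite -(reprK f) -(reprK g); apply/eqmodP/asboolP.
by move: Hf Hg; rewrite E => Hf Hg; rewrite (bool_irrelevance Hf Hg).
Qed.

Lemma Lspace_pi_eq u v : (u : T -> R) = v %[ae mu] -> Lspace_pi u = Lspace_pi v.
Proof.
move=> uv; apply/Lspace_eqP.
apply: (ae_eq_trans (Lspace_piE u)); apply: (ae_eq_trans uv).
exact/ae_eq_sym/Lspace_piE.
Qed.

Lemma Lspace_reprK f : Lspace_pi (Lspace_repr f) = f.
Proof. by apply/Lspace_eqP; exact: (Lspace_piE (Lspace_repr f)). Qed.

Definition Lspace_add f g := Lspace_pi (Lspace_repr f + Lspace_repr g).
Definition Lspace_opp f := Lspace_pi (- Lspace_repr f).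
Definition Lspace_scale (a : R) f := Lspace_pi (a *: Lspace_repr f).

Lemma Lspace_add_pi u v : Lspace_add (Lspace_pi u) (Lspace_pi v) = Lspace_pi (u + v).
Proof.
apply: Lspace_pi_eq; apply: filterS2 (Lspace_piE u) (Lspace_piE v).
by move=> x ux vx _; congr (_ + _); [exact: ux | exact: vx].
Qed.

Lemma Lspace_opp_pi u : Lspace_opp (Lspace_pi u) = Lspace_pi (- u).
Proof.
apply: Lspace_pi_eq; apply: filterS (Lspace_piE u).
by move=> x ux _; congr (- _); exact: ux.
Qed.

Lemma Lspace_scale_pi a u : Lspace_scale a (Lspace_pi u) = Lspace_pi (a *: u).
Proof.
apply: Lspace_pi_eq; apply: filterS (Lspace_piE u).
by move=> x ux _; congr (_ * _); exact: ux.
Qed.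

Lemma Lspace_ind (P : L -> Prop) : (forall u, P (Lspace_pi u)) -> forall f, P f.
Proof. by move=> Pu f; rewrite -(Lspace_reprK f). Qed.

Lemma Lspace_addA : associative Lspace_add.
Proof.
elim/Lspace_ind=> f; elim/Lspace_ind=> g; elim/Lspace_ind=> h.
by rewrite !Lspace_add_pi addrA.
Qed.

Lemma Lspace_addC : commutative Lspace_add.
Proof.
by elim/Lspace_ind=> f; elim/Lspace_ind=> g; rewrite !Lspace_add_pi addrC.
Qed.

Lemma Lspace_add0 : left_id (Lspace_pi 0) Lspace_add.
Proof. by elim/Lspace_ind=> f; rewrite Lspace_add_pi add0r. Qed.

Lemma Lspace_addN : left_inverse (Lspace_pi 0) Lspace_opp Lspace_add.
Proof.
by elim/Lspace_ind=> f; rewrite Lspace_opp_pi Lspace_add_pi addNr.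
Qed.

HB.instance Definition _ := GRing.isZmodule.Build L
  Lspace_addA Lspace_addC Lspace_add0 Lspace_addN.

Lemma Lspace_scaleA a b f :
  Lspace_scale a (Lspace_scale b f) = Lspace_scale (a * b) f.
Proof. by elim/Lspace_ind: f => f; rewrite !Lspace_scale_pi scalerA. Qed.

Lemma Lspace_scale1 : left_id 1 Lspace_scale.
Proof. by elim/Lspace_ind=> f; rewrite Lspace_scale_pi scale1r. Qed.

Lemma Lspace_scaleDr : right_distributive Lspace_scale +%R.
Proof.
move=> a; elim/Lspace_ind=> f; elim/Lspace_ind=> g.
change (Lspace_scale a (Lspace_add (Lspace_pi f) (Lspace_pi g)) =
  Lspace_add (Lspace_scale a (Lspace_pi f)) (Lspace_scale a (Lspace_pi g))).
by rewrite Lspace_add_pi !Lspace_scale_pi Lspace_add_pi scalerDr.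
Qed.

Lemma Lspace_scaleDl f : {morph Lspace_scale^~ f : a b / a + b}.
Proof.
move=> a b; elim/Lspace_ind: f => f.
change (Lspace_scale (a + b) (Lspace_pi f) =
  Lspace_add (Lspace_scale a (Lspace_pi f)) (Lspace_scale b (Lspace_pi f))).
by rewrite !Lspace_scale_pi Lspace_add_pi scalerDl.
Qed.

HB.instance Definition _ := GRing.Zmodule_isLmodule.Build R L
  Lspace_scaleA Lspace_scale1 Lspace_scaleDr Lspace_scaleDl.

Lemma Lspace_piD u v : Lspace_pi (u + v) = Lspace_pi u + Lspace_pi v.
Proof. exact: (esym (Lspace_add_pi u v)). Qed.

Lemma Lspace_piZ a u : Lspace_pi (a *: u) = a *: Lspace_pi u.
Proof. exact: (esym (Lspace_scale_pi a u)). Qed.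

Definition Lspace_norm f : R := fine 'N[mu]_p[EFin \o (f : T -> R)].

Lemma Lspace_norm_pi u : Lspace_norm (Lspace_pi u) = fine 'N[mu]_p[EFin \o u]%E.
Proof.
congr fine; apply: ae_eq_Lnorm (Lspace_piE u) => //.
exact: (measurable_funPT (Lspace_repr (Lspace_pi u))).
Qed.

Lemma Lspace_ler_normD f g : Lspace_norm (f + g) <= Lspace_norm f + Lspace_norm g.
Proof.
elim/Lspace_ind: f => u; elim/Lspace_ind: g => v.
by rewrite -Lspace_piD !Lspace_norm_pi; exact: ler_LnormD.
Qed.

Lemma Lspace_normZ a f : Lspace_norm (a *: f) = `|a| * Lspace_norm f.
Proof.
elim/Lspace_ind: f => u; rewrite -Lspace_piZ !Lspace_norm_pi.
by apply: EFin_inj; rewrite EFinM !finite_norm_fine; exact: LnormZ.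
Qed.

Lemma Lspace_norm_eq0 f : Lspace_norm f = 0 -> f = 0.
Proof.
elim/Lspace_ind: f => u; rewrite Lspace_norm_pi => /fine_Lnormr_eq0 u0.
exact: Lspace_pi_eq.
Qed.

HB.instance Definition _ := Lmodule_isNormed.Build R L
  Lspace_ler_normD Lspace_normZ Lspace_norm_eq0.

End Lspace_normed_module.

Section L2.
Context d (T : measurableType d) (R : realType).
Variable mu : {measure set T -> \bar R}.

Definition L2_dot (f g : LspaceType2 mu) : R := \int[mu]_x (f x * g x).

Lemma L2_dotE (f : LspaceType2 mu) : L2_dot f f = `|f| ^+ 2.
Proof.
have fin := finite_norm_fine (Lspace_repr f).
have n0 : 0 <= Lspace_norm f by exact: fine_ge0 (Lnorm_ge0 _ _ _).
suff I : (\int[mu]_x (f x * f x)%:E = (`|f| ^+ 2)%:E)%E.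
  by rewrite /L2_dot /Rintegral I.
rewrite [`|f|]/(Lspace_norm f) -powR_mulrn// -poweR_EFin.
rewrite [(Lspace_norm f)%:E]fin powR_Lnorm ?pnatr_eq0//.
apply: eq_integral => x _; rewrite /= powR_mulrn//.
by rewrite -normrX ger0_norm ?sqr_ge0.
Qed.

(* The class of [f]; functions that are not square integrable are sent to 0. *)
Definition L2_of (f : T -> R) : LspaceType2 mu :=
  if pselect (f \in Lfun mu 2%:R%:E) is left fL
  then Lspace_pi (Lfun_Sub (lee1n 2) fL) else 0.

End L2.

(* [K] is a Hilbert space with inner product [dot]. Derivatives are identified
   with tensors through [dot]: the first derivative of [phi] is a gradient map
   [K -> K], and an element of the Hilbert tensor square of [K] is a
   Hilbert-Schmidt operator [A], standing for the tensor whose coefficients in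
   an orthonormal basis [e] are the [dot (A (e i)) (e j)]. *)
Section d2_distance.
Context (R : realType) (K : normedModType R) (dot : K -> K -> R).

Definition orthonormal m (e : 'I_m -> K) : Prop :=
  forall i j, dot (e i) (e j) = (i == j)%:R.

Definition is_gradient (phi : K -> R) (grad : K -> K) : Prop :=
  forall v, differentiable phi v /\ forall h, 'd phi v h = dot (grad v) h.

(* Norm of the Hilbert tensor square, i.e. the Hilbert-Schmidt norm: the supremum
   over finite orthonormal families is the value on any orthonormal basis, and it
   is +oo when [A] is not Hilbert-Schmidt. *)
Definition tensor2_norm (A : K -> K) : \bar R :=
  ereal_sup [set x | exists m (e : 'I_m -> K), orthonormal e /\
    x = (Num.sqrt (\sum_(i < m) \sum_(j < m) dot (A (e i)) (e j) ^+ 2))%:E].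

Definition d2_test_function (phi : K -> R) : Prop :=
  exists grad : K -> K,
    [/\ is_gradient phi grad,
        forall v, differentiable grad v &
        (maxe (ereal_sup (range (fun v => `|grad v|%:E)))
              (ereal_sup (range (fun v => tensor2_norm ('d grad v)))) <= 1)%E].

Definition d2 d (T1 : measurableType d) (P1 : probability T1 R) (F : T1 -> K)
    d' (T2 : measurableType d') (P2 : probability T2 R) (G : T2 -> K) : \bar R :=
  ereal_sup [set `| 'E_P1[phi \o F] - 'E_P2[phi \o G] |%E
            | phi in d2_test_function].

End d2_distance.

Section probability_notions.
Context (R : realType) d (T : measurableType d) (P : probability T R).

Definition mutually_independent (I : eqType) (X : I -> T -> R) : Prop :=
  forall (s : seq I) (A : I -> set R), uniq s -> (forall i, measurable (A i)) ->
  P (\bigcap_(i in [set` s]) (X i @^-1` A i)) =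
  (\prod_(i <- s) P (X i @^-1` A i))%E.

Definition has_law (X : T -> R) (mu : set R -> \bar R) : Prop :=
  measurable_fun [set: T] X /\
  forall A, measurable A -> P (X @^-1` A) = mu A.

(* The library's [normal_prob m 0] is not the point mass at [m]. *)
Definition gaussian_law (m s : R) : set R -> \bar R :=
  if s == 0 then \d_m else normal_prob m s.

(* Joint measurability makes [B] a random element of a space of classes of
   functions of the index. *)
Definition centered_gaussian_field (B : R -> T -> R) (C : R -> R -> \bar R) :
    Prop :=
  [/\ measurable_fun [set: R * T] (fun xt => B xt.1 xt.2),
      forall m (c x : 'I_m -> R), exists mean sd : R,
        has_law (fun t => \sum_(i < m) c i * B (x i) t) (gaussian_law mean sd),
      forall x, 'E_P[B x]%E = 0 &
      forall x y, covariance P (B x) (B y) = C x y].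

End probability_notions.

Definition atom d (T : measurableType d) (R : realType)
    (mu : {measure set T -> \bar R}) (A : set T) : Prop :=
  [/\ measurable A, (0 < mu A)%E &
      forall B, measurable B -> B `<=` A -> mu B = 0 \/ mu B = mu A].

Section shallow_network.
Context (R : realType) (tau : R -> R).

Definition network_output (T : Type) (w w0 : nat -> T -> R) (n : nat) (x : R)
    (t : T) : R :=
  (Num.sqrt n%:R)^-1 * \sum_(j < n) w j t * tau (x * w0 j t).

Definition network_cov (x y : R) : \bar R :=
  'E_(normal_prob 0 1)[fun z : R => (tau (x * z) * tau (y * z))%R]%E.

Definition C2 : Prop :=
  (forall l x, (l < 2)%N -> derivable (tau^`(l))%classic x 1) /\
  continuous (tau^`(2))%classic.

End shallow_network.

(* Main.v *)
(* Two Gaussian-type sums [sum_j A_j w_j u_j] and [sum_j B_j w_j u_j] with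
   [A_j B_j = 0] are joined by the path [sin s * A_j + cos s * B_j]; Gaussian
   integration by parts in the outer weights [w_j] bounds the variation of
   [E phi] along it by the mean of [sum_j (A_j^2 - B_j^2) phi''(u_j, u_j)]. For
   networks this is the pairing of a Hessian of Hilbert-Schmidt norm at most 1
   with the difference of two empirical covariances of the features
   [u_j = tau (. w0_j)], whose Hilbert-Schmidt norm is [O(n^{-1/2})] in mean
   square because the inner weights are independent. Since [f_n] and [B] live on
   different probability spaces, [f_n] is compared with a network of width
   [m >= n] made of fresh neurons, and then [m] tends to infinity: the finite
   dimensional marginals of the wide network converge to those of [B], by the
   same interpolation applied to [cos (<c, .> + b)] and by the approximation of
   Lipschitz functions by trigonometric polynomials.

   Both fields are first replaced by their values on a finite grid. The error
   vanishes as the grid is refined by the mean value theorem for [tau] and the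
   moment hypothesis on [nu], so that the bound does not depend on the grid. *)

Require Import Defs.
From HB Require Import structures.
From mathcomp Require Import all_boot all_order all_algebra.
From mathcomp Require Import all_classical all_reals all_analysis.
From mathcomp Require Import measurable_realfun.
From mathcomp Require Import ring lra.

Set Implicit Arguments.
Unset Strict Implicit.
Unset Printing Implicit Defensive.

Import Order.TTheory GRing.Theory Num.Theory.
Import numFieldNormedType.Exports.

Local Open Scope classical_set_scope.
Local Open Scope ring_scope.

(** * Integrable real-valued functions *)

(** The grid makes expectations tractable. On [K] only continuity of [phi] is at hand, and
    [t |-> phi (L2_of nu (Y ^~ t))] is not shown to be measurable; on a finite span [phi] is a
    continuous function of finitely many random coefficients. Replacing a field by a step function
    costs an error whose bound is measurable, and the expectations are compared by monotonicity of
    the integral. The interpolation integrates by parts only in the outer weights, so two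
    derivatives of [phi] suffice and no third-order remainder appears. The condition [A_j B_j = 0]
    removes the mixed terms [A_j B_j (cos^2 s - sin^2 s)] of the derivative along the path. The
    bound between widths [n] and [m] is uniform in [m], so the limit in [m] needs no rate. The rate
    is [ep + 4 I / (ep n)] at [ep = n^{-1/2}], where [I] sums the second moments of products of two
    feature coordinates in the orthonormal grid basis. By the growth bound [I] is at most a multiple
    of the square of an integral of [(1 + |x|)^{2 gamma}], whatever the mesh. The other four powers
    in [2 gamma + 4] pay for the squared displacement [((1 + x^2) / q)^2] of a point moved to the
    grid. *)

Notation L1 mu f := (integrable mu setT (EFin \o f)) (only parsing).

Section L1_functions.
Context d (T : measurableType d) (R : realType) (mu : {measure set T -> \bar R}).
Implicit Types f g : T -> R.

Lemma L1_measurable f : L1 mu f -> measurable_fun setT f.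
Proof. by move=> /integrableP[/measurable_EFinP]. Qed.

Lemma eq_L1 f g : f =1 g -> L1 mu f -> L1 mu g.
Proof. by move=> /funext ->. Qed.

Lemma L1_dominated f g : measurable_fun setT f -> L1 mu g ->
  (forall x, `|f x| <= g x) -> L1 mu f.
Proof.
move=> mf ig fg; apply: (le_integrable measurableT _ _ ig).
  exact/measurable_EFinP.
by move=> x _ /=; rewrite lee_fin (le_trans (fg x))// ler_norm.
Qed.

Lemma L1D f g : L1 mu f -> L1 mu g -> L1 mu (fun x => f x + g x).
Proof.
move=> lf lg; have := integrableD measurableT lf lg.
by apply: eq_integrable => // x _; rewrite /= EFinD.
Qed.

Lemma L1N f : L1 mu f -> L1 mu (fun x => - f x).
Proof.
move=> lf; have := integrableN lf.
by apply: eq_integrable.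
Qed.

Lemma L1B f g : L1 mu f -> L1 mu g -> L1 mu (fun x => f x - g x).
Proof. by move=> lf lg; apply: L1D => //; exact: L1N. Qed.

Lemma L1Z k f : L1 mu f -> L1 mu (fun x => k * f x).
Proof.
move=> lf; have := integrableZl measurableT k lf.
by apply: eq_integrable => // x _; rewrite /= EFinM.
Qed.

Lemma L1_0 : L1 mu (fun _ : T => 0 : R).
Proof. exact: integrable0. Qed.

Lemma L1_sum (I : Type) (s : seq I) (p : pred I) (F : I -> T -> R) :
  (forall i, p i -> L1 mu (F i)) -> L1 mu (fun x => \sum_(i <- s | p i) F i x).
Proof.
move=> lF; elim: s => [|i s ih].
  by apply: eq_L1 L1_0 => x; rewrite big_nil.
case: (boolP (p i)) => pi.
  by apply: eq_L1 (L1D (lF _ pi) ih) => x; rewrite big_cons pi.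
by apply: eq_L1 ih => x; rewrite big_cons (negbTE pi).
Qed.

Lemma L1_abs f : L1 mu f -> L1 mu (fun x => `|f x|).
Proof.
move=> lf; apply: (le_integrable measurableT _ _ lf).
  by apply/measurable_EFinP; apply: measurableT_comp (L1_measurable lf).
by move=> x _ /=; rewrite normr_id.
Qed.

Lemma L1_ge0 f : measurable_fun setT f -> (forall x, 0 <= f x) ->
  (\int[mu]_x (f x)%:E < +oo)%E -> L1 mu f.
Proof.
move=> mf f0 foo; apply/integrableP; split; first exact/measurable_EFinP.
rewrite (eq_integral (fun x => (f x)%:E))// => x _ /=.
by rewrite ger0_norm.
Qed.

Lemma EFin_Rintegral f : L1 mu f -> (\int[mu]_x f x)%:E = (\int[mu]_x (f x)%:E)%E.
Proof. by move=> lf; rewrite fineK// integrable_fin_num. Qed.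

Lemma Rintegral_sumr (I : Type) (s : seq I) (p : pred I) (F : I -> T -> R) :
  (forall i, p i -> L1 mu (F i)) ->
  \int[mu]_x (\sum_(i <- s | p i) F i x) = \sum_(i <- s | p i) \int[mu]_x F i x.
Proof.
move=> lF; elim: s => [|i s ih].
  under eq_Rintegral do rewrite big_nil.
  by rewrite /Rintegral integral0 big_nil.
rewrite big_cons; under eq_Rintegral do rewrite big_cons.
case: ifPn => // pi; rewrite -ih -RintegralD//; first exact: lF.
exact: L1_sum.
Qed.

Lemma normr_Rintegral_le f g : measurable_fun setT f -> L1 mu g ->
  (forall x, `|f x| <= g x) -> `|\int[mu]_x f x| <= \int[mu]_x g x.
Proof.
move=> mf lg fg; have lf := L1_dominated mf lg fg.
apply: (le_trans (le_normr_Rintegral measurableT lf)).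
by apply: le_Rintegral => //; exact: L1_abs.
Qed.

Lemma L1_sqr_mul f g : measurable_fun setT f -> measurable_fun setT g ->
  L1 mu (fun x => f x ^+ 2) -> L1 mu (fun x => g x ^+ 2) ->
  L1 mu (fun x => f x * g x).
Proof.
move=> mf mg lf lg; apply: (L1_dominated _ (L1D lf lg)).
  exact: measurable_funM.
move=> x; rewrite normrM -[f x ^+ 2]real_normK ?num_real//.
rewrite -[g x ^+ 2]real_normK ?num_real//.
set a := `|f x|; set b := `|g x|; have a0 : 0 <= a by exact: normr_ge0.
have b0 : 0 <= b by exact: normr_ge0.
by have := sqr_ge0 (a - b); nra.
Qed.

Lemma L1_sqr_add f g : measurable_fun setT f -> measurable_fun setT g ->
  L1 mu (fun x => f x ^+ 2) -> L1 mu (fun x => g x ^+ 2) ->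
  L1 mu (fun x => (f x + g x) ^+ 2).
Proof.
move=> mf mg lf lg; apply: (L1_dominated _ (L1Z 2 (L1D lf lg))).
  by apply: measurable_funX; exact: measurable_funD.
move=> x; rewrite ger0_norm ?sqr_ge0//.
by have := sqr_ge0 (f x - g x); nra.
Qed.

End L1_functions.

Section L1_finite_measure.
Context d (T : measurableType d) (R : realType) (mu : {finite_measure set T -> \bar R}).
Implicit Types f g : T -> R.

Lemma L1_cst (c : R) : L1 mu (fun _ : T => c).
Proof.
have := finite_measure_integrable_cst mu c measurableT.
exact.
Qed.

Lemma L1_bounded f (M : R) : measurable_fun setT f -> (forall x, `|f x| <= M) ->
  L1 mu f.
Proof. by move=> mf fM; apply: (L1_dominated mf (L1_cst M)). Qed.

Lemma L1_of_sqr f : measurable_fun setT f -> L1 mu (fun x => f x ^+ 2) -> L1 mu f.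
Proof.
move=> mf lf; apply: (L1_dominated mf (L1D (L1_cst 1) lf)) => x.
rewrite -[f x ^+ 2]real_normK ?num_real//.
by have := sqr_ge0 (`|f x| - 1); have := normr_ge0 (f x); nra.
Qed.

End L1_finite_measure.

(** * Gaussian integrals *)

Section normal_integral.
Context (R : realType).
Variables m s : R.
Local Notation mu := (@lebesgue_measure R).

(** [normal_prob] is dominated by Lebesgue measure, and its Radon-Nikodym derivative agrees almost
    everywhere with [normal_pdf] because both have the same integral over every measurable set. *)
Lemma ge0_integral_normal_prob (f : R -> \bar R) :
  measurable_fun setT f -> (forall x, 0 <= f x)%E ->
  (\int[normal_prob m s]_x f x = \int[mu]_x (f x * (normal_pdf m s x)%:E))%E.
Proof.
move=> mf f0; have dom := normal_prob_dominates m s.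
have mpdf : measurable_fun setT (fun x : R => (normal_pdf m s x)%:E).
  by apply/measurable_EFinP; exact: measurable_normal_pdf.
rewrite -(Radon_Nikodym_SigmaFinite.change_of_variables dom)//.
apply: ae_eq_integral => //.
- apply: emeasurable_funM => //.
  exact: measurable_int (Radon_Nikodym_SigmaFinite.f_integrable _).
- exact: emeasurable_funM.
- apply: ae_eqe_mul2l; apply: integral_ae_eq => //.
  + exact: Radon_Nikodym_SigmaFinite.f_integrable.
  + by move=> A _ mA; rewrite -Radon_Nikodym_SigmaFinite.f_integral.
Qed.

Lemma L1_normal_prob (f : R -> R) : measurable_fun setT f ->
  L1 (normal_prob m s) f <-> L1 mu (fun x => f x * normal_pdf m s x).
Proof.
move=> mf; rewrite -!(rwP (integrableP _ _ _)).
have E : (\int[normal_prob m s]_x `|(f x)%:E| =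
    \int[mu]_x `|(f x * normal_pdf m s x)%:E|)%E.
  rewrite ge0_integral_normal_prob//; last first.
    by apply: measurableT_comp => //; exact/measurable_EFinP.
  apply: eq_integral => x _; rewrite /= normrM EFinM.
  by rewrite (ger0_norm (normal_pdf_ge0 m s x)).
by split=> -[_ +]; rewrite /comp ?E -?E => ?; split=> //; apply/measurable_EFinP => //;
  apply: measurable_funM => //; exact: measurable_normal_pdf.
Qed.

Lemma Rintegral_normal_prob (f : R -> R) : measurable_fun setT f ->
  L1 (normal_prob m s) f ->
  \int[normal_prob m s]_x f x = \int[mu]_x (f x * normal_pdf m s x).
Proof.
move=> mf lf; rewrite /Rintegral; congr fine.
have mpdf := @measurable_normal_pdf R m s.
rewrite integralE [in RHS]integralE !ge0_integral_normal_prob//; first last.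
- by apply: measurable_funepos; exact/measurable_EFinP.
- by apply: measurable_funeneg; exact/measurable_EFinP.
congr (_ - _)%E; apply: eq_integral => x _; rewrite !(funeposE,funenegE) -?EFinN -!EFin_max -EFinM;
  congr EFin; rewrite maxr_pMl ?normal_pdf_ge0// mul0r// mulNr //.
Qed.

End normal_integral.

Section translation.
Context (R : realType).
Local Notation mu := (@lebesgue_measure R).

(** Substitution along the increasing map [x + e], whose derivative is 1; the substitution theorem
    is where continuity of [f] enters. *)
Lemma ge0_integral_translation (f : R -> R) (e : R) : continuous f ->
  (forall x, 0 <= f x) ->
  (\int[mu]_x (f (x + e))%:E = \int[mu]_x (f x)%:E)%E.
Proof.
move=> cf f0; pose F (x : R) : R := x + e.
have F'E : F^`()%classic = cst 1.
  by apply/funext => x; rewrite derive1E deriveD// derive_cst derive_id addr0.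
rewrite [RHS](@increasing_ge0_integration_by_substitutionT _ F f)//.
- by apply: eq_integral => x _; rewrite F'E !fctE mulr1.
- by move=> x y xy; rewrite /F ltrD2r.
- by rewrite F'E => x; exact: cvg_cst.
- by rewrite F'E; exact: is_cvg_cst.
- by rewrite F'E; exact: is_cvg_cst.
- exact: cvg_addrr_Ny.
- exact: cvg_addrr.
Qed.

Lemma L1_translation (f : R -> R) (e : R) : continuous f -> L1 mu f ->
  L1 mu (fun x : R => f (x + e)).
Proof.
move=> cf lf.
have mf : measurable_fun setT f by exact: continuous_measurable_fun.
have mfe : measurable_fun setT (fun x : R => f (x + e)).
  by apply: (measurableT_comp mf); exact: measurable_funD.
apply/integrableP; split; first exact/measurable_EFinP.
have cn : continuous (fun x : R => `|f x|).
  by move=> x; apply: (continuous_comp (cf x)); exact: norm_continuous.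
have := ge0_integral_translation e cn (fun x => normr_ge0 _).
by rewrite /comp /= => ->; case/integrableP : lf.
Qed.

Lemma Rintegral_translation (f : R -> R) (e : R) : continuous f -> L1 mu f ->
  \int[mu]_x f (x + e) = \int[mu]_x f x.
Proof.
move=> cf lf; have lfe := L1_translation e cf lf.
have cn : continuous (fun x : R => `|f x|).
  by move=> x; apply: (continuous_comp (cf x)); exact: norm_continuous.
have cp : continuous (fun x : R => f x + `|f x|).
  by move=> x; apply: (@cvgD _ R^o); [exact: cf|exact: cn].
have E1 := ge0_integral_translation e cn (fun x => normr_ge0 _).
have E2 := ge0_integral_translation e cp.
(* [f + |f|] and [|f|] are both nonnegative; the signed identity is the difference of theirs. *)
have {E2} /(congr1 fine) : (\int[mu]_x (f (x + e) + `|f (x + e)|)%:E =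
    \int[mu]_x (f x + `|f x|)%:E)%E.
  by apply: E2 => x; have := ler_norm (- f x); rewrite normrN; lra.
rewrite -![fine _]/(Rintegral _ _ _).
rewrite (RintegralD measurableT lfe (L1_abs lfe)).
rewrite (RintegralD measurableT lf (L1_abs lf)).
rewrite [X in _ + X = _](congr1 fine E1 : _ = \int[mu]_x `|f x|).
exact: addIr.
Qed.

End translation.

Lemma is_derive_comp_affine (R : realType) (h : R -> R) (D x c e : R) :
  is_derive (x + c * e) 1 h D -> is_derive e 1 (fun e => h (x + c * e)) (c * D).
Proof.
move=> dh; have da : is_derive e 1 (fun e => x + c * e) c.
  have -> : (fun e => x + c * e) = cst x + c \*: (@id R) by apply/funext.
  by apply: is_derive_eq; rewrite add0r /GRing.scale/= mulr1.
by rewrite mulrC; exact: (@is_derive1_comp _ h (fun e => x + c * e) e _ _ dh da).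
Qed.

Lemma is_derive_under_integral (R : realType) d (Y : measurableType d)
    (mu : {measure set Y -> \bar R}) (f df : R -> Y -> R) (a r : R) (G : Y -> R) :
  0 < r -> (forall x, `|x - a| < r -> L1 mu (f x)) ->
  (forall x y, `|x - a| < r -> is_derive x 1 (f ^~ y) (df x y)) ->
  L1 mu G -> (forall x y, `|x - a| < r -> `|df x y| <= G y) ->
  is_derive a 1 (fun x => \int[mu]_y f x y) (\int[mu]_y df a y).
Proof.
move=> r0 lf dfE lG dG.
have aa : `|a - a| < r by rewrite subrr normr0.
have Ia : `]a - r, a + r[%classic a by rewrite /= in_itv/= ltrBlDr !ltrDl r0.
have inI x : `]a - r, a + r[%classic x -> `|x - a| < r.
  by rewrite /= in_itv/= => /andP[? ?]; rewrite ltr_norml; apply/andP; split; lra.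
have p1 x y : `|x - a| < r -> partial1of2 f x y = df x y.
  by move=> xa; rewrite partial1of2E; case: (dfE x y xa).
have dd x y : `|x - a| < r -> derivable (f ^~ y) x 1 by move=> xa; case: (dfE x y xa).
have D := @derivable_under_integral _ _ _ mu f _ measurableT a _ _ Ia
  (fun x xI => lf x (inI x xI)) (fun x y xI _ => dd x y (inI x xI))
  G (fun y => le_trans (normr_ge0 _) (dG a y aa)) lG.
have E := @differentiation_under_integral _ _ _ mu f _ measurableT a _ _ Ia
  (fun x xI => lf x (inI x xI)) (fun x y xI _ => dd x y (inI x xI))
  G (fun y => le_trans (normr_ge0 _) (dG a y aa)) lG.
have H x y : `]a - r, a + r[%classic x -> setT y -> `|partial1of2 f x y| <= G y.
  by move=> /inI xI _; rewrite p1// dG.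
apply: DeriveDef; first exact: D H.
rewrite -derive1E (E H); apply: eq_Rintegral => y _; exact: p1.
Qed.

Section standard_normal.
Context (R : realType).
Local Notation mu := (@lebesgue_measure R).
Local Notation gamma := (normal_prob (0 : R) 1).
Local Notation g := (normal_pdf (0 : R) 1).

Lemma std_normal_pdfE x : g x = normal_peak 1 * expR (- (x ^+ 2 / 2)).
Proof.
by rewrite normal_pdfE ?oner_neq0// /normal_fun subr0 expr1n mulNr.
Qed.

Lemma L1_expR_sqr (c : R) : 0 < c -> L1 mu (fun x => expR (- (c * x ^+ 2))).
Proof.
move=> c0; pose s := (Num.sqrt (2 * c))^-1.
have s2 : s ^+ 2 = (2 * c)^-1 by rewrite exprVn sqr_sqrtr// mulr_ge0// ltW.
have s0 : s != 0 by rewrite invr_eq0 gt_eqF// sqrtr_gt0 mulr_gt0.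
apply: eq_L1 (L1Z (normal_peak s)^-1 (integrable_normal_pdf 0 s)) => x.
rewrite normal_pdfE// mulrA mulVf ?gt_eqF ?normal_peak_gt0// mul1r /normal_fun.
congr expR; rewrite subr0 s2.
by field; rewrite gt_eqF.
Qed.

Lemma L1_gauss_expR (c : R) : c < 2^-1 ->
  L1 gamma (fun x => expR (c * x ^+ 2)).
Proof.
move=> c2; apply/L1_normal_prob.
  by apply: measurableT_comp => //; apply: measurable_funM => //; exact: measurable_funX.
have c0 : 0 < 2^-1 - c by rewrite subr_gt0.
apply: eq_L1 (L1Z (normal_peak 1) (L1_expR_sqr c0)) => x.
rewrite std_normal_pdfE [RHS]mulrCA -expRD; congr (_ * expR _).
by field.
Qed.

Lemma std_normal_pdf_is_derive (x : R) : is_derive x 1 g (- x * g x).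
Proof.
have -> : g = cst (normal_peak 1) * (expR \o (- ((@id R) ^+ 2 * cst 2^-1))).
  by apply/funext => y; rewrite std_normal_pdfE.
apply: is_derive_eq; rewrite !fctE /GRing.scale/=; by field.
Qed.

Lemma continuous_std_normal_pdf : continuous g.
Proof. by apply: continuous_normal_pdf; exact: oner_neq0. Qed.

(** Half of the Gaussian exponent absorbs the linear factor, since
    [|t| <= 1 + t^2 / 4 <= expR (t^2 / 4)]. This dominates the derivative of a shifted density. *)
Lemma mul_std_normal_pdf_le (t : R) :
  `|t| * g t <= normal_peak 1 * expR (- (t ^+ 2 / 4)).
Proof.
have p0 := @normal_peak_ge0 R 1; rewrite std_normal_pdfE mulrCA ler_wpM2l//.
have -> : expR (- (t ^+ 2 / 2)) = expR (- (t ^+ 2 / 4)) * expR (- (t ^+ 2 / 4)).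
  by rewrite -expRD; congr expR; field.
rewrite mulrA ler_piMl ?expR_ge0// expRN ler_pdivrMr ?expR_gt0// mul1r.
apply: le_trans (expR_ge1Dx _); rewrite -(real_normK (num_real t)).
by have := sqr_ge0 (`|t| - 2); lra.
Qed.

(** The function [e |-> E h(x + e)] is differentiated at 0 in two ways: under the integral it gives
    [E h']; after the translation that moves the shift onto the density it gives [E (x h)], because
    [g' = - x g]. No boundary terms at infinity have to be handled. *)
Lemma stein_identity (h h' : R -> R) (M : R) :
  (forall x : R, is_derive x 1 h (h' x)) -> (forall x, `|h x| <= M) ->
  (forall x, `|h' x| <= M) ->
  \int[gamma]_x (x * h x) = \int[gamma]_x h' x.
Proof.
move=> dh hM h'M.
have ch : continuous h.
  by move=> x; apply/differentiable_continuous/derivable1_diffP; case: (dh x).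
have mh : measurable_fun setT h by exact: continuous_measurable_fun.
have cgs e : continuous (fun x : R => g (x - e)).
  move=> x; apply: (continuous_comp (f := fun x => x - e) (g := g)).
    by apply: (@cvgB _ R^o); [exact: cvg_id|exact: cvg_cst].
  exact: continuous_std_normal_pdf.
have cg e : continuous (fun x : R => h (x + e)).
  move=> x; apply: (continuous_comp (f := fun x => x + e) (g := h)); last exact: ch.
  by apply: (@cvgD _ R^o); [exact: cvg_id|exact: cvg_cst].
have lhe e : L1 gamma (fun x : R => h (x + e)).
  apply: (@L1_bounded _ _ _ gamma _ M) => //.
  by apply: continuous_measurable_fun; exact: cg.
pose I (e : R) := \int[gamma]_x h (x + e).
pose J (e : R) := \int[mu]_x (h x * g (x - e)).
have lJ e : L1 mu (fun x : R => h x * g (x - e)).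
  have lp : L1 mu (fun x : R => M * g (x - e)).
    apply: L1Z; apply: L1_translation; first exact: continuous_std_normal_pdf.
    exact: integrable_normal_pdf.
  apply: L1_dominated lp _.
    by apply: continuous_measurable_fun => x; apply: cvgM; [exact: ch|exact: cgs].
  by move=> x; rewrite normrM [`|g _|]ger0_norm ?ler_wpM2r ?normal_pdf_ge0.
have IJ e : I e = J e.
  rewrite /I (Rintegral_normal_prob (continuous_measurable_fun (cg e)) (lhe e)).
  rewrite /J -(Rintegral_translation e _ (lJ e)).
    by apply: eq_Rintegral => x _; rewrite addrK.
  by move=> x; apply: cvgM; [exact: ch|exact: cgs].
have dI : is_derive (0 : R) 1 I (\int[gamma]_x h' (x + 0)).
  apply: (@is_derive_under_integral R _ _ gamma (fun e x => h (x + e))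
    (fun e x => h' (x + e)) _ 1 (cst M)) => //.
  - move=> e x _.
    have := @is_derive_comp_affine _ h (h' (x + e)) x 1 e.
    have -> : (fun e => h (x + 1 * e)) = (fun e => h (x + e)).
      by apply/funext => y; rewrite mul1r.
    by rewrite !mul1r; apply; exact: dh.
  - exact: (@L1_cst _ _ _ gamma).
(* For [|e| <= 1] one has [- (x - e)^2 / 4 <= 1/4 - x^2 / 8], so a single Gaussian dominates all the
   shifted derivatives. *)
pose C : R := normal_peak 1 * expR (4^-1).
have dJ : is_derive (0 : R) 1 J (\int[mu]_x (h x * ((x - 0) * g (x - 0)))).
  apply: (@is_derive_under_integral R _ _ mu (fun e x => h x * g (x - e))
    (fun e x => h x * ((x - e) * g (x - e))) _ 1
    (fun x => M * C * expR (- (8^-1 * x ^+ 2)))) => //.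
  - move=> e x _.
    have dg : is_derive e 1 (fun e => g (x - e)) ((x - e) * g (x - e)).
      have := @is_derive_comp_affine _ g (- (x - e) * g (x - e)) x (-1) e.
      have -> : (fun e => g (x + -1 * e)) = (fun e => g (x - e)).
        by apply/funext => y; rewrite mulN1r.
      by rewrite !mulN1r mulNr opprK; apply; rewrite -mulNr;
        exact: std_normal_pdf_is_derive.
    have -> : (fun e => h x * g (x - e)) = (h x) \*: (fun e => g (x - e)).
      by apply/funext.
    exact: is_deriveZ.
  - by apply: L1Z; apply: L1_expR_sqr.
  - move=> e x; rewrite subr0 => e1.
    rewrite normrM -mulrA ler_pM// normrM [`|g _|]ger0_norm ?normal_pdf_ge0//.
    apply: (le_trans (mul_std_normal_pdf_le _)).
    rewrite /C -(mulrA (normal_peak 1)) -expRD.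
    rewrite (ler_wpM2l (normal_peak_ge0 1))// ler_expR.
    have e2 : e ^+ 2 <= 1.
      by rewrite -(real_normK (num_real e)) expr_le1// ltW.
    by have := sqr_ge0 (x - 2 * e); nra.
have := dI; rewrite (_ : I = J); last exact/funext.
case=> _ dI'; case: dJ => _; rewrite dI'.
have E0 : \int[gamma]_x h' (x + 0) = \int[gamma]_x h' x.
  by apply: eq_Rintegral => x _; rewrite addr0.
rewrite E0 => ->; rewrite Rintegral_normal_prob.
- by apply: eq_Rintegral => x _; rewrite !subr0; ring.
- by apply: measurable_funM.
- apply: (@L1_dominated _ _ _ gamma _ (fun x => M * (2 * expR (4^-1 * x ^+ 2)))).
  + exact: measurable_funM.
  + by do 2 apply: L1Z; apply: L1_gauss_expR; lra.
  + move=> x; rewrite normrM mulrC ler_pM//.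
    have := expR_ge1Dx (4^-1 * x ^+ 2); rewrite -(real_normK (num_real x)).
    by have := sqr_ge0 (`|x| - 1); lra.
Qed.

Lemma gauss_sqr_L1 : L1 gamma (fun x : R => x ^+ 2).
Proof.
apply: (@L1_dominated _ _ _ gamma _ (fun x => 4 * expR (4^-1 * x ^+ 2))).
- exact: measurable_funX.
- by apply: L1Z; apply: L1_gauss_expR; lra.
- move=> x; rewrite ger0_norm ?sqr_ge0//.
  by have := expR_ge1Dx (4^-1 * x ^+ 2); lra.
Qed.

Lemma gauss_id_L1 : L1 gamma (fun x : R => x).
Proof. by apply: (@L1_of_sqr _ _ _ gamma) => //; exact: gauss_sqr_L1. Qed.

Lemma gauss_mean : \int[gamma]_x x = 0.
Proof.
have := @stein_identity (cst 1) (cst 0) 1 (fun x => is_derive_cst _ _ _).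
rewrite /= normr1 normr0 => /(_ (fun _ => lexx _) (fun _ => ler01)).
under eq_Rintegral do rewrite mulr1.
by move=> ->; rewrite /Rintegral integral0.
Qed.

End standard_normal.

Lemma Rintegral_probability_cst d (T : measurableType d) (R : realType)
  (P : probability T R) (c : R) : \int[P]_t c = c.
Proof. by rewrite Rintegral_cst// [X in _ * fine X](probability_setT P) mulr1. Qed.

Section lipschitz.
Context (R : realType).

Lemma derive_lipschitz (f f' : R -> R) (L : R) :
  (forall x : R, is_derive x 1 f (f' x)) -> (forall x, `|f' x| <= L) ->
  forall x y, `|f x - f y| <= L * `|x - y|.
Proof.
move=> df f'L.
have cf : continuous f.
  by move=> x; apply/differentiable_continuous/derivable1_diffP; case: (df x).
have H x y : x <= y -> `|f y - f x| <= L * `|y - x|.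
  move=> xy; have [|c _ ->] := @MVT_segment _ f f' x y xy (fun z _ => df z).
    exact: continuous_subspaceT.
  by rewrite normrM ler_wpM2r.
move=> x y; have [xy|/ltW yx] := leP x y; last exact: H.
by rewrite distrC (distrC x); exact: H.
Qed.

End lipschitz.

Section normal_law.
Context (R : realType).

(* [normal_prob m s] lives on [measurableTypeR R], whose display differs from
   that of [R]; [normal_law m s] is the same measure for the display of [R]. *)
Definition normal_law (m s : R) (A : set R) : \bar R := normal_prob m s A.

Section normal_law_measure.
Variables m s : R.
Let normal_law0 : normal_law m s set0 = 0%E.
Proof. exact: (measure0 (normal_prob m s)). Qed.
Let normal_law_ge0 A : (0 <= normal_law m s A)%E.
Proof. exact: (measure_ge0 (normal_prob m s)). Qed.
Let normal_law_sigma_additive : semi_sigma_additive (normal_law m s).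
Proof. exact: (@measure_semi_sigma_additive _ _ _ (normal_prob m s)). Qed.
HB.instance Definition _ := isMeasure.Build _ _ _ (normal_law m s)
  normal_law0 normal_law_ge0 normal_law_sigma_additive.
Let normal_law_setT : normal_law m s setT = 1%E.
Proof. exact: (probability_setT (normal_prob m s)). Qed.
HB.instance Definition _ :=
  @Measure_isProbability.Build _ _ R (normal_law m s) normal_law_setT.
End normal_law_measure.

Definition std_normal : probability R R := normal_law 0 1.

(** Transport along the identity map between the two displays of the real line. *)
Lemma ge0_integral_normal_law (m s : R) (f : R -> \bar R) :
  measurable_fun setT f -> (forall x, 0 <= f x)%E ->
  (\int[normal_law m s]_x f x = \int[normal_prob m s]_x f x)%E.
Proof.
move=> mf f0; have mid : measurable_fun [set: measurableTypeR R] (fun x : measurableTypeR R => x : R).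
  by move=> _ Y mY; rewrite setTI.
transitivity (\int[pushforward (normal_prob m s) (fun x : measurableTypeR R => x : R)]_x f x)%E.
  by apply: eq_measure_integral.
by rewrite (@ge0_integral_pushforward _ _ _ _ _ _ mid (normal_prob m s) setT f)//.
Qed.

Lemma L1_normal_law (m s : R) (f : R -> R) : measurable_fun setT f ->
  L1 (normal_prob m s) f -> L1 (normal_law m s) f.
Proof.
move=> mf /integrableP[_ lf]; apply/integrableP; split; first exact/measurable_EFinP.
rewrite (ge0_integral_normal_law m s (f := fun x => `|(f x)%:E|%E))//.
by apply: measurableT_comp => //; exact/measurable_EFinP.
Qed.

Lemma Rintegral_normal_law (m s : R) (f : R -> R) : measurable_fun setT f ->
  \int[normal_law m s]_x f x = \int[normal_prob m s]_x f x.
Proof.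
move=> mf; rewrite /Rintegral integralE [in RHS]integralE; congr (fine (_ - _)).
- rewrite (ge0_integral_normal_law m s (f := (fun x => (f x)%:E)^\+%E))//.
  by apply: measurable_funepos; exact/measurable_EFinP.
- rewrite (ge0_integral_normal_law m s (f := (fun x => (f x)%:E)^\-%E))//.
  by apply: measurable_funeneg; exact/measurable_EFinP.
Qed.

End normal_law.
Arguments std_normal {R}.

Section normal_moments.
Context (R : realType).
Local Notation gamma := (@std_normal R).

Lemma L1_std_normal_expR (c : R) : c < 2^-1 -> L1 gamma (fun x => expR (c * x ^+ 2)).
Proof.
move=> c2; apply: L1_normal_law; last exact: L1_gauss_expR.
by apply: measurableT_comp => //; apply: measurable_funM => //; exact: measurable_funX.
Qed.

Lemma std_normal_stein (h h' : R -> R) (M : R) :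
  measurable_fun setT h' ->
  (forall x : R, is_derive x 1 h (h' x)) -> (forall x, `|h x| <= M) ->
  (forall x, `|h' x| <= M) ->
  \int[gamma]_x (x * h x) = \int[gamma]_x h' x.
Proof.
move=> mh' dh hM h'M.
have mh : measurable_fun setT h.
  apply: continuous_measurable_fun => x.
  by apply/differentiable_continuous/derivable1_diffP; case: (dh x).
rewrite !Rintegral_normal_law//; first exact: stein_identity h'M.
exact: measurable_funM.
Qed.

Lemma std_normal_sqr_L1 : L1 gamma (fun x : R => x ^+ 2).
Proof. by apply: L1_normal_law; [exact: measurable_funX|exact: gauss_sqr_L1]. Qed.

Lemma std_normal_L1 : L1 gamma (fun x : R => x).
Proof. by apply: L1_normal_law => //; exact: gauss_id_L1. Qed.

Lemma std_normal_mean : \int[gamma]_x x = 0.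
Proof. by rewrite Rintegral_normal_law// gauss_mean. Qed.

(** The Stein identity asks for bounded functions, which excludes [h = id]. It is applied to
    [sin (t x)], giving [E (x sin (t x)) = t E cos (t x)], and this equality is differentiated at
    [t = 0]. *)
Lemma std_normal_sqr : \int[gamma]_x x ^+ 2 = 1.
Proof.
have dsin (x t : R) : is_derive t 1 (fun t => sin (t * x)) (x * cos (t * x)).
  have := @is_derive_comp_affine _ sin (cos (t * x)) 0 x t.
  have -> : (fun e : R => sin (0 + x * e)) = (fun e => sin (e * x)).
    by apply/funext => y; rewrite add0r mulrC.
  by rewrite add0r (mulrC x t); apply; exact: is_derive_sin.
have dcos (x t : R) : is_derive t 1 (fun t => cos (t * x)) (x * - sin (t * x)).
  have := @is_derive_comp_affine _ cos (- sin (t * x)) 0 x t.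
  have -> : (fun e : R => cos (0 + x * e)) = (fun e => cos (e * x)).
    by apply/funext => y; rewrite add0r mulrC.
  by rewrite add0r (mulrC x t); apply; exact: is_derive_cos.
have msin (t : R) : measurable_fun setT (fun x : R => sin (t * x)).
  apply: measurableT_comp; last exact: measurable_funM.
  by apply: continuous_measurable_fun; exact: continuous_sin.
have mcos (t : R) : measurable_fun setT (fun x : R => cos (t * x)).
  apply: measurableT_comp; last exact: measurable_funM.
  by apply: continuous_measurable_fun; exact: continuous_cos.
have sin1 (t : R) : `|sin t| <= 1 by rewrite ler_norml sin_geN1 sin_le1.
have cos1 (t : R) : `|cos t| <= 1 by rewrite ler_norml cos_geN1 cos_le1.
pose k (t : R) := \int[gamma]_x cos (t * x).
have steint (t : R) : \int[gamma]_x (x * sin (t * x)) = t * k t.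
  rewrite /k -RintegralZl//; last first.
    by apply: (@L1_bounded _ _ _ gamma _ 1 (mcos t)) => x; exact: cos1.
  apply: (@std_normal_stein (fun x => sin (t * x)) _ (`|t| + 1)) => [|x|x|x].
  - exact: measurable_funM.
  - have -> : (fun x => sin (t * x)) = (fun x => sin (x * t)).
      by apply/funext => y; rewrite mulrC.
    by rewrite (mulrC t x); exact: dsin.
  - by rewrite (le_trans (sin1 _))// lerDr.
  - by rewrite normrM (@le_trans _ _ `|t|)// ?lerDl// ler_piMr.
have dl : is_derive (0 : R) 1 (fun t => \int[gamma]_x (x * sin (t * x)))
    (\int[gamma]_x (x * (x * cos (0 * x)))).
  apply: (@is_derive_under_integral R _ _ gamma (fun t x => x * sin (t * x))
    (fun t x => x * (x * cos (t * x))) 0 1 (fun x => x ^+ 2)) => //.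
  - move=> t _.
    have m1 : measurable_fun setT (fun x : R => x * sin (t * x)) by exact: measurable_funM.
    apply: (@L1_dominated _ _ _ gamma _ (fun x => `|x|)); first exact: m1.
    + by apply: L1_abs; exact: std_normal_L1.
    + by move=> x; rewrite normrM ler_piMr.
  - exact: std_normal_sqr_L1.
  - move=> t x _; rewrite mulrA normrM -expr2 [`|x ^+ 2|]ger0_norm ?sqr_ge0//.
    by rewrite ler_piMr ?sqr_ge0.
have dk : is_derive (0 : R) 1 k (\int[gamma]_x (x * - sin (0 * x))).
  apply: (@is_derive_under_integral R _ _ gamma (fun t x => cos (t * x))
    (fun t x => x * - sin (t * x)) 0 1 (fun x => `|x|)) => //.
  - by move=> t _; apply: (@L1_bounded _ _ _ gamma _ 1 (mcos t)) => x; exact: cos1.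
  - by apply: L1_abs; exact: std_normal_L1.
  - by move=> t x _; rewrite normrM normrN ler_piMr.
have dr : is_derive (0 : R) 1 (fun t => t * k t) (k 0).
  have -> : (fun t => t * k t) = (@id R) * k by apply/funext.
  apply: is_derive_eq; rewrite /GRing.scale/= mul0r add0r mulr1//.
have k0 : k 0 = 1.
  rewrite /k; under eq_Rintegral do rewrite mul0r cos0.
  exact: Rintegral_probability_cst.
have E : (fun t => \int[gamma]_x (x * sin (t * x))) = (fun t => t * k t) by exact/funext.
move: dl; rewrite E => -[_]; case: dr => _ ->; rewrite k0 => ->.
by apply: eq_Rintegral => x _; rewrite mul0r cos0 mulr1 expr2.
Qed.

End normal_moments.

Section equal_laws.
Context d1 d2 (T1 : measurableType d1) (T2 : measurableType d2) (R : realType).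
Variables (P1 : {measure set T1 -> \bar R}) (P2 : {measure set T2 -> \bar R}).
Variables (X : T1 -> R) (Y : T2 -> R).
Hypothesis mX : measurable_fun setT X.
Hypothesis XY : forall f : R -> R, continuous f -> (forall x, 0 <= f x) ->
  (\int[P1]_t (f (X t))%:E = \int[P2]_t (f (Y t))%:E)%E.

(** As for translations, the signed case is the difference of the nonnegative cases [f + |f|] and
    [|f|]. *)
Lemma equal_laws_integral (f : R -> R) : continuous f ->
  L1 P2 (fun t => f (Y t)) ->
  L1 P1 (fun t => f (X t)) /\ \int[P1]_t f (X t) = \int[P2]_t f (Y t).
Proof.
move=> cf lf.
have mf : measurable_fun setT f by exact: continuous_measurable_fun.
have cn : continuous (fun x : R => `|f x|).
  by move=> x; apply: (continuous_comp (cf x)); exact: norm_continuous.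
have cp : continuous (fun x : R => f x + `|f x|).
  by move=> x; apply: (@cvgD _ R^o); [exact: cf|exact: cn].
have E1 := XY cn (fun x => normr_ge0 _).
have lX : L1 P1 (fun t => f (X t)).
  apply/integrableP; split; first exact/measurable_EFinP/measurableT_comp.
  by move: E1; rewrite /comp /= => ->; case/integrableP : lf.
split => //.
have E2 := XY cp.
have {E2} /(congr1 fine) : (\int[P1]_t (f (X t) + `|f (X t)|)%:E =
    \int[P2]_t (f (Y t) + `|f (Y t)|)%:E)%E.
  by apply: E2 => x; have := ler_norm (- f x); rewrite normrN; lra.
rewrite -![fine _]/(Rintegral _ _ _).
rewrite (RintegralD measurableT lX (L1_abs lX)).
rewrite (RintegralD measurableT lf (L1_abs lf)).
rewrite [X in _ + X = _](congr1 fine E1 : _ = \int[P2]_x `|f (Y x)|).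
exact: addIr.
Qed.

End equal_laws.

Section has_law_integral.
Context d (T : measurableType d) (R : realType) (P : probability T R).
Variables (X : T -> R) (mu : {measure set R -> \bar R}).
Hypothesis lawX : has_law P X mu.

Lemma has_law_measurable : measurable_fun setT X.
Proof. by case: lawX. Qed.

Lemma has_law_ge0_integral (f : R -> \bar R) : measurable_fun setT f ->
  (forall x, 0 <= f x)%E -> (\int[P]_t f (X t) = \int[mu]_x f x)%E.
Proof.
move=> mf f0; have mX := has_law_measurable.
rewrite -(@ge0_integral_pushforward _ _ _ _ _ X mX P setT f)//.
by apply: eq_measure_integral => A mA _; case: lawX => _ /(_ _ mA) <-.
Qed.

Lemma has_law_L1 (f : R -> R) : measurable_fun setT f ->
  L1 mu f -> L1 P (fun t => f (X t)).
Proof.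
move=> mf /integrableP[_ lf]; apply/integrableP; split.
  by apply/measurable_EFinP; exact: measurableT_comp has_law_measurable.
rewrite (has_law_ge0_integral (f := fun x => `|(f x)%:E|%E))//.
by apply: measurableT_comp => //; exact/measurable_EFinP.
Qed.

Lemma has_law_Rintegral (f : R -> R) : measurable_fun setT f ->
  L1 mu f -> \int[P]_t f (X t) = \int[mu]_x f x.
Proof.
move=> mf lf; have lX := has_law_L1 mf lf.
rewrite /Rintegral integralE [in RHS]integralE; congr (fine (_ - _)).
- rewrite -(has_law_ge0_integral (f := (fun x => (f x)%:E)^\+%E))//; last first.
    by apply: measurable_funepos; exact/measurable_EFinP.
  by apply: eq_integral => t _; rewrite !funeposE.
- rewrite -(has_law_ge0_integral (f := (fun x => (f x)%:E)^\-%E))//; last first.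
    by apply: measurable_funeneg; exact/measurable_EFinP.
  by apply: eq_integral => t _; rewrite !funenegE.
Qed.

End has_law_integral.

Section gaussian_law_integral.
Context d (T : measurableType d) (R : realType) (P : probability T R).
Local Notation gamma := (@std_normal R).

(** Substitution along [z |-> m + |s| z]. The absolute value makes the map increasing, and the
    density only depends on [s] through [s ^+ 2]. *)
Lemma normal_law_affine (m s : R) (f : R -> R) : s != 0 -> continuous f ->
  (forall x, 0 <= f x) ->
  (\int[normal_law m s]_x (f x)%:E = \int[gamma]_z (f (m + `|s| * z))%:E)%E.
Proof.
move=> s0 cf f0; have ns : 0 < `|s| by rewrite normr_gt0.
pose F (x : R) : R := m + `|s| * x.
have dF (x : R) : is_derive x 1 F `|s|.
  have -> : F = cst m + `|s| \*: (@id R) by apply/funext.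
  by apply: is_derive_eq; rewrite add0r /GRing.scale/= mulr1.
have cF : continuous F.
  by move=> x; apply/differentiable_continuous/derivable1_diffP; case: (dF x).
have F'E : F^`()%classic = cst `|s|.
  by apply/funext => x; rewrite derive1E; case: (dF x).
have mf : measurable_fun setT f by exact: continuous_measurable_fun.
have mfF : measurable_fun setT (fun z : R => (f (F z))%:E).
  apply/measurable_EFinP; apply: (measurableT_comp mf).
  exact: continuous_measurable_fun.
have mfE : measurable_fun setT (fun z : R => (f z)%:E) by exact/measurable_EFinP.
have f0E x : (0 <= (f x)%:E)%E by rewrite lee_fin.
rewrite (ge0_integral_normal_law m s mfE f0E).
rewrite (ge0_integral_normal_law 0 1 mfF (fun z => f0E (F z))).
rewrite (ge0_integral_normal_prob m s mfE f0E).
rewrite (ge0_integral_normal_prob 0 1 mfF (fun z => f0E (F z))).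
transitivity (\int[lebesgue_measure]_x (f x * normal_pdf m s x)%:E)%E.
  by apply: eq_integral => x _; rewrite EFinM.
rewrite (@increasing_ge0_integration_by_substitutionT _ F
  (fun x => f x * normal_pdf m s x))//.
- apply: eq_integral => z _; rewrite F'E !fctE -EFinM; congr EFin.
  rewrite -mulrA; congr (_ * _); rewrite !normal_pdfE ?oner_neq0//.
  rewrite mulrAC; congr (_ * _).
    rewrite /normal_peak expr1n mul1r -mulrnAr sqrtrM ?sqr_ge0// sqrtr_sqr invfM.
    by rewrite mulrC mulrA divff ?gt_eqF// mul1r.
  rewrite /normal_fun /F addrAC subrr add0r subr0 exprMn real_normK ?num_real//.
  by congr expR; field.
- by move=> x y xy; rewrite /F ltrD2l ltr_pM2l.
- by rewrite F'E => x; exact: cvg_cst.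
- by rewrite F'E; exact: is_cvg_cst.
- by rewrite F'E; exact: is_cvg_cst.
- apply: (@cvg_comp _ _ _ (fun x : R => `|s| * x) (fun y => m + y) _ (ninfty_nbhs R));
    last exact: cvg_addrl_Ny.
  under eq_fun do rewrite mulrC.
  exact: (gt0_cvgMlNy ns cvg_id).
- apply: (@cvg_comp _ _ _ (fun x : R => `|s| * x) (fun y => m + y) _ (pinfty_nbhs R));
    last exact: cvg_addrl.
  under eq_fun do rewrite mulrC.
  exact: (gt0_cvgMly ns cvg_id).
- move=> x; apply: cvgM; [exact: cf|exact: continuous_normal_pdf].
- by move=> x; rewrite mulr_ge0// normal_pdf_ge0.
Qed.

Variables (X : T -> R) (m s : R).
Hypothesis lawX : has_law P X (gaussian_law m s).

(** One formula covers both branches of [gaussian_law]: for [s = 0] the law is the point mass at [m]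
    and the affine map is constant. *)
Let XE (f : R -> R) : continuous f -> (forall x, 0 <= f x) ->
  (\int[P]_t (f (X t))%:E = \int[gamma]_z (f (m + `|s| * z))%:E)%E.
Proof.
move=> cf f0; have mf : measurable_fun setT f by exact: continuous_measurable_fun.
move: lawX; rewrite /gaussian_law; case: eqVneq => [->|s0] l.
  rewrite (has_law_ge0_integral (mu := \d_m) l (f := fun x => (f x)%:E)); last first.
  - by move=> x; rewrite lee_fin.
  - exact/measurable_EFinP.
  rewrite integral_dirac//; last exact/measurable_EFinP.
  rewrite diracT mul1e; under eq_integral do rewrite normr0 mul0r addr0.
  by rewrite integral_cst//= (probability_setT gamma) mule1.
rewrite (has_law_ge0_integral (mu := normal_law m s) l (f := fun x => (f x)%:E)); last first.
- by move=> x; rewrite lee_fin.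
- exact/measurable_EFinP.
exact: normal_law_affine.
Qed.

Lemma gaussian_law_Rintegral (f : R -> R) : continuous f ->
  L1 gamma (fun z : R => f (m + `|s| * z)) ->
  L1 P (fun t => f (X t)) /\
  \int[P]_t f (X t) = \int[gamma]_z f (m + `|s| * z).
Proof.
move=> cf lf; exact: (equal_laws_integral (proj1 lawX) XE cf lf).
Qed.

Lemma gaussian_law_mean : L1 P X /\ \int[P]_t X t = m.
Proof.
have lz : L1 gamma (fun z : R => `|s| * z) by apply: L1Z; exact: std_normal_L1.
have l1 : L1 gamma (fun z : R => m + `|s| * z).
  by apply: L1D => //; exact: (@L1_cst _ _ _ gamma).
have [l e] := @gaussian_law_Rintegral id (fun x => cvg_id) l1; split => //.
rewrite e (RintegralD measurableT (@L1_cst _ _ _ gamma m) lz).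
rewrite (@RintegralZl _ _ _ gamma _ _ _ measurableT (std_normal_L1 R)) std_normal_mean mulr0 addr0.
exact: Rintegral_probability_cst.
Qed.

Lemma gaussian_law_sqr : m = 0 ->
  L1 P (fun t => X t ^+ 2) /\ \int[P]_t X t ^+ 2 = s ^+ 2.
Proof.
move=> m0.
have l2 : L1 gamma (fun z : R => (m + `|s| * z) ^+ 2).
  apply: eq_L1 (L1Z (s ^+ 2) (std_normal_sqr_L1 R)) => z.
  by rewrite m0 add0r exprMn real_normK ?num_real.
have [l e] := @gaussian_law_Rintegral (fun x => x ^+ 2) (@sqr_continuous _) l2.
split => //; rewrite e; transitivity (\int[gamma]_z (s ^+ 2 * z ^+ 2)).
  by apply: eq_Rintegral => z _; rewrite m0 add0r exprMn real_normK ?num_real.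
by rewrite (@RintegralZl _ _ _ gamma _ _ _ measurableT (std_normal_sqr_L1 R)) std_normal_sqr mulr1.
Qed.

End gaussian_law_integral.

(** * Independence and integration by parts *)

Section independence.
Context d (T : measurableType d) (R : realType) (P : probability T R).
Variables (I : eqType) (X : I -> T -> R) (i0 : I) (mu : probability R R).
Hypothesis mX : forall i, measurable_fun setT (X i).
Hypothesis indX : mutually_independent P X.
Hypothesis lawX : has_law P (X i0) mu.

(** A pi-system generating the sigma-algebra of all the variables except [X i0]. [TG] is the space
    [T] with this coarser sigma-algebra, so a function of the remaining variables is just a
    [TG]-measurable function, and no joint value space is needed. *)
Definition other_cylinders : set (set T) :=
  [set A | exists (s : seq I) (B : I -> set R), [/\ uniq s, i0 \notin s,
    (forall i, measurable (B i)) &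
    A = \bigcap_(i in [set` s]) (X i @^-1` B i)]].

Local Notation TG := (g_sigma_algebraType other_cylinders).

Lemma other_cylinders_measurable A : other_cylinders A -> measurable A.
Proof.
move=> [s [B [us i0s mB ->]]].
apply: fin_bigcap_measurable => [|i _]; first exact: finite_seq.
by rewrite -[X in measurable X]setTI; exact: mX.
Qed.

Lemma other_cylinders_setI : setI_closed other_cylinders.
Proof.
move=> _ _ [s1 [B1 [u1 i1 m1 ->]]] [s2 [B2 [u2 i2 m2 ->]]].
pose B i := (if i \in s1 then B1 i else setT) `&` (if i \in s2 then B2 i else setT).
exists (undup (s1 ++ s2)), B; split.
- exact: undup_uniq.
- by rewrite mem_undup mem_cat negb_or i1.
- by move=> i; apply: measurableI; case: ifP.
- apply/seteqP; split=> [t [H1 H2] i /=|t H].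
    rewrite mem_undup mem_cat /B => _.
    split; case: ifPn => // ii; [exact: H1|exact: H2].
  split=> i /= ii; have := H i; rewrite /= mem_undup mem_cat ii ?orbT => /(_ isT);
    by rewrite /B /preimage /= ii => -[].
Qed.

Lemma other_cylinders_setT : other_cylinders setT.
Proof.
exists [::], (fun=> setT); split => //.
by rewrite (_ : [set` [::]] = set0) ?bigcap_set0//; apply/seteqP; split.
Qed.

Lemma other_sigma_measurable A : (<<s other_cylinders >>) A -> measurable A.
Proof.
move: A; apply: smallest_sub; first exact: sigma_algebra_measurable.
exact: other_cylinders_measurable.
Qed.

Lemma measurable_other i : i != i0 -> measurable_fun [set: TG] (X i : TG -> R).
Proof.
move=> ii0 _ B mB; rewrite setTI; apply: sub_sigma_algebra.
exists [:: i], (fun=> B); split => //; first by rewrite inE eq_sym.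
apply/seteqP; split=> t; first by move=> Xt j /=; rewrite inE => /eqP ->.
by apply; rewrite /= inE.
Qed.

Lemma measurable_fun_other d' (T' : measurableType d') (f : TG -> T') :
  measurable_fun [set: TG] f -> measurable_fun [set: T] (f : T -> T').
Proof.
move=> mf _ B mB; apply: other_sigma_measurable.
exact: mf.
Qed.

(** The finite measures [D |-> P (D & X i0 in A)] and [mu A * P D] agree on the cylinders by mutual
    independence, hence on the sigma-algebra they generate. *)
Lemma indep_rectangle A D : measurable A -> (<<s other_cylinders >>) D ->
  P (X i0 @^-1` A `&` D) = (mu A * P D)%E.
Proof.
move=> mA sD.
have mXA : measurable (X i0 @^-1` A) by rewrite -[X in measurable X]setTI; exact: mX.
have muA : mu A \is a fin_num by exact: fin_num_measure.
pose k : {nonneg R} := NngNum (fine_ge0 (measure_ge0 mu A)).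
have E F : (mu A * P F)%E = mscale k P F by rewrite /mscale /= fineK.
rewrite setIC -[LHS]/(mrestr P mXA D).
rewrite E.
move: D sD; apply: (@g_sigma_algebra_measure_unique _ _ _ other_cylinders _ (fun=> setT) _ _ (mrestr P mXA) (mscale k P)).
- exact: other_cylinders_measurable.
- by move=> _; exact: other_cylinders_setT.
- exact: bigcup_const.
- exact: other_cylinders_setI.
- move=> D [s [B [us i0s mB ->]]].
  transitivity (mu A * P (\bigcap_(i in [set` s]) X i @^-1` B i))%E; last exact: E.
  (* The event on [X i0] is put at the head of the index list, which turns the claim into an
     instance of mutual independence. *)
  pose B' i := if i == i0 then A else B i.
  have mB' i : measurable (B' i) by rewrite /B'; case: ifP.
  have us' : uniq (i0 :: s) by rewrite /= i0s.
  have bs i : i \in s -> B' i = B i.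
    by rewrite /B'; case: eqVneq => // -> ; rewrite (negbTE i0s).
  have Bi0 : B' i0 = A by rewrite /B' eqxx.
  have := indX us' mB'; rewrite big_cons Bi0.
  have -> : (\prod_(j <- s) P (X j @^-1` B' j) = \prod_(j <- s) P (X j @^-1` B j))%E.
    by rewrite !big_seq; apply: eq_bigr => i /bs ->.
  rewrite -(indX us mB).
  have -> : \bigcap_(i in [set` i0 :: s]) X i @^-1` B' i =
      (\bigcap_(i in [set` s]) X i @^-1` B i) `&` X i0 @^-1` A.
    apply/seteqP; split=> t.
      move=> H; split.
        by move=> i /= ii; have := H i; rewrite /= inE ii orbT bs//; exact.
      by have := H i0; rewrite /= inE eqxx /B' eqxx; exact.
    move=> [H1 H2] i /=; rewrite inE => /orP[/eqP ->|ii]; first by rewrite /B' eqxx.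
    by rewrite bs//; exact: H1.
  move=> H; transitivity (P (X i0 @^-1` A) * P (\bigcap_(i in [set` s]) X i @^-1` B i))%E.
    exact: H.
  by case: lawX => _ /(_ _ mA) ->.
- move=> _; have : (P (setT `&` X i0 @^-1` A) < +oo)%E.
    by rewrite setTI (le_lt_trans (probability_le1 P mXA))// ltry.
  exact.
Qed.

Let idG (t : T) : TG := t.
Lemma measurable_id_other : measurable_fun setT idG.
Proof. by move=> _ B mB; rewrite setTI; exact: other_sigma_measurable. Qed.
HB.instance Definition _ := isMeasurableFun.Build _ _ _ _ idG measurable_id_other.

Let pairG (t : T) : R * TG := (X i0 t, t).
Let measurable_pairG : measurable_fun setT pairG.
Proof. by apply: measurable_fun_pair; [exact: mX|exact: measurable_id_other]. Qed.
HB.instance Definition _ := isMeasurableFun.Build _ _ _ _ pairG measurable_pairG.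

Let PG : probability TG R := distribution P idG.

(** [PG] is [P] restricted to the events of the other variables. Since [X i0] is independent of
    them, the pair [(X i0, id)] has a product law; rectangles suffice to check it. *)
Let law_pair A : measurable A -> ((mu \x PG) A = distribution P pairG A)%E.
Proof.
apply: product_measure_unique => B D mB mD.
rewrite /= /distribution /pushforward -(indep_rectangle mB)//.
Qed.

(** Tonelli for the product law: the other variables are frozen and [X i0] is integrated alone. *)
Lemma indep_ge0_integral (f : R * TG -> \bar R) : measurable_fun setT f ->
  (forall x, 0 <= f x)%E ->
  (\int[P]_t f (X i0 t, t) = \int[P]_t \int[mu]_z f (z, t))%E.
Proof.
move=> mf f0.
transitivity (\int[distribution P pairG]_x f x)%E.
  by rewrite (ge0_integral_distribution pairG).
transitivity (\int[(mu \x PG)%E]_x f x)%E.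
  by apply: eq_measure_integral => A mA _; apply/esym; exact: law_pair.
rewrite (@fubini_tonelli2 _ _ _ _ _ mu PG f)//.
rewrite [LHS](ge0_integral_distribution idG)//.
- exact: (@measurable_fun_fubini_tonelli_G _ _ _ _ _ mu f).
- by move=> y; apply: integral_ge0.
Qed.

(** Equality of the inner integrals for each frozen [t] is enough, by Fubini. A one-dimensional
    identity thus lifts to the whole probability space. *)
Lemma indep_eq_Rintegral (f1 f2 : R * TG -> R) :
  measurable_fun setT f1 -> measurable_fun setT f2 ->
  L1 P (fun t => f1 (X i0 t, t)) -> L1 P (fun t => f2 (X i0 t, t)) ->
  (forall t, \int[mu]_z (f1 (z, t))%:E = \int[mu]_z (f2 (z, t))%:E)%E ->
  \int[P]_t f1 (X i0 t, t) = \int[P]_t f2 (X i0 t, t).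
Proof.
have key (f : R * TG -> R) : measurable_fun setT f ->
    L1 P (fun t => f (X i0 t, t)) ->
    \int[P]_t f (X i0 t, t) = fine (\int[PG]_t \int[mu]_z (f (z, t))%:E).
  move=> mf lf; rewrite /Rintegral; congr fine.
  have mfE : measurable_fun setT (fun x => (f x)%:E) by exact/measurable_EFinP.
  have lprod : (mu \x PG)%E.-integrable setT (fun x => (f x)%:E).
    apply/integrableP; split => //.
    rewrite (eq_measure_integral (distribution P pairG)); last first.
      by move=> A mA _; exact: law_pair.
    rewrite (ge0_integral_distribution pairG)//.
      by case/integrableP : lf.
    exact: measurableT_comp.
  transitivity (\int[distribution P pairG]_x (f x)%:E)%E.
    by rewrite (integral_distribution (X := pairG) mfE lf).
  transitivity (\int[(mu \x PG)%E]_x (f x)%:E)%E.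
    by apply: eq_measure_integral => A mA _; apply/esym; exact: law_pair.
  by rewrite -(@integral21_prod_meas1 _ _ _ _ _ mu PG _ lprod).
move=> m1 m2 l1 l2 e12; rewrite (key _ m1 l1) (key _ m2 l2); congr fine.
by apply: eq_integral => t _; exact: e12.
Qed.

Lemma indep_L1M (f : R -> R) (g : TG -> R) : measurable_fun setT f ->
  measurable_fun [set: TG] g -> L1 mu f -> L1 P (g : T -> R) ->
  L1 P (fun t => f (X i0 t) * g t).
Proof.
move=> mf mg lf lg; have mgT := measurable_fun_other mg.
have mX0 := mX i0.
apply/integrableP; split.
  by apply/measurable_EFinP; apply: measurable_funM => //; exact: measurableT_comp mX0.
rewrite /comp (@indep_ge0_integral (fun x => `|(f x.1 * g x.2)%:E|%E))//; last first.
  apply: measurableT_comp => //; apply/measurable_EFinP; apply: measurable_funM.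
    exact: measurableT_comp.
  exact: measurableT_comp.
under eq_integral => t _.
  under eq_integral => z _ do rewrite /= normrM EFinM.
  rewrite ge0_integralZr//; last first.
    by apply/measurable_EFinP; exact: measurableT_comp.
  over.
rewrite ge0_integralZl//.
- apply: lte_mul_pinfty; first exact: integral_ge0.
    by rewrite ge0_fin_numE ?integral_ge0//; case/integrableP : lf.
  by case/integrableP : lg.
- by apply/measurable_EFinP; exact: measurableT_comp.
- exact: integral_ge0.
Qed.

Lemma indep_RintegralM (f : R -> R) (g : TG -> R) : measurable_fun setT f ->
  measurable_fun [set: TG] g -> L1 mu f -> L1 P (g : T -> R) ->
  \int[P]_t (f (X i0 t) * g t) = \int[mu]_z f z * \int[P]_t g t.
Proof.
move=> mf mg lf lg; rewrite -(@RintegralZl _ _ _ P _ _ _ measurableT lg).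
have mfg : measurable_fun [set: R * TG] (fun x => f x.1 * g x.2).
  by apply: measurable_funM; exact: measurableT_comp.
have mg2 : measurable_fun [set: R * TG] (fun x => \int[mu]_z f z * g x.2).
  by apply: measurable_funM => //; exact: measurableT_comp.
apply: (indep_eq_Rintegral mfg mg2).
- exact: indep_L1M.
- exact: L1Z.
- move=> t /=; rewrite integral_cst//= probability_setT mule1 EFinM.
  rewrite EFin_Rintegral//.
  rewrite -(integralZr measurableT lf).
  by apply: eq_integral => z _; rewrite EFinM.
Qed.

End independence.

Section integration_by_parts.
Context d (T : measurableType d) (R : realType) (P : probability T R).
Variables (I : eqType) (X : I -> T -> R) (i0 : I).
Hypothesis mX : forall i, measurable_fun setT (X i).
Hypothesis indX : mutually_independent P X.
Hypothesis lawX : has_law P (X i0) std_normal.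
Local Notation TG := (g_sigma_algebraType (other_cylinders X i0)).

(** The derivative is the pointwise limit of the difference quotients with steps [1 / (n + 1)], each
    of which is jointly measurable. *)
Lemma measurable_partial_derivative d' (T' : measurableType d') (H H' : R -> T' -> R) :
  measurable_fun [set: R * T'] (fun x => H x.1 x.2) ->
  (forall (z : R) t, is_derive z 1 (H ^~ t) (H' z t)) ->
  measurable_fun [set: R * T'] (fun x => H' x.1 x.2).
Proof.
move=> mH dH.
pose e (n : nat) : R := n.+1%:R^-1.
pose F n (x : R * T') := (e n)^-1 * (H (x.1 + e n) x.2 - H x.1 x.2).
apply: (measurable_fun_cvg (h := F)) => [n|x _].
  apply: measurable_funM => //; apply: measurable_funB => //.
  apply: (measurableT_comp (f := fun x => H x.1 x.2) (g := fun x : R * T' => (x.1 + e n, x.2))) => //.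
  apply: measurable_fun_pair => //=; exact: measurable_funD.
have /cvg_ex[/= l Hl] : derivable (H ^~ x.2) x.1 1 by case: (dH x.1 x.2).
have lE : H' x.1 x.2 = l.
  case: (dH x.1 x.2) => _ <-; apply/cvg_lim => //.
rewrite lE.
have /cvgr_dnbhsP Hl' := Hl.
have : (forall n, e n != 0) /\ (e n @[n --> \oo] --> (0 : R)).
  by split=> [n|]; [rewrite invr_eq0 pnatr_eq0|exact: cvg_harmonic].
move=> /Hl'; apply: cvg_trans; apply: near_eq_cvg; apply: nearW => n.
by rewrite /F /GRing.scale /= mulr1 [e n + _]addrC.
Qed.

(** The Stein identity in [X i0] with the other variables frozen. The bound [b] may depend on those
    variables: boundedness is used for each fixed [t], and integrability of [b] for the outer
    integral. *)
Lemma gaussian_integration_by_parts (H H' : R -> T -> R) (b : T -> R) :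
  measurable_fun [set: R * TG] (fun x => H x.1 x.2) ->
  (forall (z : R) t, is_derive z 1 (H ^~ t) (H' z t)) ->
  measurable_fun [set: TG] (b : TG -> R) ->
  (forall z t, `|H z t| <= b t) -> (forall z t, `|H' z t| <= b t) ->
  L1 P b ->
  [/\ L1 P (fun t => X i0 t * H (X i0 t) t), L1 P (fun t => H' (X i0 t) t) &
  \int[P]_t (X i0 t * H (X i0 t) t) = \int[P]_t H' (X i0 t) t].
Proof.
move=> mH dH mb Hb H'b lb.
have mH' := @measurable_partial_derivative _ TG H H' mH dH.
have mpair : measurable_fun [set: T] (fun t => (X i0 t, t) : R * TG).
  apply: measurable_fun_pair; first exact: mX.
  exact: measurable_id_other.
have mfH : measurable_fun [set: R * TG] (fun x => x.1 * H x.1 x.2) by exact: measurable_funM.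
have mHX : measurable_fun [set: T] (fun t => X i0 t * H (X i0 t) t).
  exact: (measurableT_comp mfH mpair).
have mH'X : measurable_fun [set: T] (fun t => H' (X i0 t) t).
  exact: (measurableT_comp mH' mpair).
have b0 t : 0 <= b t by rewrite (le_trans _ (Hb 0 t)).
have l1 : L1 P (fun t => X i0 t * H (X i0 t) t).
  apply: (L1_dominated mHX (g := fun t => `|X i0 t| * b t)).
    apply: (indep_L1M mX indX lawX (f := fun x => `|x|) _ mb _ lb) => //.
    by apply: L1_abs; exact: std_normal_L1.
  by move=> t; rewrite normrM ler_wpM2l.
have l2 : L1 P (fun t => H' (X i0 t) t) by apply: (L1_dominated mH'X lb).
split => //.
apply: (indep_eq_Rintegral mX indX lawX (f1 := fun x => x.1 * H x.1 x.2)
  (f2 := fun x => H' x.1 x.2)) => // t /=.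
have mHt : measurable_fun setT (H ^~ t).
  apply: continuous_measurable_fun => z.
  by apply/differentiable_continuous/derivable1_diffP; case: (dH z t).
have mH't : measurable_fun setT (H' ^~ t).
  have mp (u : TG) : measurable_fun [set: R] (fun z : R => (z, u)).
    by apply: measurable_fun_pair; [exact: measurable_id|exact: measurable_cst].
  exact: (measurableT_comp mH' (mp t)).
rewrite -!EFin_Rintegral.
- by rewrite (@std_normal_stein _ (H ^~ t) (H' ^~ t) (b t)).
- exact: (@L1_bounded _ _ _ std_normal _ (b t)).
- apply: (@L1_dominated _ _ _ std_normal _ (fun z : R => b t * `|z|)).
  + exact: measurable_funM.
  + by apply: L1Z; apply: L1_abs; exact: std_normal_L1.
  + by move=> z; rewrite normrM mulrC ler_wpM2r.
Qed.

End integration_by_parts.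

(** * Interpolation between Gaussian-type sums *)

Section measurable_continuous_combination.
Context d (T : measurableType d) (R : realType) (K : normedModType R).

(** [Y] is rounded down to multiples of [1 / (q + 1)]. The rounded variable takes countably many
    values, so the composite is measurable piece by piece, and continuity in the first argument
    passes to the limit. No sigma-algebra on [K] is involved. *)
Lemma measurable_continuous_shift (f : K -> T -> R) (Y : T -> R) (k : K) :
  (forall v, measurable_fun setT (f v)) -> (forall t, continuous (f ^~ t)) ->
  measurable_fun setT Y -> measurable_fun setT (fun t => f (Y t *: k) t).
Proof.
move=> mf cf mY.
pose r (q : nat) (z : int) : R := z%:~R / q.+1%:R.
pose F (q : nat) (t : T) := f (r q (Num.floor (Y t * q.+1%:R)) *: k) t.
apply: (measurable_fun_cvg (h := F)) => [q|t _].
  move=> _ B mB; rewrite setTI.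
  have -> : F q @^-1` B = \bigcup_(z in [set: int])
      ((fun t => Y t * q.+1%:R) @^-1` `[z%:~R, (z + 1)%:~R[ `&` f (r q z *: k) @^-1` B).
    apply/seteqP; split => t.
      move=> FB; exists (Num.floor (Y t * q.+1%:R)) => //; split => //.
      by rewrite /= in_itv/= floor_itv.
    move=> [z _ [/=]]; rewrite in_itv/= => zY Bt.
    by rewrite /F /= (floor_def zY).
  apply: countable_bigcupT_measurable; first exact: countableP.
  move=> z; apply: measurableI.
    rewrite -[X in measurable X]setTI.
    by apply: (measurable_funM mY (measurable_cst _)) => //; exact: measurable_itv.
  by rewrite -[X in measurable X]setTI; exact: mf.
have rY : r q (Num.floor (Y t * q.+1%:R)) @[q --> \oo] --> Y t.
  apply/cvgrPdist_le => e e0; near=> q.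
  have /andP[l1 l2] := floor_itv (Y t * q.+1%:R).
  have q0 : 0 < q.+1%:R :> R by rewrite ltr0n.
  have E : Y t - r q (Num.floor (Y t * q.+1%:R)) =
      (Y t * q.+1%:R - (Num.floor (Y t * q.+1%:R))%:~R) / q.+1%:R.
    by rewrite /r mulrBl mulfK// gt_eqF.
  rewrite E normrM ger0_norm ?subr_ge0// normfV gtr0_norm//.
  apply: (@le_trans _ _ (q.+1%:R^-1)).
    rewrite ler_piMl// ?invr_ge0// lerBlDl; apply: ltW; move: l2.
    by rewrite intrD.
  near: q.
  have := @cvg_harmonic R; move/cvgrPdist_le => /(_ _ e0).
  by apply: filterS => n /=; rewrite /harmonic sub0r normrN ger0_norm ?invr_ge0.
have cvk : r q (Num.floor (Y t * q.+1%:R)) *: k @[q --> \oo] --> Y t *: k.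
  by apply: cvgZr_tmp.
exact: (cvg_comp _ _ cvk (cf t (Y t *: k))).
Unshelve. all: by end_near. Qed.

(** Induction on the sum: the head summand is absorbed into [f] as a random translation, which
    preserves both hypotheses on [f]. *)
Lemma measurable_continuous_combination (J : Type) (s : seq J) (Y : J -> T -> R)
    (k : J -> K) (f : K -> T -> R) :
  (forall v, measurable_fun setT (f v)) -> (forall t, continuous (f ^~ t)) ->
  (forall j, measurable_fun setT (Y j)) ->
  measurable_fun setT (fun t => f (\sum_(j <- s) Y j t *: k j) t).
Proof.
move=> mf cf mY; elim: s f mf cf => [|j s ih] f mf cf.
  by under eq_fun do rewrite big_nil; exact: mf.
under eq_fun do rewrite big_cons.
apply: (ih (fun v t => f (Y j t *: k j + v) t)) => [v|t v].
  apply: (measurable_continuous_shift (f := fun u t => f (u + v) t)) => // t u.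
  apply: (continuous_comp (f := fun u => u + v) (g := f ^~ t)); last exact: cf.
  by apply: cvgD; [exact: cvg_id|exact: cvg_cst].
apply: (continuous_comp (f := fun v => Y j t *: k j + v) (g := f ^~ t)); last exact: cf.
by apply: cvgD; [exact: cvg_cst|exact: cvg_id].
Qed.

End measurable_continuous_combination.

Section curves.
Context (R : realType) (K W : normedModType R).

Lemma is_derive_scalel (k : R -> R) (dk x : R) (v : K) :
  is_derive x 1 k dk -> is_derive x 1 (fun s => k s *: v) (dk *: v).
Proof.
move=> [dkx <-]; have dfk : differentiable k x by exact/derivable1_diffP.
have dZ : differentiable (fun s => k s *: v) x by exact: differentiableZl.
apply: DeriveDef; first exact/derivable1_diffP.
by rewrite deriveE// diffZl// deriveE.
Qed.

Lemma is_derive_diff_comp (f : K -> W) (g : R -> K) (x : R) (dg : K) :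
  differentiable f (g x) -> is_derive x 1 g dg ->
  is_derive x 1 (f \o g) ('d f (g x) dg).
Proof.
move=> dfx [dgx <-]; have dgd : differentiable g x by exact/derivable1_diffP.
have dfg : differentiable (f \o g) x by exact: differentiable_comp.
apply: DeriveDef; first exact/derivable1_diffP.
by rewrite deriveE// diff_comp//= deriveE.
Qed.

Lemma is_derive_line (f : K -> W) (v h : K) (z : R) :
  differentiable f (v + z *: h) ->
  is_derive z 1 (fun z => f (v + z *: h)) ('d f (v + z *: h) h).
Proof.
move=> df; apply: (is_derive_diff_comp (g := fun z => v + z *: h)) => //.
have := @is_deriveD _ _ _ (cst v) (fun z : R => z *: h) z 1 0 (1 *: h) _
  (is_derive_scalel h (is_derive_id z 1)).
by rewrite scale1r add0r; apply; exact: is_derive_cst.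
Qed.

End curves.

Section rotation_curve.
Context (R : realType) (K : normedModType R).

Lemma is_derive_rotation (f : K -> R) (u v : K) (x : R) :
  differentiable f (sin x *: u + cos x *: v) ->
  is_derive x 1 (fun s => f (sin s *: u + cos s *: v))
    ('d f (sin x *: u + cos x *: v) (cos x *: u - sin x *: v)).
Proof.
move=> df; apply: (is_derive_diff_comp (g := fun s => sin s *: u + cos s *: v)) => //.
have := is_deriveD (is_derive_scalel u (is_derive_sin x)) (is_derive_scalel v (is_derive_cos x)).
by rewrite scaleNr.
Qed.

Lemma norm_diff_le_lipschitz (f : K -> R) (L : R) :
  (forall v, differentiable f v) -> (forall v h, `|'d f v h| <= L * `|h|) ->
  forall u v, `|f u - f v| <= L * `|u - v|.
Proof.
move=> df fL u v.
have dl (z : R) := is_derive_line (df (v + z *: (u - v))).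
have := derive_lipschitz dl (fun z => fL (v + z *: (u - v)) (u - v)) 1 0.
by rewrite scale1r scale0r addr0 [v + _]addrC subrK subr0 normr1 mulr1.
Qed.

End rotation_curve.

Section gaussian_interpolation.
Context d (T : measurableType d) (R : realType) (P : probability T R).
Variables (K : normedModType R) (phi : K -> R) (D Q : K -> K -> R) (L : R).
Hypothesis dphi : forall v, differentiable phi v.
Hypothesis phiD : forall v h, 'd phi v h = D v h.
Hypothesis L_ge0 : 0 <= L.
Hypothesis D_le : forall v h, `|D v h| <= L * `|h|.
Hypothesis D_cont : forall h, continuous (D ^~ h).
Hypothesis dD : forall v h (z : R),
  is_derive z 1 (fun z => D (v + z *: h) h) (Q (v + z *: h) h).
Hypothesis Q_le : forall v h, `|Q v h| <= L * `|h| ^+ 2.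

Variables (I : eqType) (X : I -> T -> R).
Hypothesis mX : forall i, measurable_fun setT (X i).
Hypothesis indX : mutually_independent P X.

Variables (p N : nat) (g : 'I_p -> I) (U : 'I_p -> 'I_N -> T -> R) (e : 'I_N -> K).
Hypothesis g_inj : injective g.
Hypothesis lawX : forall j, has_law P (X (g j)) std_normal.
Hypothesis mU : forall i j k,
  measurable_fun [set: g_sigma_algebraType (other_cylinders X (g i))] (U j k).

(** The features lie in the span of the finite family [e], so that measurability of functions of [Z]
    reduces to that of the real coefficients [U]. *)
Let u (j : 'I_p) (t : T) : K := \sum_(k < N) U j k t *: e k.
Let Z (c : 'I_p -> R) (t : T) : K := \sum_(j < p) (c j * X (g j) t) *: u j t.

Hypothesis u_sqr : forall j, L1 P (fun t => `|u j t| ^+ 2).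


Let mUT j k : measurable_fun setT (U j k).
Proof. exact: (measurable_fun_other mX (@mU j j k)). Qed.

Let ZE c t : Z c t = \sum_(k < N) (\sum_(j < p) c j * X (g j) t * U j k t) *: e k.
Proof.
under [RHS]eq_bigr do rewrite scaler_suml.
rewrite exchange_big; apply: eq_bigr => j _ /=.
by rewrite scaler_sumr; apply: eq_bigr => k _; rewrite scalerA.
Qed.

Let D_linear v : linear (D v).
Proof. by move=> a x y; rewrite -!phiD linearP. Qed.

Let DZ v (a : R) h : D v (a *: h) = a * D v h.
Proof. by have := D_linear v a h 0; rewrite !addr0 -(phiD v 0) linear0 addr0. Qed.

Let DE v (c : 'I_N -> R) : D v (\sum_(k < N) c k *: e k) = \sum_(k < N) c k * D v (e k).
Proof.
rewrite -phiD raddf_sum; apply: eq_bigr => k _.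
by rewrite -DZ; exact: phiD.
Qed.

Let phi_cont : continuous phi.
Proof. by move=> v; exact: differentiable_continuous. Qed.

Let norm_u_measurable i j :
  measurable_fun [set: g_sigma_algebraType (other_cylinders X (g i))]
    (fun t => `|u j t| : R).
Proof.
apply: (@measurable_continuous_combination _ _ R K _ _ _ _ (fun v _ => `|v|)) => //.
by move=> t; exact: norm_continuous.
Qed.

Let norm_u_L1 j : L1 P (fun t => `|u j t|).
Proof.
apply: L1_of_sqr; last exact: u_sqr.
exact: (measurable_fun_other mX (@norm_u_measurable j j)).
Qed.

Let Xu_L1 i j : L1 P (fun t => `|X (g i) t| * `|u j t|).
Proof.
apply: (indep_L1M mX indX (lawX i) (f := fun x : R => `|x|) _ (@norm_u_measurable i j)) => //.
by apply: L1_abs; exact: std_normal_L1.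
Qed.

Let phiZ_measurable c : measurable_fun setT (fun t => phi (Z c t)).
Proof.
under eq_fun do rewrite ZE.
apply: (@measurable_continuous_combination _ _ R K _ _ _ _ (fun v _ => phi v)) => // k.
apply: measurable_sum => j; apply: measurable_funM => //.
exact: measurable_funM.
Qed.

Let normZ_le c t : `|Z c t| <= \sum_(j < p) `|c j| * (`|X (g j) t| * `|u j t|).
Proof.
apply: (le_trans (ler_norm_sum _ _ _)); apply: ler_sum => j _.
by rewrite normrZ normrM mulrA.
Qed.

Lemma interpolation_L1 c : L1 P (fun t => phi (Z c t)).
Proof.
apply: (L1_dominated (phiZ_measurable c) (g := fun t => `|phi 0| +
    L * \sum_(j < p) `|c j| * (`|X (g j) t| * `|u j t|))).
  apply: L1D; first exact: L1_cst.
  by apply: L1Z; apply: L1_sum => j _; apply: L1Z.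
move=> t; rewrite -[phi (Z c t)](subrK (phi 0)) addrC.
apply: (le_trans (ler_normD _ _)); rewrite lerD2l.
have phiL v h : `|'d phi v h| <= L * `|h| by rewrite phiD.
apply: (le_trans (norm_diff_le_lipschitz dphi phiL _ _)).
by rewrite subr0; apply: ler_wpM2l => //; exact: normZ_le.
Qed.

(** [Z c = V + c_j X_j u_j] with [V] and [u_j] free of [X_j]. Hence [D (Z c) (u_j)] depends on [X_j]
    along a line of direction [c_j u_j], and its derivative there is [c_j Q (Z c) (u_j)]. *)
Lemma interpolation_by_parts c j :
  [/\ L1 P (fun t => X (g j) t * D (Z c t) (u j t)),
      L1 P (fun t => c j * Q (Z c t) (u j t)) &
  \int[P]_t (X (g j) t * D (Z c t) (u j t)) =
  \int[P]_t (c j * Q (Z c t) (u j t))].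
Proof.
pose V t := \sum_(i < p | i != j) (c i * X (g i) t) *: u i t.
pose H (z : R) t := D (V t + (c j * z) *: u j t) (u j t).
pose H' (z : R) t := c j * Q (V t + (c j * z) *: u j t) (u j t).
have ZV t : Z c t = V t + (c j * X (g j) t) *: u j t.
  by rewrite /Z (bigD1 j)//= addrC.
have VE t z : V t + (c j * z) *: u j t =
    \sum_(k < N) (\sum_(i < p | i != j) c i * X (g i) t * U i k t +
                  c j * z * U j k t) *: e k.
  under [RHS]eq_bigr do rewrite scalerDl scaler_suml.
  rewrite big_split /= exchange_big /=; congr (_ + _).
    apply: eq_bigr => i _ /=.
    by rewrite scaler_sumr; apply: eq_bigr => k _; rewrite scalerA.
  by rewrite scaler_sumr; apply: eq_bigr => k _; rewrite scalerA.
pose TG := g_sigma_algebraType (other_cylinders X (g j)).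
have mH : measurable_fun [set: R * TG] (fun x => H x.1 x.2).
  rewrite /H; under eq_fun do rewrite VE DE.
  apply: measurable_sum => k; apply: measurable_funM.
    exact: (measurableT_comp (@mU j j k)).
  apply: (@measurable_continuous_combination _ _ R K _ _ _ _ (fun v _ => D v (e k))) => //.
  move=> l; apply: measurable_funD.
    rewrite (_ : (fun x : R * TG => _) =
      (fun x : R * TG => \sum_(i < p) (if i != j then c i * X (g i) x.2 * U i l x.2 else 0))).
      apply: measurable_sum => i; case: eqVneq => // ij.
      apply: measurable_funM; last exact: (measurableT_comp (@mU j i l)).
      apply: measurable_funM => //.
      apply: (measurableT_comp (f := X (g i) : TG -> R)) => //.
      apply: measurable_other => //; by rewrite (inj_eq g_inj).
    by apply/funext => x; rewrite big_mkcond.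
  apply: measurable_funM; last exact: (measurableT_comp (@mU j j l)).
  by apply: measurable_funM.
have dH (z : R) t : is_derive z 1 (H ^~ t) (H' z t).
  have := @is_derive_comp_affine R (fun y => D (V t + y *: u j t) (u j t))
    (Q (V t + (0 + c j * z) *: u j t) (u j t)) 0 (c j) z (dD _ _ _).
  rewrite (_ : (fun e0 : R => D (V t + (0 + c j * e0) *: u j t) (u j t)) = H ^~ t).
    by rewrite add0r.
  by apply/funext => y; rewrite add0r.
(* Bounds both [H] and [H'] uniformly in [z]; its integrability is what the second moments of the
   features are for. *)
pose b t := L * `|u j t| + `|c j| * (L * `|u j t| ^+ 2).
have mb : measurable_fun [set: TG] (b : TG -> R).
  apply: measurable_funD; first by apply: measurable_funM => //; exact: norm_u_measurable.
  do 2 apply: measurable_funM => //; apply: measurable_funX; exact: norm_u_measurable.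
have lb : L1 P b by apply: L1D; do ?apply: L1Z.
have Hb z t : `|H z t| <= b t.
  by rewrite (le_trans (D_le _ _))// lerDl mulr_ge0// mulr_ge0// sqr_ge0.
have H'b z t : `|H' z t| <= b t.
  by rewrite normrM -[leLHS]add0r lerD// ?mulr_ge0// ler_wpM2l.
have [l1 l2 E] := gaussian_integration_by_parts mX indX (lawX j) mH dH mb Hb H'b lb.
have E1 t : H (X (g j) t) t = D (Z c t) (u j t) by rewrite /H ZV.
have E2 t : H' (X (g j) t) t = c j * Q (Z c t) (u j t) by rewrite /H' ZV.
split.
- by apply: eq_L1 l1 => t; rewrite E1.
- by apply: eq_L1 l2 => t; rewrite E2.
- transitivity (\int[P]_t (X (g j) t * H (X (g j) t) t)).
    by apply: eq_Rintegral => t _; rewrite E1.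
  by rewrite E; apply: eq_Rintegral => t _; rewrite E2.
Qed.

Theorem gaussian_interpolation (A B : 'I_p -> R) (M : T -> R) :
  (forall j, A j * B j = 0) -> L1 P M ->
  (forall v t, `|\sum_(j < p) (A j ^+ 2 - B j ^+ 2) * Q v (u j t)| <= M t) ->
  `|\int[P]_t phi (Z A t) - \int[P]_t phi (Z B t)| <= 2 * \int[P]_t M t.
Proof.
move=> AB0 lM QM.
(* A quarter turn of the coefficients, from [B] at [s = 0] to [A] at [s = pi / 2]. *)
pose c (s : R) j := A j * sin s + B j * cos s.
pose c' (s : R) j := A j * cos s - B j * sin s.
have Zrot s t : Z (c s) t = sin s *: Z A t + cos s *: Z B t.
  rewrite /Z !scaler_sumr -big_split /=; apply: eq_bigr => j _.
  rewrite !scalerA -scalerDl /c; congr (_ *: _); ring.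
have Zrot' s t : Z (c' s) t = cos s *: Z A t - sin s *: Z B t.
  rewrite /Z !scaler_sumr -sumrB /=; apply: eq_bigr => j _.
  rewrite !scalerA -scalerBl /c'; congr (_ *: _); ring.
have ZD v s t : D v (Z (c' s) t) = \sum_(j < p) c' s j * (X (g j) t * D v (u j t)).
  rewrite -phiD raddf_sum; apply: eq_bigr => j _ /=.
  by rewrite phiD DZ mulrA.
pose G (t : T) := L * \sum_(j < p) (`|A j| + `|B j|) * (`|X (g j) t| * `|u j t|).
have dPhi (s : R) : is_derive s 1 (fun s => \int[P]_t phi (Z (c s) t))
    (\int[P]_t D (Z (c s) t) (Z (c' s) t)).
  apply: (@is_derive_under_integral R _ _ P (fun s t => phi (Z (c s) t))
    (fun s t => D (Z (c s) t) (Z (c' s) t)) s 1 G) => //.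
  - by move=> x _; exact: interpolation_L1.
  - move=> x t _; have := @is_derive_rotation R K phi (Z A t) (Z B t) x (dphi _).
    rewrite phiD -Zrot -Zrot' (_ : (fun s0 => _) = (fun x => phi (Z (c x) t)))//.
    by apply/funext => y; rewrite Zrot.
  - by apply: L1Z; apply: L1_sum => j _; apply: L1Z.
  - move=> x t _; apply: (le_trans (D_le _ _)); apply: ler_wpM2l => //.
    apply: (le_trans (normZ_le _ _)); apply: ler_sum => j _.
    rewrite ler_wpM2r// ?mulr_ge0//.
    apply: (le_trans (ler_normD _ _)); rewrite normrN !normrM.
    by rewrite lerD// ler_piMr// ler_norml ?cos_geN1 ?cos_le1 ?sin_geN1 ?sin_le1.
have lQ s : L1 P (fun t => \sum_(j < p) c' s j * (c s j * Q (Z (c s) t) (u j t))).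
  by apply: L1_sum => j _; apply: L1Z; case: (interpolation_by_parts (c s) j).
have dE s : \int[P]_t D (Z (c s) t) (Z (c' s) t) =
    \int[P]_t (\sum_(j < p) c' s j * (c s j * Q (Z (c s) t) (u j t))).
  transitivity (\sum_(j < p) \int[P]_t (c' s j * (X (g j) t * D (Z (c s) t) (u j t)))).
    rewrite -Rintegral_sumr; last first.
      by move=> j _; apply: L1Z; case: (interpolation_by_parts (c s) j).
    by apply: eq_Rintegral => t _; rewrite ZD.
  rewrite Rintegral_sumr; last first.
    by move=> j _; apply: L1Z; case: (interpolation_by_parts (c s) j).
  apply: eq_bigr => j _; case: (interpolation_by_parts (c s) j) => l1 l2 E.
  by rewrite (@RintegralZl _ _ _ P _ _ _ measurableT l1) E -(@RintegralZl _ _ _ P _ _ _ measurableT l2).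
(* Expanding [c' c] gives [sin cos (A^2 - B^2) + A B (cos^2 - sin^2)]; the last term vanishes by
   hypothesis. *)
have QE s t : \sum_(j < p) c' s j * (c s j * Q (Z (c s) t) (u j t)) =
    sin s * cos s * \sum_(j < p) (A j ^+ 2 - B j ^+ 2) * Q (Z (c s) t) (u j t).
  rewrite mulr_sumr; apply: eq_bigr => j _.
  rewrite mulrA [RHS]mulrA; congr (_ * _); rewrite /c /c'.
  transitivity (sin s * cos s * (A j ^+ 2 - B j ^+ 2) + A j * B j * (cos s ^+ 2 - sin s ^+ 2)).
    ring.
  by rewrite AB0 mul0r addr0.
have dle s : `|\int[P]_t D (Z (c s) t) (Z (c' s) t)| <= \int[P]_t M t.
  rewrite dE; apply: normr_Rintegral_le => //; first exact: L1_measurable (lQ s).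
  move=> t; rewrite QE normrM; apply: le_trans (QM (Z (c s) t) t).
  rewrite ler_piMl// normrM.
  by rewrite mulr_ile1// ler_norml ?cos_geN1 ?cos_le1 ?sin_geN1 ?sin_le1.
have := derive_lipschitz dPhi dle (pi / 2) 0.
have cA : c (pi / 2) = A.
  by apply/funext => j; rewrite /c sin_pihalf cos_pihalf mulr1 mulr0 addr0.
have cB : c 0 = B.
  by apply/funext => j; rewrite /c sin0 cos0 mulr1 mulr0 add0r.
(* The length of the path is [pi / 2 < 2], which is the factor 2 of the statement. *)
rewrite cA cB subr0 => /le_trans; apply; rewrite mulrC ler_wpM2r//.
  by apply: Rintegral_ge0 => t _; exact: (le_trans _ (QM 0 t)).
by rewrite ger0_norm ?divr_ge0 ?pi_ge0// ltW// pihalf_lt2.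
Qed.

End gaussian_interpolation.

(** * Trigonometric approximation *)

Section discrete_fejer_kernel.
Context (R : realType) (n : nat).
Local Notation q := n.+2.
Implicit Types x y a : R.

Definition grid_angle (p : nat) : R := 2 * pi * p%:R / q%:R.

(** The squared modulus of [sum_(k <= n) e^{i k x}], normalised to have total mass 1 on the [n + 2]
    grid angles. There is one more angle than frequencies because multiplication by [cos] creates
    frequency differences up to [n + 1], which must stay below [q] to be annihilated by the grid. *)
Definition fejer x : R := (n.+1%:R * q%:R)^-1 *
  ((\sum_(k < n.+1) cos (k%:R * x)) ^+ 2 + (\sum_(k < n.+1) sin (k%:R * x)) ^+ 2).

Lemma fejer_ge0 x : 0 <= fejer x.
Proof. by rewrite mulr_ge0// ?invr_ge0 ?mulr_ge0// addr_ge0// sqr_ge0. Qed.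

Lemma fejerE x : fejer x = (n.+1%:R * q%:R)^-1 *
  \sum_(k < n.+1) \sum_(l < n.+1) cos ((k%:R - l%:R) * x).
Proof.
rewrite /fejer !expr2 !big_distrlr /= -big_split /=; congr (_ * _).
apply: eq_bigr => k _; rewrite -big_split /=; apply: eq_bigr => l _.
by rewrite mulrBl cosB.
Qed.

(** Telescoping of [2 sin a cos y = sin (y + a) - sin (y - a)]. *)
Lemma sum_cos_arithmetic x a (m : nat) :
  2 * sin a * \sum_(p < m) cos (x + 2 * a * p%:R) =
  sin (x - a + 2 * a * m%:R) - sin (x - a).
Proof.
elim: m => [|m ih]; first by rewrite big_ord0 !mulr0 addr0 subrr.
rewrite big_ord_recr /= mulrDr ih.
have -> : x - a + 2 * a * m.+1%:R = (x + 2 * a * m%:R) + a.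
  by rewrite -[m.+1]addn1 natrD; ring.
have -> : x - a + 2 * a * m%:R = (x + 2 * a * m%:R) - a by ring.
set y := x + 2 * a * m%:R; rewrite (sinB y) (sinD y); ring.
Qed.

(** With [a = m pi / q] the two end sines differ by [m] full turns and cancel, while [0 < a < pi]
    keeps [sin a] nonzero. *)
Lemma sum_cos_grid_pos x (m : nat) : (0 < m < q)%N ->
  \sum_(p < q) cos (x + m%:R * grid_angle p) = 0.
Proof.
move=> /andP[m0 mq]; pose a : R := m%:R * pi / q%:R.
have q0 : 0 < q%:R :> R by rewrite ltr0n.
have a0 : 0 < a by rewrite divr_gt0// mulr_gt0 ?pi_gt0// ltr0n.
have api : a < pi.
  by rewrite ltr_pdivrMr// mulrC ltr_pM2l ?pi_gt0// ltr_nat.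
have sa : sin a != 0 by rewrite gt_eqF// sin_gt0_pi// a0.
have := sum_cos_arithmetic x a q.
have -> : x - a + 2 * a * q%:R = (x - a) + (pi *+ 2) *+ m.
  rewrite /a -(mulr_natr (pi *+ 2)) -(mulr_natr pi).
  by rewrite -(mulrA 2) divfK ?gt_eqF//; ring.
rewrite (periodicn (@sinD2pi R)) subrr => /eqP; rewrite !mulf_eq0 pnatr_eq0 /= (negbTE sa)/=.
move=> /eqP E; rewrite -[RHS]E; apply: eq_bigr => p _; congr (cos (_ + _)).
by rewrite /a /grid_angle; ring.
Qed.

Lemma sum_cos_grid x (k l : nat) : (k < q)%N -> (l < q)%N ->
  \sum_(p < q) cos ((k%:R - l%:R) * (x - grid_angle p)) = if k == l then q%:R else 0.
Proof.
move=> kq lq; case: (ltngtP k l) => [kl|lk|->].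
- transitivity (\sum_(p < q) cos ((k%:R - l%:R) * x + (l - k)%:R * grid_angle p)); last first.
    by apply: sum_cos_grid_pos; rewrite subn_gt0 kl (leq_ltn_trans (leq_subr _ _)).
  by apply: eq_bigr => p _; rewrite natrB ?(ltnW kl)//; congr cos; ring.
- transitivity (\sum_(p < q) cos (- ((k%:R - l%:R) * x) + (k - l)%:R * grid_angle p)); last first.
    by apply: sum_cos_grid_pos; rewrite subn_gt0 lk (leq_ltn_trans (leq_subr _ _)).
  by apply: eq_bigr => p _; rewrite natrB ?(ltnW lk)// -cosN; congr cos; ring.
- under eq_bigr do rewrite subrr mul0r cos0.
  by rewrite sumr_const card_ord.
Qed.

(** Discrete orthogonality leaves only the [n + 1] diagonal pairs of frequencies. *)
Lemma sum_fejer x : \sum_(p < q) fejer (x - grid_angle p) = 1.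
Proof.
under eq_bigr do rewrite fejerE.
rewrite -mulr_sumr exchange_big /=.
under eq_bigr do rewrite exchange_big /=.
rewrite (eq_bigr (fun=> q%:R)) => [|k _].
  rewrite sumr_const card_ord -[q%:R *+ _]mulr_natl mulVf// mulf_neq0// pnatr_eq0//.
rewrite (bigD1 k)//= sum_cos_grid ?(ltn_trans (ltn_ord _))// eqxx big1 ?addr0// => l lk.
by rewrite sum_cos_grid ?(ltn_trans (ltn_ord _))// ifN// eq_sym.
Qed.

Let cosM x y : cos x * cos y = 2^-1 * (cos (x + y) + cos (x - y)).
Proof. by rewrite cosD cosB; field. Qed.

(** The factor [cos] shifts frequency differences by one in each direction with weight 1/2, so
    exactly the [2 n] pairs of adjacent frequencies survive, giving [n / (n + 1)]. *)
Lemma sum_fejer_cos x :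
  \sum_(p < q) fejer (x - grid_angle p) * cos (x - grid_angle p) = 1 - n.+1%:R^-1.
Proof.
transitivity ((n.+1%:R * q%:R)^-1 * \sum_(k < n.+1) \sum_(l < n.+1) 2^-1 *
    ((if k.+1 == l :> nat then q%:R else 0) + (if k == l.+1 :> nat then q%:R else 0)) : R).
  transitivity ((n.+1%:R * q%:R)^-1 * \sum_(p < q) \sum_(k < n.+1) \sum_(l < n.+1) 2^-1 *
      (cos ((k.+1%:R - l%:R) * (x - grid_angle p)) +
       cos ((k%:R - l.+1%:R) * (x - grid_angle p)))).
    rewrite mulr_sumr; apply: eq_bigr => p _.
    rewrite fejerE -mulrA mulr_suml; congr (_ * _); apply: eq_bigr => k _.
    rewrite mulr_suml; apply: eq_bigr => l _; rewrite cosM.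
    congr (_ * (cos _ + cos _)).
      by rewrite -[k.+1]addn1 natrD; ring.
    by rewrite -[l.+1]addn1 natrD; ring.
  congr (_ * _); rewrite exchange_big /=; apply: eq_bigr => k _.
  rewrite exchange_big /=; apply: eq_bigr => l _.
  have k2 : (k.+1 < q)%N by rewrite ltnS.
  have l2 : (l.+1 < q)%N by rewrite ltnS.
  rewrite -mulr_sumr big_split /= (sum_cos_grid x k2 (ltnW l2)).
  by rewrite (sum_cos_grid x (ltnW k2) l2).
under eq_bigr do rewrite -mulr_sumr big_split /=.
rewrite -mulr_sumr big_split /=.
have E1 : \sum_(k < n.+1) \sum_(l < n.+1) (if k.+1 == l then q%:R else 0) = n%:R * q%:R :> R.
  rewrite big_ord_recr /= [X in _ + X]big1 ?addr0; last first.
    by move=> l _; rewrite ifN// gtn_eqF.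
  under eq_bigr => k _.
    rewrite (bigD1 (lift ord0 k))//= eqxx big1 ?addr0; last first.
      by move=> l lk; rewrite ifN//; apply: contra lk => /eqP lk; apply/eqP/val_inj.
    over.
  by rewrite /= sumr_const card_ord -[q%:R *+ _]mulr_natl.
have E2 : \sum_(k < n.+1) \sum_(l < n.+1) (if k == l.+1 :> nat then q%:R else 0) = n%:R * q%:R :> R.
  by rewrite exchange_big /= -E1; apply: eq_bigr => k _; apply: eq_bigr => l _; rewrite eq_sym.
rewrite E1 E2; set r : R := q%:R; rewrite -(natr1 n); set m : R := n%:R.
have m1 : m + 1 != 0 by rewrite natr1 pnatr_eq0.
have r0 : r != 0 by rewrite pnatr_eq0.
by field; apply/andP; split.
Qed.

Lemma sum_fejer_1Bcos x :
  \sum_(p < q) fejer (x - grid_angle p) * (1 - cos (x - grid_angle p)) = n.+1%:R^-1.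
Proof.
under eq_bigr do rewrite mulrBr mulr1.
by rewrite sumrB sum_fejer sum_fejer_cos opprB addrC subrK.
Qed.

End discrete_fejer_kernel.

Section fejer_concentration.
Context (R : realType).

(** The range reaches [3 pi / 2] because a point of [[- pi / 2, pi / 2]] is compared with grid
    points of [[- pi, pi]]. Between [pi] and [3 pi / 2] the cosine is still nonpositive, so
    periodicity does no harm. *)
Lemma cos_le_far (eta u : R) : 0 < eta <= pi / 2 -> eta <= `|u| -> `|u| <= 3 / 2 * pi ->
  cos u <= cos eta.
Proof.
move=> /andP[e0 ep] eu u3.
have p0 := @pi_gt0 R.
have -> : cos u = cos `|u| by case: (ger0P u) => // _; rewrite cosN.
have [up|pu] := leP `|u| pi.
  by rewrite leNgt ltr_cos ?in_itv/= -?leNgt//; apply/andP; split; lra.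
have -> : `|u| = (`|u| - pi) + pi by rewrite subrK.
rewrite cosDpi; apply: (@le_trans _ _ 0).
  by rewrite oppr_le0 cos_ge0_pihalf//; apply/andP; split; lra.
by rewrite cos_ge0_pihalf//; apply/andP; split; lra.
Qed.

(* Far from [0], [x] is dominated by a multiple of [1 - cos x], whose mean under
   the kernel is [1 / (n + 1)] by [sum_fejer_1Bcos]. *)
Lemma fejer_concentration (delta : R) : 0 < delta ->
  exists n : nat, forall y : R, `|y| <= pi / 2 ->
  \sum_(p < n.+2) fejer n (y + pi - grid_angle R n p) * `|y - (grid_angle R n p - pi)| <= delta.
Proof.
move=> d0; have p0 := @pi_gt0 R.
pose eta := Num.min (delta / 2) (pi / 2).
have e0 : 0 < eta by rewrite lt_min !divr_gt0.
have ed : eta <= delta / 2 by rewrite ge_min lexx.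
have ep : eta <= pi / 2 by rewrite ge_min lexx orbT.
have c0 : 0 < 1 - cos eta.
  rewrite subr_gt0 -cos0 ltr_cos ?in_itv/= ?lexx//; apply/andP; split; lra.
pose C := 3 / 2 * pi / (1 - cos eta).
have C0 : 0 <= C by rewrite divr_ge0 ?(ltW c0)// mulr_ge0// ltW.
pose n := Num.truncn (C / (delta / 2)).
exists n => y yp.
have nC : C / n.+1%:R <= delta / 2.
  rewrite ler_pdivrMr// mulrC -ler_pdivrMr ?divr_gt0//.
  by apply: ltW; rewrite truncnS_gt.
apply: (@le_trans _ _ (\sum_(p < n.+2) fejer n (y + pi - grid_angle R n p) *
    (eta + C * (1 - cos (y + pi - grid_angle R n p))))).
  apply: ler_sum => p _; rewrite ler_wpM2l ?fejer_ge0//.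
  set u := y + pi - _; have -> : y - (grid_angle R n p - pi) = u by rewrite /u; ring.
  have [ue|eu] := ltP `|u| eta.
    by rewrite (le_trans (ltW ue))// lerDl mulr_ge0// subr_ge0 cos_le1.
  have g0 : 0 <= grid_angle R n p by rewrite divr_ge0// !mulr_ge0// ltW.
  have g2 : grid_angle R n p <= 2 * pi.
    rewrite ler_pdivrMr// ler_wpM2l ?mulr_ge0 ?(ltW p0)// ler_nat ltnW//.
  have u3 : `|u| <= 3 / 2 * pi.
    by move: yp; rewrite !ler_norml /u => /andP[? ?]; apply/andP; split; lra.
  have cu := cos_le_far (ltac:(by rewrite e0) : 0 < eta <= pi / 2) eu u3.
  rewrite (le_trans u3)// -[leLHS]add0r lerD ?(ltW e0)//.
  have -> : C * (1 - cos u) = 3 / 2 * pi * (1 - cos u) / (1 - cos eta) by rewrite /C [LHS]mulrAC.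
  rewrite ler_pdivlMr// ler_wpM2l ?mulr_ge0 ?(ltW p0)//.
  by rewrite lerB.
under eq_bigr do rewrite mulrDr mulrCA.
rewrite big_split /= -mulr_suml sum_fejer mul1r -mulr_sumr sum_fejer_1Bcos.
by rewrite [leRHS](splitr delta) lerD.
Qed.

End fejer_concentration.

Section trigonometric_polynomials.
Context (R : realType) (N : nat).
Implicit Types (f g : ('I_N -> R) -> R).

(** Phases stand in for sines, and the product-to-sum formula makes the class an algebra. *)
Inductive trig_poly : (('I_N -> R) -> R) -> Prop :=
| trig_cos (s : 'I_N -> R) (b : R) :
    trig_poly (fun y => cos (\sum_(k < N) s k * y k + b))
| trig_add f g : trig_poly f -> trig_poly g -> trig_poly (fun y => f y + g y)
| trig_scale c f : trig_poly f -> trig_poly (fun y => c * f y).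

Lemma trig_ext f g : f =1 g -> trig_poly f -> trig_poly g.
Proof. by move=> /funext ->. Qed.

Lemma trig_cst c : trig_poly (fun=> c).
Proof.
apply: trig_ext (trig_scale c (trig_cos (fun=> 0) 0)) => y.
by rewrite big1 ?addr0 ?cos0 ?mulr1// => k _; rewrite mul0r.
Qed.

Lemma trig_mul f g : trig_poly f -> trig_poly g -> trig_poly (fun y => f y * g y).
Proof.
move=> tf; elim: tf g => [s b|f1 f2 _ ih1 _ ih2|c f1 _ ih1] g tg.
- elim: tg => [s' b'|g1 g2 _ ih1 _ ih2|c g1 _ ih1].
  + apply: trig_ext (trig_scale 2^-1 (trig_add
      (trig_cos (fun k => s k + s' k) (b + b')) (trig_cos (fun k => s k - s' k) (b - b')))) => y.
    set x := \sum_(k < N) s k * y k + b; set x' := \sum_(k < N) s' k * y k + b'.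
    have -> : \sum_(k < N) (s k + s' k) * y k + (b + b') = x + x'.
      by rewrite /x /x' addrACA -big_split; congr (_ + _); apply: eq_bigr => k _; rewrite mulrDl.
    have -> : \sum_(k < N) (s k - s' k) * y k + (b - b') = x - x'.
      rewrite /x /x' opprD addrACA -sumrB; congr (_ + _).
      by apply: eq_bigr => k _; rewrite mulrBl.
    by rewrite cosD cosB; field.
  + by apply: trig_ext (trig_add ih1 ih2) => y; rewrite mulrDr.
  + by apply: trig_ext (trig_scale c ih1) => y; rewrite mulrCA.
- by apply: trig_ext (trig_add (ih1 g tg) (ih2 g tg)) => y; rewrite mulrDl.
- by apply: trig_ext (trig_scale c (ih1 g tg)) => y; rewrite mulrA.
Qed.

Lemma trig_sum (I : Type) (r : seq I) (F : I -> ('I_N -> R) -> R) :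
  (forall i, trig_poly (F i)) -> trig_poly (fun y => \sum_(i <- r) F i y).
Proof.
move=> tF; elim: r => [|i r ih].
  by apply: trig_ext (trig_cst 0) => y; rewrite big_nil.
by apply: trig_ext (trig_add (tF i) ih) => y; rewrite big_cons.
Qed.

Lemma trig_prod (I : Type) (r : seq I) (F : I -> ('I_N -> R) -> R) :
  (forall i, trig_poly (F i)) -> trig_poly (fun y => \prod_(i <- r) F i y).
Proof.
move=> tF; elim: r => [|i r ih].
  by apply: trig_ext (trig_cst 1) => y; rewrite big_nil.
by apply: trig_ext (trig_mul (tF i) ih) => y; rewrite big_cons.
Qed.

Lemma trig_cos_coord (a b : R) (k : 'I_N) : trig_poly (fun y => cos (a * y k + b)).
Proof.
apply: trig_ext (trig_cos (fun j => if j == k then a else 0) b) => y.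
rewrite (bigD1 k)//= eqxx big1 ?addr0// => j jk.
by rewrite (negbTE jk) mul0r.
Qed.

Lemma trig_fejer (n : nat) (a b : R) (k : 'I_N) :
  trig_poly (fun y => fejer n (a * y k + b)).
Proof.
apply: trig_scale; apply: trig_add.
  under eq_fun do rewrite expr2.
  apply: trig_mul; apply: trig_sum => i;
    by apply: trig_ext (trig_cos_coord (i%:R * a) (i%:R * b) k) => y; congr cos; ring.
under eq_fun do rewrite expr2.
apply: trig_mul; apply: trig_sum => i;
  apply: trig_ext (trig_cos_coord (i%:R * a) (i%:R * b - pi / 2) k) => y;
  rewrite -[RHS]cosBpihalf; congr cos; ring.
Qed.

(** [psi] is sampled at rescaled grid points and averaged with a product of Fejer kernels, a
    probability weight on the samples. On a large cube the kernel concentrates near [y] and the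
    Lipschitz bound applies. Outside it the periodic [f] is bounded and [psi] grows linearly, which
    the quadratic weight absorbs. *)
Lemma trig_dense (psi : ('I_N -> R) -> R) (L eps : R) : 0 <= L ->
  (forall y z, `|psi y - psi z| <= L * \sum_(k < N) `|y k - z k|) -> 0 < eps ->
  exists2 f, trig_poly f & forall y, `|psi y - f y| <= eps * (1 + \sum_(k < N) y k ^+ 2).
Proof.
move=> L0 psiL e0; have p0 := @pi_gt0 R.
pose C := 2 * `|psi (fun=> 0)| + 3 * L * N%:R.
have C0 : 0 <= C by rewrite addr_ge0 ?mulr_ge0.
(* Makes [C <= eps M], so an error [C S / M] outside the cube of half-side [M] is at most
   [eps S]. *)
pose M := 1 + C / eps.
have M1 : 1 <= M by rewrite lerDl divr_ge0// ltW.
have M0 : 0 < M by rewrite (lt_le_trans ltr01).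
(* Maps the cube into [[- pi / 2, pi / 2]], where the kernel concentrates; the sample points then
   fill [[- 2 M, 2 M]]. *)
pose a : R := pi / 2 / M.
have a0 : 0 < a by rewrite !divr_gt0.
pose delta := eps * a / (L * N%:R + 1).
have LN0 : 0 < L * N%:R + 1 by rewrite ltr_wpDl// mulr_ge0.
have d0 : 0 < delta by rewrite divr_gt0// mulr_gt0.
have [n nP] := fejer_concentration d0.
pose t (p : 'I_n.+2) : R := (grid_angle R n p - pi) / a.
pose w (x : R) (p : 'I_n.+2) := fejer n (a * x + pi - grid_angle R n p).
pose f (y : 'I_N -> R) := \sum_(p : {ffun 'I_N -> 'I_n.+2})
  (\prod_(k < N) w (y k) (p k)) * psi (fun k => t (p k)).
have w0 x p : 0 <= w x p by exact: fejer_ge0.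
have w1 x : \sum_p w x p = 1 by exact: sum_fejer.
have W1 y : \sum_(p : {ffun 'I_N -> 'I_n.+2}) \prod_(k < N) w (y k) (p k) = 1.
  by rewrite -(bigA_distr_bigA (fun k p => w (y k) p)) big1// => k _; exact: w1.
have W0 y (p : {ffun 'I_N -> 'I_n.+2}) : 0 <= \prod_(k < N) w (y k) (p k).
  by apply: prodr_ge0.
exists f.
  apply: trig_sum => p; under eq_fun do rewrite mulrC.
  apply: trig_scale; apply: trig_prod => k.
  by apply: trig_ext (trig_fejer n a (pi - grid_angle R n (p k)) k) => y; rewrite /w addrA.
have tM p : `|t p| <= 2 * M.
  rewrite /t normrM normfV (gtr0_norm a0) ler_pdivrMr// /a.
  have -> : 2 * M * (pi / 2 / M) = pi by field; rewrite gt_eqF.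
  have g0 : 0 <= grid_angle R n p by rewrite divr_ge0// !mulr_ge0// ltW.
  have g2 : grid_angle R n p <= 2 * pi.
    by rewrite ler_pdivrMr// ler_wpM2l ?mulr_ge0 ?(ltW p0)// ler_nat ltnW.
  by rewrite ler_norml; apply/andP; split; lra.
have psi_le y : `|psi y| <= `|psi (fun=> 0)| + L * \sum_(k < N) `|y k|.
  rewrite -[psi y](subrK (psi (fun=> 0))) addrC (le_trans (ler_normD _ _))// lerD2l.
  by apply: (le_trans (psiL _ _)); under eq_bigr do rewrite subr0.
have f_le y : `|f y| <= `|psi (fun=> 0)| + L * (N%:R * (2 * M)).
  apply: (le_trans (ler_norm_sum _ _ _)).
  rewrite -[leRHS]mul1r -[X in X * _](W1 y) mulr_suml; apply: ler_sum => p _.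
  rewrite normrM ger0_norm// ler_wpM2l//; apply: (le_trans (psi_le _)).
  rewrite lerD2l ler_wpM2l//.
  by rewrite -[N in N%:R]card_ord mulr_natl -sumr_const; apply: ler_sum.
move=> y; set S := \sum_(k < N) y k ^+ 2.
have S0 : 0 <= S by apply: sumr_ge0 => k _; exact: sqr_ge0.
have [yM|] := boolP [forall k, `|y k| <= M].
  apply: (@le_trans _ _ eps); last by rewrite ler_peMr ?(ltW e0)// lerDl.
  have -> : psi y - f y = \sum_(p : {ffun 'I_N -> 'I_n.+2})
      (\prod_(k < N) w (y k) (p k)) * (psi y - psi (fun k => t (p k))).
    under eq_bigr do rewrite mulrBr.
    by rewrite sumrB -mulr_suml W1 mul1r.
  apply: (le_trans (ler_norm_sum _ _ _)).
  apply: (@le_trans _ _ (\sum_(p : {ffun 'I_N -> 'I_n.+2})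
      (\prod_(k < N) w (y k) (p k)) * (L * \sum_(k < N) `|y k - t (p k)|))).
    by apply: ler_sum => p _; rewrite normrM ger0_norm// ler_wpM2l.
  under eq_bigr do rewrite mulrCA mulr_sumr.
  rewrite -mulr_sumr exchange_big /=.
  (* Distributing the product over the sum, every coordinate other than [k] contributes total mass
     1, and the one-dimensional concentration remains. *)
  have key k : \sum_(p : {ffun 'I_N -> 'I_n.+2})
      (\prod_(i < N) w (y i) (p i)) * `|y k - t (p k)| <= delta / a.
    pose F (i : 'I_N) (p : 'I_n.+2) := w (y i) p * (if i == k then `|y k - t p| else 1).
    rewrite (eq_bigr (fun p : {ffun 'I_N -> 'I_n.+2} => \prod_(i < N) F i (p i))); last first.
      move=> p _; rewrite [RHS]big_split /=; congr GRing.mul.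
      by rewrite -big_mkcond /= big_pred1_eq.
    rewrite -(bigA_distr_bigA F) (bigD1 k)//= [X in _ * X]big1 ?mulr1; last first.
      by move=> i ik; rewrite /F (negbTE ik); under eq_bigr do rewrite mulr1; exact: w1.
    have ya : `|a * y k| <= pi / 2.
      rewrite normrM (gtr0_norm a0) /a -[leRHS](@divfK _ M) ?gt_eqF//.
      by rewrite ler_wpM2l ?divr_ge0 ?(ltW p0) ?(ltW M0)//; move/forallP : yM.
    apply: le_trans (_ : (\sum_(p < n.+2) fejer n (a * y k + pi - grid_angle R n p) *
        `|a * y k - (grid_angle R n p - pi)|) / a <= _); last first.
      by rewrite ler_wpM2r ?invr_ge0 ?(ltW a0)// nP.
    rewrite mulr_suml; apply: ler_sum => p _; rewrite /F eqxx -mulrA ler_wpM2l//.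
    rewrite -[X in _ / X](gtr0_norm a0) -normfV -normrM mulrBl mulrAC divff ?gt_eqF//.
    by rewrite mul1r.
  apply: (@le_trans _ _ (L * (N%:R * (delta / a)))).
    rewrite ler_wpM2l// -[N in N%:R]card_ord mulr_natl -sumr_const.
    by apply: ler_sum => k _; exact: key.
  have -> : delta / a = eps / (L * N%:R + 1).
    by rewrite /delta; field; rewrite !gt_eqF.
  have -> : L * (N%:R * (eps / (L * N%:R + 1))) = eps * (L * N%:R) / (L * N%:R + 1).
    by field; rewrite gt_eqF.
  by rewrite ler_pdivrMr// ler_wpM2l ?(ltW e0)// lerDl.
(* Some coordinate exceeds [M], hence [S >= M^2], and 1, [M] and all [|y_i|] are bounded by
   [S / M]. *)
rewrite negb_forall => /existsP[k]; rewrite -ltNge => kM.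
have yS i : `|y i| ^+ 2 <= S.
  by rewrite real_normK ?num_real// /S (bigD1 i)//= lerDl sumr_ge0// => j _; exact: sqr_ge0.
have M2 : M ^+ 2 <= S by rewrite (le_trans _ (yS k))// ler_pXn2r ?nnegrE ?(ltW M0)// ltW.
have MS : M <= S / M by rewrite ler_pdivlMr// -expr2.
have S1 : 1 <= S / M by rewrite (le_trans M1).
have yi i : `|y i| <= S / M.
  have [yM|My] := leP `|y i| M; first exact: le_trans yM MS.
  by rewrite ler_pdivlMr// (le_trans _ (yS i))// expr2 ler_wpM2l// ltW.
have : `|psi y - f y| <= C * (S / M).
  apply: (le_trans (ler_normB _ _)); apply: (le_trans (lerD (psi_le y) (f_le y))).
  have H1 : `|psi (fun=> 0)| <= `|psi (fun=> 0)| * (S / M) by rewrite ler_peMr.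
  have H2 : L * \sum_(k < N) `|y k| <= L * N%:R * (S / M).
    rewrite -mulrA ler_wpM2l// -[N in N%:R]card_ord mulr_natl -sumr_const.
    by apply: ler_sum => i _; exact: yi.
  have H3 : L * (N%:R * (2 * M)) <= 2 * (L * N%:R * (S / M)).
    have -> : L * (N%:R * (2 * M)) = 2 * (L * N%:R) * M by ring.
    by rewrite [leRHS]mulrA ler_wpM2l// !mulr_ge0.
  rewrite /C; lra.
move=> /le_trans; apply; rewrite mulrA ler_pdivrMr//.
have CM : C <= eps * M by rewrite /M mulrDr mulr1 mulrCA divff ?gt_eqF// mulr1 lerDr ltW.
rewrite mulrAC (@le_trans _ _ (eps * M * S))// ?ler_wpM2r// ler_wpM2l ?lerDr//.
by rewrite mulr_ge0// ltW.
Qed.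

End trigonometric_polynomials.

(** * Empirical covariances of the features *)

Lemma L1_sqr_sum d (T : measurableType d) (R : realType)
    (mu : {measure set T -> \bar R}) (n : nat) (f : 'I_n -> T -> R) :
  (forall k, measurable_fun setT (f k)) -> (forall k, L1 mu (fun t => f k t ^+ 2)) ->
  L1 mu (fun t => (\sum_(k < n) f k t) ^+ 2).
Proof.
move=> mf lf.
have l : L1 mu (fun t => \sum_(i < n) \sum_(j < n) f i t * f j t).
  by apply: L1_sum => i _; apply: L1_sum => j _; exact: L1_sqr_mul.
by apply: eq_L1 l => t; rewrite expr2 big_distrlr.
Qed.

Section orthogonal_sum.
Context d (T : measurableType d) (R : realType) (P : probability T R).

Lemma orthogonal_sum_sqr (n : nat) (xi : 'I_n -> T -> R) (v : R) :
  (forall j, measurable_fun setT (xi j)) ->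
  (forall j, L1 P (fun t => xi j t ^+ 2)) ->
  (forall i j, i != j -> \int[P]_t (xi i t * xi j t) = 0) ->
  (forall j, \int[P]_t (xi j t ^+ 2) <= v) ->
  L1 P (fun t => (\sum_(j < n) xi j t) ^+ 2) /\
  \int[P]_t (\sum_(j < n) xi j t) ^+ 2 <= n%:R * v.
Proof.
move=> mxi l2 o v2.
have l i j : L1 P (fun t => xi i t * xi j t) by exact: L1_sqr_mul.
have E t : (\sum_(j < n) xi j t) ^+ 2 = \sum_(i < n) \sum_(j < n) xi i t * xi j t.
  by rewrite expr2 big_distrlr.
have ll i : L1 P (fun t => \sum_(j < n) xi i t * xi j t) by apply: L1_sum => j _.
have lS : L1 P (fun t => \sum_(i < n) \sum_(j < n) xi i t * xi j t).
  by apply: L1_sum => i _; exact: ll.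
split; first by apply: eq_L1 lS => t; rewrite E.
under eq_Rintegral do rewrite E.
rewrite Rintegral_sumr// (@le_trans _ _ (\sum_(i < n) v))//; last first.
  by rewrite sumr_const card_ord mulr_natl.
apply: ler_sum => i _; rewrite Rintegral_sumr// (bigD1 i)//= big1 ?addr0.
  exact: v2.
by move=> j ji; rewrite o// eq_sym.
Qed.

End orthogonal_sum.

Section network_variables.
Context d (T : measurableType d) (R : realType) (P : probability T R).
Variables (w w0 : nat -> T -> R).
Hypothesis law_w : forall j, has_law P (w j) std_normal.
Hypothesis law_w0 : forall j, has_law P (w0 j) std_normal.

Definition network_vars (i : nat + nat) : T -> R :=
  match i with inl j => w j | inr j => w0 j end.

Hypothesis ind : mutually_independent P network_vars.
Local Notation gamma := (@std_normal R).

Lemma network_vars_measurable i : measurable_fun setT (network_vars i).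
Proof. by case: i => j; [case: (law_w j)|case: (law_w0 j)]. Qed.

Let mw j : measurable_fun setT (w j). Proof. exact: (network_vars_measurable (inl j)). Qed.
Let mw0 j : measurable_fun setT (w0 j). Proof. exact: (network_vars_measurable (inr j)). Qed.

Lemma inner_weight_other (h : R -> R) i j : measurable_fun setT h ->
  measurable_fun [set: g_sigma_algebraType (other_cylinders network_vars (inl i))]
    (fun t => h (w0 j t)).
Proof.
move=> mh; apply: (measurableT_comp mh).
exact: (measurable_other (X := network_vars) (i := inr j)).
Qed.

Lemma inner_weights_uncorrelated (f g : R -> R) i j : i != j ->
  measurable_fun setT f -> measurable_fun setT g -> L1 gamma f -> L1 gamma g ->
  \int[P]_t (f (w0 i t) * g (w0 j t)) = \int[gamma]_z f z * \int[gamma]_z g z.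
Proof.
move=> ij mf mg lf lg.
rewrite -(has_law_Rintegral (law_w0 j) mg lg).
apply: (indep_RintegralM network_vars_measurable ind (law_w0 i : has_law P (network_vars (inr i)) gamma) mf _ lf).
- apply: (measurableT_comp mg).
  apply: (measurable_other (X := network_vars) (i := inr j)).
  by apply: contra ij => /eqP[->].
- exact: (has_law_L1 (law_w0 j)).
Qed.

(** Centred functions of distinct inner weights are orthogonal, and a variance is at most the second
    moment. The injection [ka] lets disjoint blocks of neurons be treated alike. *)
Lemma empirical_mean_variance (n : nat) (ka : 'I_n -> nat) (f : R -> R) :
  (0 < n)%N -> injective ka -> measurable_fun setT f ->
  L1 gamma (fun z => f z ^+ 2) ->
  L1 P (fun t => (n%:R^-1 * \sum_(j < n) f (w0 (ka j) t) - \int[gamma]_z f z) ^+ 2) /\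
  \int[P]_t (n%:R^-1 * \sum_(j < n) f (w0 (ka j) t) - \int[gamma]_z f z) ^+ 2 <=
    n%:R^-1 * \int[gamma]_z f z ^+ 2.
Proof.
move=> n0 ik mf lf2; set m := \int[gamma]_z f z.
have lf : L1 gamma f by apply: (@L1_of_sqr _ _ _ gamma).
have nn : n%:R != 0 :> R by rewrite pnatr_eq0 -lt0n.
pose c z := f z - m.
have mc : measurable_fun setT c by exact: measurable_funB.
have lc : L1 gamma c by apply: L1B => //; exact: (@L1_cst _ _ _ gamma).
have c0 : \int[gamma]_z c z = 0.
  by rewrite (RintegralB measurableT lf (@L1_cst _ _ _ gamma m)) Rintegral_probability_cst subrr.
have cE z : c z ^+ 2 = f z ^+ 2 - 2 * m * f z + m ^+ 2 by rewrite /c; ring.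
have lmf : L1 gamma (fun z => 2 * m * f z) by exact: L1Z.
have lc2 : L1 gamma (fun z => c z ^+ 2).
  apply: eq_L1 (L1D (L1B lf2 lmf) (@L1_cst _ _ _ gamma (m ^+ 2))) => z.
  by rewrite cE.
have c2 : \int[gamma]_z c z ^+ 2 <= \int[gamma]_z f z ^+ 2.
  under eq_Rintegral do rewrite cE.
  rewrite (RintegralD measurableT (L1B lf2 lmf) (@L1_cst _ _ _ gamma (m ^+ 2))).
  rewrite (RintegralB measurableT lf2 lmf) (@RintegralZl _ _ _ gamma _ _ _ measurableT lf).
  rewrite Rintegral_probability_cst -/m.
  by have := sqr_ge0 m; lra.
have mc2 : measurable_fun setT (fun z => c z ^+ 2) by exact: measurable_funX.
have [||||l E] := @orthogonal_sum_sqr _ _ _ P n (fun j t => c (w0 (ka j) t)) (\int[gamma]_z f z ^+ 2).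
- by move=> j; exact: measurableT_comp.
- by move=> j; exact: (has_law_L1 (law_w0 (ka j)) mc2).
- move=> i j ij; rewrite inner_weights_uncorrelated ?c0 ?mul0r//.
  by rewrite (inj_eq ik).
- by move=> j; rewrite (has_law_Rintegral (law_w0 (ka j)) mc2).
have SE t : (n%:R^-1 * \sum_(j < n) f (w0 (ka j) t) - m) ^+ 2 =
    (n%:R^-1) ^+ 2 * (\sum_(j < n) c (w0 (ka j) t)) ^+ 2.
  rewrite -exprMn; congr (_ ^+ 2).
  by rewrite /c sumrB sumr_const card_ord -[m *+ n]mulr_natl mulrBr mulKf.
split; first by apply: eq_L1 (L1Z _ l) => t; rewrite SE.
under eq_Rintegral do rewrite SE.
rewrite (@RintegralZl _ _ _ P _ _ _ measurableT l).
apply: (@le_trans _ _ (n%:R^-1 ^+ 2 * (n%:R * \int[gamma]_z f z ^+ 2))).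
  by rewrite ler_wpM2l// sqr_ge0.
by rewrite expr2 -mulrA mulKf.
Qed.

(** Cross terms vanish because [w (ka i)] is centred and independent of the three other factors. *)
Lemma network_sum_sqr (n : nat) (ka : 'I_n -> nat) (h : R -> R) :
  injective ka -> measurable_fun setT h ->
  L1 gamma (fun z => h z ^+ 2) ->
  L1 P (fun t => (\sum_(j < n) w (ka j) t * h (w0 (ka j) t)) ^+ 2) /\
  \int[P]_t (\sum_(j < n) w (ka j) t * h (w0 (ka j) t)) ^+ 2 <= n%:R * \int[gamma]_z h z ^+ 2.
Proof.
move=> ik mh lh.
have mh2 : measurable_fun setT (fun z => h z ^+ 2) by exact: measurable_funX.
have sqrE j t : (w j t * h (w0 j t)) ^+ 2 = w j t ^+ 2 * h (w0 j t) ^+ 2 by rewrite exprMn.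
have lw j : has_law P (network_vars (inl j)) gamma := law_w j.
have lh0 j : L1 P (fun t => h (w0 j t) ^+ 2) := has_law_L1 (law_w0 j) mh2 lh.
have lwh j : L1 P (fun t => (w j t * h (w0 j t)) ^+ 2).
  have msq : measurable_fun setT (fun z : R => z ^+ 2) by exact: measurable_funX.
  have := indep_L1M network_vars_measurable ind (lw j) msq
    (inner_weight_other j mh2) (std_normal_sqr_L1 R) (lh0 j).
  by apply: eq_L1 => t; rewrite sqrE.
apply: (@orthogonal_sum_sqr _ _ _ P n (fun j t => w (ka j) t * h (w0 (ka j) t))) => //.
- by move=> j; apply: measurable_funM => //; exact: measurableT_comp.
- move=> i j ij.
  have mo : measurable_fun [set: g_sigma_algebraType (other_cylinders network_vars (inl (ka i)))]
      (fun t => h (w0 (ka i) t) * (w (ka j) t * h (w0 (ka j) t))).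
    apply: measurable_funM; first exact: inner_weight_other.
    apply: measurable_funM; last exact: inner_weight_other.
    apply: (measurable_other (X := network_vars) (i := inl (ka j))).
    by apply: contra ij => /eqP[/ik ->]; rewrite eqxx.
  have lo : L1 P (fun t => h (w0 (ka i) t) * (w (ka j) t * h (w0 (ka j) t))).
    apply: L1_sqr_mul => //; first exact: measurableT_comp.
    by apply: measurable_funM => //; exact: measurableT_comp.
  transitivity (\int[P]_t (w (ka i) t * (h (w0 (ka i) t) * (w (ka j) t * h (w0 (ka j) t))))).
    by apply: eq_Rintegral => t _; rewrite /= -mulrA.
  rewrite (indep_RintegralM network_vars_measurable ind (lw (ka i)) (f := fun z : R => z) _ mo
    (std_normal_L1 R) lo)//.
  by rewrite std_normal_mean mul0r.
- move=> j; under eq_Rintegral do rewrite sqrE.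
  rewrite (indep_RintegralM network_vars_measurable ind (lw (ka j)) (f := fun z : R => z ^+ 2)
    _ (inner_weight_other (ka j) mh2) (std_normal_sqr_L1 R) (lh0 (ka j))); last exact: measurable_funX.
  by rewrite std_normal_sqr mul1r (has_law_Rintegral (law_w0 (ka j)) mh2 lh).
Qed.

End network_variables.

(** * Interpolation under a Hilbert-Schmidt bound on the second derivative *)

Section interpolation_hilbert_schmidt.
Context d (T : measurableType d) (R : realType) (P : probability T R).
Variables (K : normedModType R) (phi : K -> R) (D Q : K -> K -> R) (L : R).
Hypothesis dphi : forall v, differentiable phi v.
Hypothesis phiD : forall v h, 'd phi v h = D v h.
Hypothesis L_ge0 : 0 <= L.
Hypothesis D_le : forall v h, `|D v h| <= L * `|h|.
Hypothesis D_cont : forall h, continuous (D ^~ h).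
Hypothesis dD : forall v h (z : R),
  is_derive z 1 (fun z => D (v + z *: h) h) (Q (v + z *: h) h).
Hypothesis Q_le : forall v h, `|Q v h| <= L * `|h| ^+ 2.
Variables (N : nat) (e : 'I_N -> K) (q : K -> 'I_N -> 'I_N -> R).
Hypothesis QE : forall v (c : 'I_N -> R),
  Q v (\sum_(k < N) c k *: e k) = \sum_(k < N) \sum_(l < N) q v k l * (c k * c l).
Hypothesis q_le : forall v, \sum_(k < N) \sum_(l < N) q v k l ^+ 2 <= 1.

Variables (I : eqType) (X : I -> T -> R).
Hypothesis mX : forall i, measurable_fun setT (X i).
Hypothesis indX : mutually_independent P X.
Variables (p : nat) (g : 'I_p -> I) (U : 'I_p -> 'I_N -> T -> R).
Hypothesis g_inj : injective g.
Hypothesis lawX : forall j, has_law P (X (g j)) std_normal.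
Hypothesis mU : forall i j k,
  measurable_fun [set: g_sigma_algebraType (other_cylinders X (g i))] (U j k).
Hypothesis U_sqr : forall j k, L1 P (fun t => U j k t ^+ 2).

Let mUT j k : measurable_fun setT (U j k).
Proof. exact: (measurable_fun_other mX (@mU j j k)). Qed.

Let u_sqr j : L1 P (fun t => `|\sum_(k < N) U j k t *: e k| ^+ 2).
Proof.
have l : L1 P (fun t => (\sum_(k < N) `|U j k t| * `|e k|) ^+ 2).
  apply: L1_sqr_sum => k; first by apply: measurable_funM => //; exact: measurableT_comp.
  by apply: eq_L1 (L1Z (`|e k| ^+ 2) (U_sqr j k)) => t; rewrite exprMn real_normK ?num_real// mulrC.
apply: (L1_dominated _ l).
  apply: measurable_funX.
  apply: (@measurable_continuous_combination _ _ R K _ _ _ _ (fun v _ => `|v|)) => //.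
  by move=> t; exact: norm_continuous.
move=> t; rewrite ger0_norm ?sqr_ge0// ler_pXn2r ?nnegrE// ?sumr_ge0//.
apply: (le_trans (ler_norm_sum _ _ _)); apply: ler_sum => k _.
by rewrite normrZ.
Qed.

(* The pairing is split by [x y <= (ep x^2 + y^2 / ep) / 2] instead of
   Cauchy-Schwarz. *)
Lemma interpolation_hs (A B : 'I_p -> R) (ep : R) :
  (forall j, A j * B j = 0) -> 0 < ep ->
  let m k l t := \sum_(j < p) (A j ^+ 2 - B j ^+ 2) * (U j k t * U j l t) in
  (forall k l, L1 P (fun t => m k l t ^+ 2)) ->
  `|\int[P]_t phi (\sum_(j < p) (A j * X (g j) t) *: \sum_(k < N) U j k t *: e k) -
    \int[P]_t phi (\sum_(j < p) (B j * X (g j) t) *: \sum_(k < N) U j k t *: e k)|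
  <= ep + ep^-1 * \sum_(k < N) \sum_(l < N) \int[P]_t m k l t ^+ 2.
Proof.
move=> AB0 ep0 m lm.
(* A pointwise bound for the pairing since the squared entries of [q] sum to at most 1; the half
   cancels the 2 of the interpolation theorem. *)
pose M t := 2^-1 * (ep + ep^-1 * \sum_(k < N) \sum_(l < N) m k l t ^+ 2).
have lS : L1 P (fun t => \sum_(k < N) \sum_(l < N) m k l t ^+ 2).
  by apply: L1_sum => k _; apply: L1_sum => l _.
have lM : L1 P M by apply: L1Z; apply: L1D; [exact: L1_cst|exact: L1Z].
have EM : \int[P]_t M t =
    2^-1 * (ep + ep^-1 * \sum_(k < N) \sum_(l < N) \int[P]_t m k l t ^+ 2).
  rewrite (@RintegralZl _ _ _ P _ _ _ measurableT (L1D (L1_cst P ep) (L1Z ep^-1 lS))).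
  rewrite (RintegralD measurableT (L1_cst P ep) (L1Z ep^-1 lS)).
  rewrite Rintegral_probability_cst (@RintegralZl _ _ _ P _ _ _ measurableT lS).
  rewrite Rintegral_sumr; last by move=> k _; apply: L1_sum => l _.
  congr (_ * (_ + _ * _)); apply: eq_bigr => k _.
  by rewrite Rintegral_sumr.
have := @gaussian_interpolation _ _ R P K phi D Q L dphi phiD L_ge0 D_le D_cont dD Q_le
  I X mX indX p N g U e g_inj lawX mU u_sqr A B M AB0 lM.
rewrite EM mulrA divff// mul1r; apply.
move=> v t.
have -> : \sum_(j < p) (A j ^+ 2 - B j ^+ 2) * Q v (\sum_(k < N) U j k t *: e k) =
    \sum_(k < N) \sum_(l < N) q v k l * m k l t.
  under eq_bigr do rewrite QE mulr_sumr.
  rewrite exchange_big; apply: eq_bigr => k _ /=.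
  under eq_bigr do rewrite mulr_sumr.
  rewrite exchange_big; apply: eq_bigr => l _ /=.
  by rewrite mulr_sumr; apply: eq_bigr => j _; rewrite mulrCA.
have am (x y : R) : `|x * y| <= 2^-1 * (ep * x ^+ 2 + ep^-1 * y ^+ 2).
  rewrite -(ler_pM2l (_ : 0 < 2 * ep)) ?mulr_gt0//.
  have -> : 2 * ep * (2^-1 * (ep * x ^+ 2 + ep^-1 * y ^+ 2)) = ep ^+ 2 * x ^+ 2 + y ^+ 2.
    by field; rewrite gt_eqF.
  rewrite normrM -(real_normK (num_real x)) -(real_normK (num_real y)).
  by have := sqr_ge0 (ep * `|x| - `|y|); nra.
apply: (@le_trans _ _ (\sum_(k < N) \sum_(l < N)
    2^-1 * (ep * q v k l ^+ 2 + ep^-1 * m k l t ^+ 2))).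
  apply: (le_trans (ler_norm_sum _ _ _)); apply: ler_sum => k _.
  by apply: (le_trans (ler_norm_sum _ _ _)); apply: ler_sum.
under eq_bigr do rewrite -mulr_sumr big_split /= -!mulr_sumr.
rewrite -mulr_sumr big_split /= -!mulr_sumr /M ler_wpM2l// lerD2r.
by rewrite -[leRHS]mulr1 ler_wpM2l// ltW.
Qed.

End interpolation_hilbert_schmidt.

(** * Shallow networks *)

Section network_comparison.
Context d (T : measurableType d) (R : realType) (P : probability T R).
Variables (w w0 : nat -> T -> R).
Hypothesis law_w : forall j, has_law P (w j) std_normal.
Hypothesis law_w0 : forall j, has_law P (w0 j) std_normal.
Hypothesis ind : mutually_independent P (network_vars w w0).
Local Notation gamma := (@std_normal R).

(** The offset [s] selects which neurons are used: with [s = n] the network shares none of the first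
    [n]. The feature [h] is arbitrary, so that linear combinations and increments of network values
    are again of this form. *)
Definition network_sum (s n : nat) (h : R -> R) (t : T) : R :=
  (Num.sqrt n%:R)^-1 * \sum_(j < n) w (s + j) t * h (w0 (s + j) t).

Let mvars := network_vars_measurable law_w law_w0.
Let mw0 j : measurable_fun setT (w0 j). Proof. exact: (mvars (inr j)). Qed.
Let mw j : measurable_fun setT (w j). Proof. exact: (mvars (inl j)). Qed.

Let sqrt_inv_sqr (n : nat) : (Num.sqrt n%:R)^-1 ^+ 2 = n%:R^-1 :> R.
Proof. by rewrite exprVn sqr_sqrtr. Qed.

Let sqrt_inv_gt0 (n : nat) : (0 < n)%N -> 0 < (Num.sqrt n%:R)^-1 :> R.
Proof. by move=> n0; rewrite invr_gt0 sqrtr_gt0 ltr0n. Qed.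

Lemma network_sum_measurable s n (h : R -> R) : measurable_fun setT h ->
  measurable_fun setT (network_sum s n h).
Proof.
move=> mh; apply: measurable_funM => //; apply: measurable_sum => j.
by apply: measurable_funM => //; exact: measurableT_comp.
Qed.

Lemma network_sum_moment s n (h : R -> R) : (0 < n)%N -> measurable_fun setT h ->
  L1 gamma (fun z => h z ^+ 2) ->
  L1 P (fun t => network_sum s n h t ^+ 2) /\
  \int[P]_t network_sum s n h t ^+ 2 <= \int[gamma]_z h z ^+ 2.
Proof.
move=> n0 mh lh.
have ik : injective (fun j : 'I_n => (s + j)%N) by move=> i j /addnI /val_inj.
have [l E] := network_sum_sqr law_w law_w0 ind ik mh lh.
have FE t : network_sum s n h t ^+ 2 =
    n%:R^-1 * (\sum_(j < n) w (s + j) t * h (w0 (s + j) t)) ^+ 2.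
  by rewrite /network_sum exprMn sqrt_inv_sqr.
split; first by apply: eq_L1 (L1Z n%:R^-1 l) => t; rewrite FE.
under eq_Rintegral do rewrite FE.
by rewrite (@RintegralZl _ _ _ P _ _ _ measurableT l) ler_pdivrMl ?ltr0n.
Qed.

Section differentiable_functional.
Variables (K : normedModType R) (phi : K -> R) (D Q : K -> K -> R) (L : R).
Hypothesis dphi : forall v, differentiable phi v.
Hypothesis phiD : forall v h, 'd phi v h = D v h.
Hypothesis L_ge0 : 0 <= L.
Hypothesis D_le : forall v h, `|D v h| <= L * `|h|.
Hypothesis D_cont : forall h, continuous (D ^~ h).
Hypothesis dD : forall v h (z : R),
  is_derive z 1 (fun z => D (v + z *: h) h) (Q (v + z *: h) h).
Hypothesis Q_le : forall v h, `|Q v h| <= L * `|h| ^+ 2.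
Variables (N : nat) (e : 'I_N -> K) (q : K -> 'I_N -> 'I_N -> R).
Hypothesis QE : forall v (c : 'I_N -> R),
  Q v (\sum_(k < N) c k *: e k) = \sum_(k < N) \sum_(l < N) q v k l * (c k * c l).
Hypothesis q_le : forall v, \sum_(k < N) \sum_(l < N) q v k l ^+ 2 <= 1.

(** Interpolation over [n + m] neurons: [A] is [n^{-1/2}] on the first block, [B] is [m^{-1/2}] on
    the second, and both vanish elsewhere. With [ep = n^{-1/2}] the two terms of the interpolation
    bound have the same order, and the result does not depend on [m]. *)
Lemma network_sum_width (n m : nat) (h : 'I_N -> R -> R) :
  (0 < n)%N -> (n <= m)%N ->
  (forall k, measurable_fun setT (h k)) ->
  (forall k l, L1 gamma (fun z => (h k z * h l z) ^+ 2)) ->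
  `|\int[P]_t phi (\sum_(k < N) network_sum 0 n (h k) t *: e k) -
    \int[P]_t phi (\sum_(k < N) network_sum n m (h k) t *: e k)| <=
  (1 + 4 * \sum_(k < N) \sum_(l < N) \int[gamma]_z (h k z * h l z) ^+ 2) *
    (Num.sqrt n%:R)^-1.
Proof.
move=> n0 nm mh lh.
have m0 : (0 < m)%N by exact: leq_trans nm.
pose rn : R := (Num.sqrt n%:R)^-1; pose rm : R := (Num.sqrt m%:R)^-1.
pose A (j : 'I_(n + m)) := if (j < n)%N then rn else 0.
pose B (j : 'I_(n + m)) := if (j < n)%N then 0 else rm.
pose U (j : 'I_(n + m)) k t := h k (w0 j t).
have An j : A (lshift m j) = rn by rewrite /A /= ltn_ord.
have Am j : A (rshift n j) = 0 by rewrite /A /= ltnNge leq_addr.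
have Bn j : B (lshift m j) = 0 by rewrite /B /= ltn_ord.
have Bm j : B (rshift n j) = rm by rewrite /B /= ltnNge leq_addr.
have ZE (J : finType) (r : R) (ka : J -> nat) t :
    \sum_j (r * w (ka j) t) *: \sum_(k < N) h k (w0 (ka j) t) *: e k =
    \sum_(k < N) (r * \sum_j w (ka j) t * h k (w0 (ka j) t)) *: e k.
  under eq_bigr do rewrite scaler_sumr.
  rewrite exchange_big; apply: eq_bigr => k _ /=.
  rewrite mulr_sumr scaler_suml; apply: eq_bigr => j _.
  by rewrite scalerA mulrA.
have ZA t : \sum_(j < n + m) (A j * w j t) *: (\sum_(k < N) U j k t *: e k) =
    \sum_(k < N) network_sum 0 n (h k) t *: e k.
  rewrite big_split_ord /= [X in _ + X]big1 ?addr0 => [|j _]; last first.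
    by rewrite Am mul0r scale0r.
  under eq_bigr do rewrite An.
  by rewrite (ZE _ rn (fun j : 'I_n => j : nat)).
have ZB t : \sum_(j < n + m) (B j * w j t) *: (\sum_(k < N) U j k t *: e k) =
    \sum_(k < N) network_sum n m (h k) t *: e k.
  rewrite big_split_ord /= big1 ?add0r => [|j _]; last first.
    by rewrite Bn mul0r scale0r.
  under eq_bigr do rewrite Bm.
  by rewrite (ZE _ rm (fun j : 'I_m => (n + j)%N)).
have mhh k l : measurable_fun setT (fun z => h k z * h l z) by exact: measurable_funM.
pose M k l t := \sum_(j < n + m) (A j ^+ 2 - B j ^+ 2) * (U j k t * U j l t).
pose mu k l := \int[gamma]_z (h k z * h l z).
pose I k l := \int[gamma]_z (h k z * h l z) ^+ 2.
(* Both empirical covariances are centred at the same [mu], which cancels in their difference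
   [M]. *)
pose en k l t := n%:R^-1 * \sum_(j < n) (h k (w0 j t) * h l (w0 j t)) - mu k l.
pose em k l t := m%:R^-1 * \sum_(j < m) (h k (w0 (n + j) t) * h l (w0 (n + j) t)) - mu k l.
have ME k l t : M k l t = en k l t - em k l t.
  rewrite /M big_split_ord /= /en /em opprB addrA subrK !mulr_sumr -sumrN.
  congr (_ + _); apply: eq_bigr => j _.
    by rewrite An Bn expr0n subr0 sqrt_inv_sqr.
  by rewrite Am Bm expr0n sub0r sqrt_inv_sqr mulNr.
have [len Een] : (forall k l, L1 P (fun t => en k l t ^+ 2)) /\
    (forall k l, \int[P]_t en k l t ^+ 2 <= n%:R^-1 * I k l).
  split=> k l;
    by have [] := empirical_mean_variance law_w law_w0 ind n0 (@ord_inj n) (mhh k l) (lh k l).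
have [lem Eem] : (forall k l, L1 P (fun t => em k l t ^+ 2)) /\
    (forall k l, \int[P]_t em k l t ^+ 2 <= m%:R^-1 * I k l).
  have ik : injective (fun j : 'I_m => (n + j)%N) by move=> i j /addnI /val_inj.
  split=> k l;
    by have [] := empirical_mean_variance law_w law_w0 ind m0 ik (mhh k l) (lh k l).
have me k l : measurable_fun setT (en k l) /\ measurable_fun setT (em k l).
  split; apply: measurable_funB => //; apply: measurable_funM => //;
    by apply: measurable_sum => j; apply: measurable_funM; exact: measurableT_comp.
have lD k l : L1 P (fun t => 2 * (en k l t ^+ 2 + em k l t ^+ 2)).
  by apply: L1Z; exact: L1D.
have Mle k l t : M k l t ^+ 2 <= 2 * (en k l t ^+ 2 + em k l t ^+ 2).
  by rewrite ME; have := sqr_ge0 (en k l t + em k l t); nra.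
have mM k l : measurable_fun setT (fun t => M k l t ^+ 2).
  apply: measurable_funX; rewrite (_ : M k l = fun t => en k l t - em k l t).
    by have [? ?] := me k l; exact: measurable_funB.
  by apply/funext => t; exact: ME.
have lM k l : L1 P (fun t => M k l t ^+ 2).
  by apply: (L1_dominated (mM k l) (lD k l)) => t; rewrite ger0_norm ?sqr_ge0.
have I0 k l : 0 <= I k l by apply: Rintegral_ge0 => z _; exact: sqr_ge0.
(* Each block has variance at most [I / n], the second one because [n <= m]; together with
   [(x - y)^2 <= 2 x^2 + 2 y^2] this gives the factor 4. *)
have EM k l : \int[P]_t M k l t ^+ 2 <= 4 * n%:R^-1 * I k l.
  apply: (@le_trans _ _ (\int[P]_t (2 * (en k l t ^+ 2 + em k l t ^+ 2)))).
    by apply: le_Rintegral.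
  rewrite (@RintegralZl _ _ _ P _ _ _ measurableT (L1D (len k l) (lem k l))).
  rewrite (RintegralD measurableT (len k l) (lem k l)).
  have nmI : m%:R^-1 * I k l <= n%:R^-1 * I k l.
    by rewrite ler_wpM2r// lef_pV2 ?posrE ?ltr0n// ler_nat.
  by have := Een k l; have := Eem k l; move: nmI; lra.
have AB0 j : A j * B j = 0 by rewrite /A /B; case: ifP; rewrite ?mulr0 ?mul0r.
have g_inj : injective (fun j : 'I_(n + m) => inl (j : nat) : nat + nat).
  by move=> i j [] /val_inj.
have U_sqr (j : 'I_(n + m)) k : L1 P (fun t => U j k t ^+ 2).
  apply: (has_law_L1 (law_w0 j) (f := fun z => h k z ^+ 2)).
    exact: measurable_funX.
  apply: (@L1_of_sqr _ _ _ gamma); first exact: measurable_funX.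
  by apply: eq_L1 (lh k k) => z; rewrite -expr2.
have mU (i j : 'I_(n + m)) k :
    measurable_fun [set: g_sigma_algebraType (other_cylinders (network_vars w w0) (inl (i : nat)))] (U j k).
  exact: inner_weight_other.
have rn0 : 0 < rn by exact: sqrt_inv_gt0.
have lw (j : 'I_(n + m)) : has_law P (network_vars w w0 (inl (j : nat))) gamma := law_w j.
have := interpolation_hs dphi phiD L_ge0 D_le D_cont dD Q_le QE q_le mvars ind g_inj lw mU
  U_sqr AB0 rn0 lM.
under eq_Rintegral do rewrite ZA.
under [X in _ - X]eq_Rintegral do rewrite ZB.
move=> /le_trans; apply.
rewrite [leRHS]mulrDl mul1r lerD2l -/rn.
apply: (@le_trans _ _ (rn^-1 * \sum_(k < N) \sum_(l < N) (4 * n%:R^-1 * I k l))).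
  rewrite ler_wpM2l ?invr_ge0 ?(ltW rn0)//.
  by apply: ler_sum => k _; apply: ler_sum => l _; exact: EM.
under eq_bigr do rewrite -mulr_sumr.
rewrite -mulr_sumr -(sqrt_inv_sqr n) -/rn le_eqVlt; apply/orP; left; apply/eqP.
by field; rewrite gt_eqF.
Qed.

End differentiable_functional.

(* The [m] neurons are interpolated with one extra term [sg * w (s + m)], the
   outer weight of an unused neuron, which is exactly Gaussian. *)
Lemma network_sum_cos (s m : nat) (h : R -> R) (b sg : R) :
  (0 < m)%N -> measurable_fun setT h -> L1 gamma (fun z => h z ^+ 4) ->
  sg ^+ 2 = \int[gamma]_z h z ^+ 2 ->
  `|\int[P]_t cos (network_sum s m h t + b) - \int[gamma]_z cos (sg * z + b)| <=
  (1 + \int[gamma]_z h z ^+ 4) * (Num.sqrt m%:R)^-1.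
Proof.
move=> m0 mh lh sgE.
pose rm : R := (Num.sqrt m%:R)^-1.
have rm0 : 0 < rm by exact: sqrt_inv_gt0.
pose phi (x : R^o) : R := cos (x + b).
pose D (x y : R^o) : R := - sin (x + b) * y.
pose Q (x y : R^o) : R := - cos (x + b) * y ^+ 2.
have dsin (x y c : R) : is_derive x 1 (fun x : R => sin (c + y * x)) (y * cos (c + y * x)).
  by have := @is_derive_comp_affine _ sin _ c y x (is_derive_sin (c + y * x)).
have dcos (x : R) : is_derive x 1 (fun x : R => cos (x + b)) (- sin (x + b)).
  have := @is_derive_comp_affine _ cos (- sin (b + 1 * x)) b 1 x (is_derive_cos (b + 1 * x)).
  rewrite !mul1r [b + x]addrC.
  by congr (is_derive _ _ _ _); apply/funext => y; rewrite mul1r addrC.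
have dphi (v : R^o) : differentiable phi v by apply/derivable1_diffP; case: (dcos v).
have phiD (v y : R^o) : 'd phi v y = D v y.
  have -> : y = y *: (1 : R^o) by rewrite /GRing.scale /= mulr1.
  rewrite linearZ /= -deriveE//; case: (dcos v) => _ -> .
  by rewrite /D /GRing.scale /= mulr1 mulrC.
have sin1 (x : R) : `|sin x| <= 1 by rewrite ler_norml sin_geN1 sin_le1.
have cos1 (x : R) : `|cos x| <= 1 by rewrite ler_norml cos_geN1 cos_le1.
have D_le (v y : R^o) : `|D v y| <= 1 * `|y|.
  by rewrite /D normrM normrN ler_wpM2r.
have Q_le (v y : R^o) : `|Q v y| <= 1 * `|y| ^+ 2.
  by rewrite /Q normrM normrN normrX ler_wpM2r// sqr_ge0.
have D_cont (y : R^o) : continuous (D ^~ y).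
  move=> x; apply: (@cvgM R _ _ _ (fun x : R => - sin (x + b)) (cst y)); last exact: cvg_cst.
  apply: (@cvgN _ R^o).
  have /derivable1_diffP/differentiable_continuous : derivable (fun x : R => sin (b + 1 * x)) x 1.
    by case: (dsin x 1 b).
  by congr continuous_at; apply/funext => z; rewrite mul1r addrC.
have dD (v y : R^o) (z : R) :
    is_derive z 1 (fun z : R => D (v + z *: y) y) (Q (v + z *: y) y).
  have := is_deriveZ (- y) (dsin z y (v + b)).
  have E (x : R) : v + x *: y + b = v + b + y * x by rewrite addrAC [y * x]mulrC.
  rewrite /D /Q E /GRing.scale /=.
  have -> : - y * (y * cos (v + b + y * z)) = - cos (v + b + y * z) * y ^+ 2 by ring.
  by congr (is_derive _ _ _ _); apply/funext => x; rewrite E mulNr mulrC -mulNr.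
(* The real line is taken as a one-dimensional space with basis vector 1, so the matrix [q] has the
   single entry [- cos]. *)
pose e (k : 'I_1) : R^o := 1.
pose q (v : R^o) (k l : 'I_1) : R := - cos (v + b).
have QE (v : R^o) (c : 'I_1 -> R) :
    Q v (\sum_(k < 1) c k *: e k) = \sum_(k < 1) \sum_(l < 1) q v k l * (c k * c l).
  by rewrite !big_ord1 /Q /q /e /GRing.scale /= mulr1 expr2.
have q_le (v : R^o) : \sum_(k < 1) \sum_(l < 1) q v k l ^+ 2 <= 1.
  by rewrite !big_ord1 /q sqrrN -[leRHS](cos2Dsin2 (v + b)) lerDl sqr_ge0.
pose g (j : 'I_(m + 1)) : nat + nat := inl (s + j)%N.
have g_inj : injective g by move=> i j [] /addnI /val_inj.
have lw j : has_law P (network_vars w w0 (g j)) gamma := law_w _.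
pose U (j : 'I_(m + 1)) (k : 'I_1) t := if (j < m)%N then h (w0 (s + j)%N t) else 1.
pose A (j : 'I_(m + 1)) := if (j < m)%N then rm else 0.
pose B (j : 'I_(m + 1)) := if (j < m)%N then 0 else sg.
have An j : A (lshift 1 j) = rm by rewrite /A /= ltn_ord.
have Am j : A (rshift m j) = 0 by rewrite /A /= ltnNge leq_addr.
have Bn j : B (lshift 1 j) = 0 by rewrite /B /= ltn_ord.
have Bm j : B (rshift m j) = sg by rewrite /B /= ltnNge leq_addr.
have Un j k t : U (lshift 1 j) k t = h (w0 (s + j)%N t) by rewrite /U /= ltn_ord.
have Um j k t : U (rshift m j) k t = 1 by rewrite /U /= ltnNge leq_addr.
have AB0 j : A j * B j = 0 by rewrite /A /B; case: ifP; rewrite ?mulr0 ?mul0r.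
have mU (i j : 'I_(m + 1)) k :
    measurable_fun [set: g_sigma_algebraType (other_cylinders (network_vars w w0) (g i))] (U j k).
  rewrite /U; case: (j < m)%N; last exact: measurable_cst.
  exact: inner_weight_other.
have mh2 : measurable_fun setT (fun z => h z ^+ 2) by exact: measurable_funX.
have lh22 : L1 gamma (fun z => (h z ^+ 2) ^+ 2).
  by apply: eq_L1 lh => z; rewrite -exprM.
have lh2 : L1 gamma (fun z => h z ^+ 2) by exact: (@L1_of_sqr _ _ _ gamma).
have U_sqr (j : 'I_(m + 1)) k : L1 P (fun t => U j k t ^+ 2).
  rewrite /U; case: (j < m)%N; last exact: L1_cst.
  exact: (has_law_L1 (law_w0 _) mh2 lh2).
pose M (k l : 'I_1) t := \sum_(j < m + 1) (A j ^+ 2 - B j ^+ 2) * (U j k t * U j l t).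
have ME k l t : M k l t = m%:R^-1 * (\sum_(j < m) h (w0 (s + j)%N t) ^+ 2) -
    \int[gamma]_z h z ^+ 2.
  rewrite /M big_split_ord /= big_ord1 Am Bm !Um expr0n sub0r !mulr1 sgE; congr (_ - _).
  rewrite mulr_sumr; apply: eq_bigr => j _.
  by rewrite An Bn !Un expr0n subr0 sqrt_inv_sqr expr2.
have ik : injective (fun j : 'I_m => (s + j)%N) by move=> i j /addnI /val_inj.
have [lM EM] := empirical_mean_variance law_w law_w0 ind m0 ik mh2 lh22.
have lM' k l : L1 P (fun t => M k l t ^+ 2) by apply: eq_L1 lM => t; rewrite ME.
have := interpolation_hs dphi phiD ler01 D_le D_cont dD Q_le QE q_le mvars ind g_inj lw mU
  U_sqr AB0 rm0 lM'.
have ZA t : phi (\sum_(j < m + 1) (A j * network_vars w w0 (g j) t) *: \sum_(k < 1) U j k t *: e k) =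
    cos (network_sum s m h t + b).
  rewrite big_split_ord /= [X in _ + X]big1 ?addr0 => [|j _]; last first.
    by rewrite Am mul0r scale0r.
  rewrite /phi /network_sum mulr_sumr; congr (cos (_ + _)); apply: eq_bigr => j _.
  by rewrite An big_ord1 Un /e /GRing.scale /= mulr1 mulrA.
have ZB t : phi (\sum_(j < m + 1) (B j * network_vars w w0 (g j) t) *: \sum_(k < 1) U j k t *: e k) =
    cos (sg * w (s + m)%N t + b).
  rewrite big_split_ord /= big1 ?add0r => [|j _]; last first.
    by rewrite Bn mul0r scale0r.
  rewrite /phi !big_ord1 Bm Um /e /GRing.scale /= !mulr1; congr (cos (_ * w (s + _)%N _ + _)).
  by rewrite addn0.
under eq_Rintegral do rewrite ZA.
under [X in _ - X]eq_Rintegral do rewrite ZB.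
have mcos : measurable_fun setT (fun z : R => cos (sg * z + b)).
  apply: (@measurableT_comp _ _ _ _ _ _ (@cos R)).
    by apply: continuous_measurable_fun; exact: continuous_cos.
  by apply: measurable_funD => //; exact: measurable_funM.
have -> : \int[P]_t cos (sg * w (s + m)%N t + b) = \int[gamma]_z cos (sg * z + b).
  apply: (has_law_Rintegral (law_w (s + m)) mcos).
  by apply: (@L1_bounded _ _ _ gamma _ 1 mcos) => z.
move=> /le_trans; apply.
rewrite [leRHS]mulrDl mul1r lerD2l -/rm !big_ord1.
apply: (@le_trans _ _ (rm^-1 * (m%:R^-1 * \int[gamma]_z h z ^+ 4))).
  rewrite ler_wpM2l ?invr_ge0 ?(ltW rm0)//.
  move: EM; under [X in _ <= _ * X]eq_Rintegral do rewrite -exprM.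
  apply: le_trans; rewrite le_eqVlt; apply/orP; left; apply/eqP.
  by apply: eq_Rintegral => t _; rewrite -(ME ord0 ord0).
rewrite -(sqrt_inv_sqr m) -/rm le_eqVlt; apply/orP; left; apply/eqP.
by field; rewrite gt_eqF.
Qed.

End network_comparison.

Lemma trig_poly_L1 d (T : measurableType d) (R : realType) (P : probability T R)
    (N : nat) (f : ('I_N -> R) -> R) (Y : 'I_N -> T -> R) :
  trig_poly f -> (forall k, measurable_fun setT (Y k)) ->
  L1 P (fun t => f (fun k => Y k t)).
Proof.
move=> tf mY; elim: tf => [c b|f1 f2 _ l1 _ l2|c f1 _ l1]; last exact: L1Z.
  apply: (@L1_bounded _ _ _ P _ 1) => [|t]; last by rewrite ler_norml cos_geN1 cos_le1.
  apply: (@measurableT_comp _ _ _ _ _ _ (@cos R)).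
    by apply: continuous_measurable_fun; exact: continuous_cos.
  apply: measurable_funD => //; apply: measurable_sum => k; exact: measurable_funM.
exact: L1D.
Qed.

Lemma quadratic_error_mean d (T : measurableType d) (R : realType) (P : probability T R)
    (N : nat) (psi f : ('I_N -> R) -> R) (Y : 'I_N -> T -> R) (eps : R) :
  (forall y, `|psi y - f y| <= eps * (1 + \sum_(k < N) y k ^+ 2)) ->
  L1 P (fun t => psi (fun k => Y k t)) -> L1 P (fun t => f (fun k => Y k t)) ->
  (forall k, L1 P (fun t => Y k t ^+ 2)) ->
  `|\int[P]_t psi (fun k => Y k t) - \int[P]_t f (fun k => Y k t)| <=
  eps * (1 + \sum_(k < N) \int[P]_t Y k t ^+ 2).
Proof.
move=> H lp lf lY.
have lS : L1 P (fun t => \sum_(k < N) Y k t ^+ 2) by apply: L1_sum => k _.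
have lS1 : L1 P (fun t => 1 + \sum_(k < N) Y k t ^+ 2).
  by apply: L1D => //; exact: L1_cst.
rewrite -(RintegralB measurableT lp lf).
apply: (@le_trans _ _ (\int[P]_t (eps * (1 + \sum_(k < N) Y k t ^+ 2)))).
  apply: normr_Rintegral_le => [||t]; [|exact: L1Z|exact: H].
  exact: L1_measurable (L1B lp lf).
rewrite (@RintegralZl _ _ _ P _ _ _ measurableT lS1).
rewrite (RintegralD measurableT (L1_cst P 1) lS) Rintegral_probability_cst.
by rewrite Rintegral_sumr.
Qed.

(** * Convergence of wide networks at finitely many points *)

Section network_central_limit.
Context d (T : measurableType d) (R : realType) (P : probability T R).
Variables (w w0 : nat -> T -> R).
Hypothesis law_w : forall j, has_law P (w j) std_normal.
Hypothesis law_w0 : forall j, has_law P (w0 j) std_normal.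
Hypothesis ind : mutually_independent P (network_vars w w0).
Local Notation gamma := (@std_normal R).
Context d' (T' : measurableType d') (P' : probability T' R).
Variables (N : nat) (h : 'I_N -> R -> R) (V : 'I_N -> T' -> R).
Hypothesis mh : forall k, measurable_fun setT (h k).
Hypothesis h4 : forall k, L1 gamma (fun z => h k z ^+ 4).
Hypothesis mV : forall k, measurable_fun setT (V k).
Hypothesis V_law : forall c : 'I_N -> R, exists s : R,
  has_law P' (fun t => \sum_(k < N) c k * V k t) (gaussian_law 0 s).
Hypothesis V_sqr : forall c : 'I_N -> R,
  \int[P']_t (\sum_(k < N) c k * V k t) ^+ 2 =
  \int[gamma]_z (\sum_(k < N) c k * h k z) ^+ 2.

Let h2 k : L1 gamma (fun z => h k z ^+ 2).
Proof.
apply: (@L1_of_sqr _ _ _ gamma); first exact: measurable_funX.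
by apply: eq_L1 (h4 k) => z; rewrite -exprM.
Qed.

Let mH (c : 'I_N -> R) : measurable_fun setT (fun z => \sum_(k < N) c k * h k z).
Proof. by apply: measurable_sum => k; exact: measurable_funM. Qed.

Let H4 (c : 'I_N -> R) : L1 gamma (fun z => (\sum_(k < N) c k * h k z) ^+ 4).
Proof.
have l : L1 gamma (fun z => (\sum_(k < N) \sum_(l < N) (c k * h k z) * (c l * h l z)) ^+ 2).
  apply: L1_sqr_sum => k.
    by apply: measurable_sum => l; apply: measurable_funM; exact: measurable_funM.
  apply: L1_sqr_sum => l; first by apply: measurable_funM; exact: measurable_funM.
  have lkl : L1 gamma (fun z => h k z ^+ 2 * h l z ^+ 2).
    apply: L1_sqr_mul; try exact: measurable_funX.
      by apply: eq_L1 (h4 k) => z; rewrite -exprM.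
    by apply: eq_L1 (h4 l) => z; rewrite -exprM.
  have := L1Z ((c k * c l) ^+ 2) lkl.
  by apply: eq_L1 => z; rewrite -!exprMn mulrACA.
apply: eq_L1 l => z; rewrite (_ : 4 = 2 * 2)%N// exprM; congr (_ ^+ 2).
by rewrite expr2 big_distrlr.
Qed.

(** A linear combination of network coordinates is a network with feature [H], and the same
    combination of the [V k] is Gaussian with variance [E H^2]. So each cosine is a one-dimensional
    statement with an explicit rate, and linearity does the rest. *)
Lemma trig_poly_clt (s : nat) (f : ('I_N -> R) -> R) : trig_poly f ->
  (fun m => \int[P]_t f (fun k => network_sum w w0 s m (h k) t)) @ \oo -->
  \int[P']_t f (fun k => V k t).
Proof.
have mF m k : measurable_fun setT (network_sum w w0 s m (h k)).
  exact: network_sum_measurable.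
move=> tf; elim: tf => [c b|f1 f2 t1 l1 t2 l2|c f1 t1 l1].
- pose H z := \sum_(k < N) c k * h k z.
  have E m t : \sum_(k < N) c k * network_sum w w0 s m (h k) t = network_sum w w0 s m H t.
    rewrite /network_sum /H; under eq_bigr do rewrite mulrCA mulr_sumr.
    rewrite -mulr_sumr exchange_big; congr (_ * _); apply: eq_bigr => j _ /=.
    by rewrite mulr_sumr; apply: eq_bigr => k _; rewrite mulrCA.
  have [sg lawV] := V_law c.
  have [lV2 EV2] := gaussian_law_sqr lawV erefl.
  have ccos : continuous (fun x : R => cos (x + b)).
    move=> x; apply: (continuous_comp (f := fun x : R => x + b)); last exact: continuous_cos.
    by apply: (@cvgD _ R^o); [exact: cvg_id|exact: cvg_cst].
  have lcos : L1 gamma (fun z : R => cos (0 + `|sg| * z + b)).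
    apply: (@L1_bounded _ _ _ gamma _ 1) => [|t]; last by rewrite ler_norml cos_geN1 cos_le1.
    apply: (@measurableT_comp _ _ _ _ _ _ (@cos R)).
      by apply: continuous_measurable_fun; exact: continuous_cos.
    by apply: measurable_funD => //; apply: measurable_funD => //; exact: measurable_funM.
  have [_ ->] := gaussian_law_Rintegral lawV ccos lcos.
  have sgE : `|sg| ^+ 2 = \int[gamma]_z H z ^+ 2.
    by rewrite real_normK ?num_real// -EV2 V_sqr.
  pose I := \int[gamma]_z H z ^+ 4.
  apply/cvgrPdist_le => ep ep0; near=> m.
  have m0 : (0 < m)%N by near: m; exact: nbhs_infty_gt.
  have mI : ((1 + I) / ep) ^+ 2 <= m%:R by near: m; exact: nbhs_infty_ger.
  have I0 : 0 <= I by apply: Rintegral_ge0 => z _; rewrite exprn_even_ge0.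
  rewrite distrC; under eq_Rintegral do rewrite E.
  under [X in _ - X]eq_Rintegral do rewrite add0r.
  apply: (le_trans (network_sum_cos law_w law_w0 ind s b m0 (mH c) (H4 c) sgE)).
  rewrite ler_pdivrMr ?sqrtr_gt0 ?ltr0n// mulrC -ler_pdivrMr//.
  rewrite -[leLHS]ger0_norm ?divr_ge0 ?addr_ge0 ?(ltW ep0)// -sqrtr_sqr.
  by rewrite ler_wsqrtr.
- under eq_fun do rewrite (RintegralD measurableT (trig_poly_L1 _ t1 (mF _)) (trig_poly_L1 _ t2 (mF _))).
  rewrite (RintegralD measurableT (trig_poly_L1 _ t1 mV) (trig_poly_L1 _ t2 mV)).
  exact: (@cvgD _ R^o).
- under eq_fun do rewrite (@RintegralZl _ _ _ P _ _ _ measurableT (trig_poly_L1 _ t1 (mF _))).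
  rewrite (@RintegralZl _ _ _ P' _ _ _ measurableT (trig_poly_L1 _ t1 mV)).
  by apply: cvgMl_tmp.
Unshelve. all: by end_near. Qed.

(** The second moments of the networks are bounded by [S] uniformly in the width, so the quadratic
    error of the trigonometric approximation has a small mean for all widths and for the limit. The
    budget is [e/4 + e/2 + e/4]. *)
Lemma lipschitz_clt (s : nat) (psi : ('I_N -> R) -> R) (L : R) : 0 <= L ->
  (forall y z, `|psi y - psi z| <= L * \sum_(k < N) `|y k - z k|) ->
  (forall m, L1 P (fun t => psi (fun k => network_sum w w0 s m (h k) t))) ->
  L1 P' (fun t => psi (fun k => V k t)) ->
  (fun m => \int[P]_t psi (fun k => network_sum w w0 s m (h k) t)) @ \oo -->
  \int[P']_t psi (fun k => V k t).
Proof.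
move=> L0 psiL lF lV.
have mF m k : measurable_fun setT (network_sum w w0 s m (h k)).
  exact: network_sum_measurable.
pose S := \sum_(k < N) \int[gamma]_z h k z ^+ 2.
have S0 : 0 <= S by apply: sumr_ge0 => k _; apply: Rintegral_ge0 => z _; exact: sqr_ge0.
have VE k : L1 P' (fun t => V k t ^+ 2) /\
    \int[P']_t V k t ^+ 2 = \int[gamma]_z h k z ^+ 2.
  have E (W : 'I_N -> R) : \sum_(l < N) (l == k)%:R * W l = W k.
    rewrite (bigD1 k)//= eqxx mul1r big1 ?addr0// => l lk.
    by rewrite (negbTE lk) mul0r.
  have [sg lawV] := V_law (fun l => (l == k)%:R).
  have [lV2 _] := gaussian_law_sqr lawV erefl.
  split; first by apply: eq_L1 lV2 => t; rewrite (E (V ^~ t)).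
  have := V_sqr (fun l => (l == k)%:R).
  under eq_Rintegral do rewrite (E (V ^~ _)).
  by under [RHS]eq_Rintegral do rewrite (E (h ^~ _)).
apply/cvgrPdist_le => e e0.
pose eps := e / 4 / (1 + S).
have S1 : 0 < 1 + S by rewrite ltr_pwDl.
have eps0 : 0 < eps by rewrite !divr_gt0.
have [f tf fP] := trig_dense L0 psiL eps0.
have EV := quadratic_error_mean fP lV (trig_poly_L1 _ tf mV) (fun k => (VE k).1).
have e2 : 0 < e / 2 by rewrite divr_gt0.
have /cvgrPdist_le/(_ _ e2) Cf := trig_poly_clt s tf.
near=> m.
have m0 : (0 < m)%N by near: m; exact: nbhs_infty_gt.
have FE k := network_sum_moment law_w law_w0 ind s m0 (@mh k) (h2 k).
have EF := quadratic_error_mean fP (lF m) (trig_poly_L1 _ tf (mF m)) (fun k => (FE k).1).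
have E1 : eps * (1 + S) = e / 4 by rewrite /eps divfK ?gt_eqF.
have {}EV := le_trans EV (_ : _ <= e / 4).
have {}EF : `|\int[P]_t psi (fun k => network_sum w w0 s m (h k) t) -
    \int[P]_t f (fun k => network_sum w w0 s m (h k) t)| <= e / 4.
  apply: (le_trans EF); rewrite -E1 ler_pM2l// lerD2l; apply: ler_sum => k _.
  by have [] := FE k.
have {EV} EV : `|\int[P']_t psi (fun k => V k t) - \int[P']_t f (fun k => V k t)| <= e / 4.
  by apply: EV; rewrite -E1 ler_pM2l// lerD2l; apply: ler_sum => k _; rewrite (VE k).2.
have : `|\int[P']_t f (fun k => V k t) -
    \int[P]_t f (fun k => network_sum w w0 s m (h k) t)| <= e / 2.
  by near: m.
move: EF EV; rewrite !ler_norml => /andP[? ?] /andP[? ?] /andP[? ?].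
by apply/andP; split; lra.
Unshelve. all: by end_near. Qed.

End network_central_limit.

(** * Test functions on a Hilbert space *)

Section inner_product.
Context (R : realType) (K : normedModType R) (dot : K -> K -> R).
Hypothesis dotC : forall f g, dot f g = dot g f.
Hypothesis dot_linearl : forall a f g h, dot (a *: f + g) h = a * dot f h + dot g h.
Hypothesis dotE : forall f, dot f f = `|f| ^+ 2.

Lemma dotDl f g h : dot (f + g) h = dot f h + dot g h.
Proof. by rewrite -[f]scale1r dot_linearl mul1r scale1r. Qed.

Lemma dot0l h : dot 0 h = 0.
Proof. by apply: (addrI (dot 0 h)); rewrite -dotDl !addr0. Qed.

Lemma dotZl a f h : dot (a *: f) h = a * dot f h.
Proof. by rewrite -[a *: f]addr0 dot_linearl dot0l addr0. Qed.

Lemma dotBl f g h : dot (f - g) h = dot f h - dot g h.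
Proof. by rewrite dotDl -scaleN1r dotZl mulN1r. Qed.

Lemma dotZr a f h : dot h (a *: f) = a * dot h f.
Proof. by rewrite dotC dotZl dotC. Qed.

Lemma dot_suml (J : Type) (s : seq J) (F : J -> K) h :
  dot (\sum_(j <- s) F j) h = \sum_(j <- s) dot (F j) h.
Proof.
elim: s => [|j s ih]; first by rewrite !big_nil dot0l.
by rewrite !big_cons dotDl ih.
Qed.

Lemma dot_sumr (J : Type) (s : seq J) (F : J -> K) h :
  dot h (\sum_(j <- s) F j) = \sum_(j <- s) dot h (F j).
Proof. by rewrite dotC dot_suml; apply: eq_bigr => j _; exact: dotC. Qed.

Lemma dot_cauchy_schwarz f g : `|dot f g| <= `|f| * `|g|.
Proof.
have [->|g0] := eqVneq g 0; first by rewrite dotC dot0l !normr0 mulr0.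
have n0 : 0 < `|g| by rewrite normr_gt0.
have := sqr_ge0 `| `|g| ^+ 2 *: f - dot f g *: g|.
rewrite -[X in 0 <= X]dotE dotBl !dotZl [dot f (_ - _)]dotC [dot g (_ - _)]dotC !dotBl !dotZl !dotE.
rewrite [dot g f]dotC => H.
have {H} : dot f g ^+ 2 <= (`|f| * `|g|) ^+ 2.
  rewrite -(ler_pM2l (_ : 0 < `|g| ^+ 2)) ?exprn_gt0// -subr_ge0.
  by apply: le_trans H _; rewrite le_eqVlt; apply/orP; left; apply/eqP; ring.
by rewrite -[dot f g ^+ 2]real_normK ?num_real// ler_pXn2r// ?nnegrE ?mulr_ge0.
Qed.

Lemma dot_continuous h : continuous (dot ^~ h).
Proof.
move=> f; apply/cvgrPdist_le => ep ep0; near=> g.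
rewrite -dotBl; apply: (le_trans (dot_cauchy_schwarz _ _)).
have h0 : 0 < `|h| + 1 by rewrite ltr_wpDl.
apply: (@le_trans _ _ (`|f - g| * (`|h| + 1))).
  by rewrite ler_wpM2l// lerDl.
rewrite -ler_pdivlMr//; near: g.
by apply: (@cvgr_dist_le _ _ _ _ _ (@id K)); [exact: cvg_id|rewrite divr_gt0].
Unshelve. all: by end_near. Qed.

Lemma is_derive_dot (g : R -> K) (dg h : K) (z : R) :
  is_derive z 1 g dg -> is_derive z 1 (fun z => dot (g z) h) (dot dg h).
Proof.
move=> [dgz dgE].
have lim : (fun e : R => dot (e^-1 *: (g (e *: 1 + z) - g z)) h) @ 0^' --> dot dg h.
  have l0 : (fun e : R => e^-1 *: (g (e *: 1 + z) - g z)) @ 0^' --> dg.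
    by rewrite -dgE; exact: dgz.
  exact: (cvg_comp _ _ l0 (@dot_continuous h dg)).
have E : (fun e : R => dot (e^-1 *: (g (e *: 1 + z) - g z)) h) =
    (fun e : R => e^-1 *: (dot (g (e *: 1 + z)) h - dot (g z) h)).
  by apply/funext => e; rewrite dotZl dotBl.
rewrite E in lim; apply: DeriveDef; first by apply/cvg_ex; exists (dot dg h).
exact/cvg_lim.
Qed.

Section test_function.
Variables (phi : K -> R) (grad : K -> K).
Hypothesis phi_grad : is_gradient dot phi grad.
Hypothesis dgrad : forall v, differentiable grad v.
Hypothesis grad_le : (maxe (ereal_sup (range (fun v => `|grad v|%:E)))
  (ereal_sup (range (fun v => tensor2_norm dot ('d grad v)))) <= 1)%E.

Lemma gradient_le1 v : `|grad v| <= 1.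
Proof.
rewrite -lee_fin; apply: (le_trans _ grad_le); rewrite le_max; apply/orP; left.
by apply: ereal_sup_ubound; exists v.
Qed.

Lemma test_function_dot_le v h : `|dot (grad v) h| <= 1 * `|h|.
Proof.
apply: (le_trans (dot_cauchy_schwarz _ _)); rewrite ler_wpM2r//.
exact: gradient_le1.
Qed.

Lemma test_function_lipschitz u v : `|phi u - phi v| <= `|u - v|.
Proof.
rewrite -[leRHS]mul1r; apply: norm_diff_le_lipschitz => [x|x h].
  by case: (phi_grad x).
by case: (phi_grad x) => _ ->; exact: test_function_dot_le.
Qed.

Lemma gradient_dot_continuous h : continuous (fun v => dot (grad v) h).
Proof.
move=> v; apply: (continuous_comp (f := grad) (g := dot ^~ h)).
  exact: differentiable_continuous.
exact: dot_continuous.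
Qed.

Lemma hessian_orthonormal_le (N : nat) (e : 'I_N -> K) v : Defs.orthonormal dot e ->
  \sum_(k < N) \sum_(l < N) dot ('d grad v (e k)) (e l) ^+ 2 <= 1.
Proof.
move=> oe; set S := (X in X <= _).
have S0 : 0 <= S by apply: sumr_ge0 => k _; apply: sumr_ge0 => l _; exact: sqr_ge0.
have : ((Num.sqrt S)%:E <= 1)%E.
  apply: (le_trans _ grad_le); rewrite le_max; apply/orP; right.
  apply: (@le_trans _ _ (tensor2_norm dot ('d grad v))).
    by apply: ereal_sup_ubound; exists N, e.
  by apply: ereal_sup_ubound; exists v.
by rewrite lee_fin -{1}sqrtr1 ler_sqrt.
Qed.

(** The one-element orthonormal family [h / |h|] already bounds the quadratic form by the
    Hilbert-Schmidt norm. *)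
Lemma hessian_le v h : `|dot ('d grad v h) h| <= 1 * `|h| ^+ 2.
Proof.
have [->|h0] := eqVneq h 0.
  by rewrite linear0 dot0l !normr0 expr0n mulr0.
have n0 : `|h| != 0 by rewrite normr_eq0.
pose e (k : 'I_1) : K := `|h|^-1 *: h.
have oe : Defs.orthonormal dot e.
  move=> i j; rewrite !ord1 eqxx /e dotZl dotZr dotE expr2 mulKf// mulVf//.
have := hessian_orthonormal_le v oe.
rewrite !big_ord1 /e linearZ dotZl dotZr /= mulrA -expr2 => H.
have : (`|h| ^- 2 * `|dot ('d grad v h) h|) ^+ 2 <= 1 ^+ 2.
  by rewrite exprMn real_normK ?num_real// -exprMn expr1n -exprVn.
rewrite ler_pXn2r ?nnegrE// ?mulr_ge0 ?invr_ge0 ?exprn_ge0//.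
by rewrite mulrC ler_pdivrMr// exprn_gt0// normr_gt0.
Qed.

Lemma is_derive_gradient_line v h (z : R) :
  is_derive z 1 (fun z => dot (grad (v + z *: h)) h) (dot ('d grad (v + z *: h) h) h).
Proof. by apply: is_derive_dot; exact: is_derive_line. Qed.

Lemma hessian_sum (N : nat) (e : 'I_N -> K) v (c : 'I_N -> R) :
  dot ('d grad v (\sum_(k < N) c k *: e k)) (\sum_(k < N) c k *: e k) =
  \sum_(k < N) \sum_(l < N) dot ('d grad v (e k)) (e l) * (c k * c l).
Proof.
have -> : 'd grad v (\sum_(k < N) c k *: e k) = \sum_(k < N) c k *: 'd grad v (e k).
  by rewrite linear_sum; apply: eq_bigr => k _; exact: linearZ.
rewrite dot_suml; apply: eq_bigr => k _; rewrite dot_sumr; apply: eq_bigr => l _.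
by rewrite dotZl dotZr; ring.
Qed.

(** Made for the grid basis, whose vectors on null cells are 0: these contribute nothing, and the
    indices in [p] give an orthonormal family. *)
Lemma hessian_orthogonal_le (N : nat) (e : 'I_N -> K) (p : pred 'I_N) v :
  (forall i j, dot (e i) (e j) = ((i == j) && p j)%:R) ->
  \sum_(k < N) \sum_(l < N) dot ('d grad v (e k)) (e l) ^+ 2 <= 1.
Proof.
move=> oe.
have e0 k : ~~ p k -> e k = 0.
  move=> pk; apply/normr0_eq0/eqP; rewrite -sqrf_eq0 -dotE oe eqxx (negbTE pk).
  by [].
have oe' : Defs.orthonormal dot (fun i : 'I_#|p| => e (enum_val i)).
  move=> i j; rewrite oe (inj_eq enum_val_inj).
  by have -> : p (enum_val j) by [have := enum_valP j]; rewrite andbT.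
apply: le_trans (hessian_orthonormal_le v oe').
rewrite -(@big_enum_val _ _ _ _ p (fun k => \sum_(l < #|p|) dot ('d grad v (e k)) (e (enum_val l)) ^+ 2)) /=.
rewrite (bigID p) /= [X in _ + X]big1 ?addr0; last first.
  by move=> k pk; rewrite e0// linear0 big1// => l _; rewrite dot0l expr0n.
apply: ler_sum => k pk.
rewrite -(@big_enum_val _ _ _ _ p (fun l => dot ('d grad v (e k)) (e l) ^+ 2)) /=.
rewrite (bigID p) /= [X in _ + X]big1 ?addr0//.
by move=> l pl; rewrite (e0 l)// dotC dot0l expr0n.
Qed.

End test_function.
End inner_product.

(** * The space of square integrable functions *)

Section nonmeasurable_integrand.
Context d (T : measurableType d) (R : realType) (mu : {measure set T -> \bar R}).
Local Open Scope ereal_scope.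

(** The integral of a nonnegative function is a supremum over the simple functions below it, which
    is monotone for arbitrary functions. *)
Lemma ge0_integral_homo (f g : T -> \bar R) : (forall x, 0 <= f x) ->
  (forall x, f x <= g x) -> \int[mu]_x f x <= \int[mu]_x g x.
Proof.
move=> f0 fg; have g0 x : 0 <= g x by exact: le_trans (fg x).
rewrite !ge0_integralTE//; apply: ub_ereal_sup => _ [h hf <-].
apply: ereal_sup_ubound; exists h => // x.
exact: le_trans (fg x).
Qed.

(* [a] is not assumed measurable, so additivity is applied to [b] and
   [maxe (b - h) 0] only. *)
Lemma ge0_integral_close (a b h : T -> \bar R) :
  (forall x, 0 <= a x) -> (forall x, 0 <= b x) -> (forall x, b x < +oo) ->
  (forall x, 0 <= h x) ->
  measurable_fun setT b -> measurable_fun setT h ->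
  (forall x, a x <= b x + h x) -> (forall x, b x <= a x + h x) ->
  \int[mu]_x a x <= \int[mu]_x b x + \int[mu]_x h x /\
  \int[mu]_x b x <= \int[mu]_x a x + \int[mu]_x h x.
Proof.
move=> a0 b0 boo h0 mb mh ab ba; split.
  rewrite -ge0_integralD//; exact: ge0_integral_homo.
pose c x := maxe (b x - h x) 0.
have c0 x : 0 <= c x by rewrite le_max lexx orbT.
have mc : measurable_fun setT c.
  by apply: measurable_maxe => //; exact: emeasurable_funB.
have bf x : b x \is a fin_num by rewrite ge0_fin_numE.
have ca x : c x <= a x.
  rewrite ge_max a0 andbT.
  case: (h x) (h0 x) (ba x) => [r _|_ _|]//.
    by rewrite leeBlDr.
  by rewrite -(fineK (bf x)) /= leNye.
have bc x : b x <= c x + h x.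
  have := c0 x; rewrite /c; case: (h x) (h0 x) => [r _ _|_ cx|]//=; last first.
    by rewrite addey ?leey// gt_eqF// (@lt_le_trans _ _ 0).
  by rewrite -leeBlDr// le_max lexx.
apply: (@le_trans _ _ (\int[mu]_x c x + \int[mu]_x h x)).
  rewrite -ge0_integralD//; exact: ge0_integral_homo.
by apply: leeD => //; exact: ge0_integral_homo.
Qed.

End nonmeasurable_integrand.

(* [f] need not be measurable: this applies to [f t = phi (L2_of nu (Y ^~ t))],
   for which only [g] and the error [h] are known to be measurable. *)
Lemma expectation_close d (T : measurableType d) (R : realType) (P : probability T R)
    (f g : T -> R) (h : T -> \bar R) (r : R) :
  L1 P g -> measurable_fun setT h -> (forall t, 0 <= h t)%E ->
  (forall t, `|f t - g t|%:E <= h t)%E -> (\int[P]_t h t <= r%:E)%E ->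
  exists2 m : R, ('E_P[f] = m%:E)%E & `|m - \int[P]_t g t| <= 2 * r.
Proof.
move=> lg mh h0 fg hr.
have mg := L1_measurable lg.
pose gp t := (EFin \o g)^\+%E t; pose gn t := (EFin \o g)^\-%E t.
pose fp t := (EFin \o f)^\+%E t; pose fn t := (EFin \o f)^\-%E t.
have P0 (k : T -> R) t : ((EFin \o k)^\+%E t = (Num.max (k t) 0)%:E)%E.
  by rewrite funeposE /= EFin_max.
have N0 (k : T -> R) t : ((EFin \o k)^\-%E t = (Num.max (- k t) 0)%:E)%E.
  by rewrite funenegE /= EFin_max.
have pos t : [/\ (0 <= fp t)%E, (0 <= fn t)%E, (0 <= gp t)%E & (0 <= gn t)%E].
  by rewrite /fp /fn /gp /gn !P0 !N0; split; rewrite lee_fin le_max lexx orbT.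
have fp0 t : (0 <= fp t)%E by case: (pos t).
have fn0 t : (0 <= fn t)%E by case: (pos t).
have gp0 t : (0 <= gp t)%E by case: (pos t).
have gn0 t : (0 <= gn t)%E by case: (pos t).
(* Positive and negative parts are 1-Lipschitz, so each inherits the error [h]; the two together
   produce the factor 2 in the bound. *)
have key (x y : R) (e : \bar R) : (`|x - y|%:E <= e)%E ->
    [/\ ((Num.max x 0)%:E <= (Num.max y 0)%:E + e)%E,
        ((Num.max y 0)%:E <= (Num.max x 0)%:E + e)%E,
        ((Num.max (- x) 0)%:E <= (Num.max (- y) 0)%:E + e)%E &
        ((Num.max (- y) 0)%:E <= (Num.max (- x) 0)%:E + e)%E].
  case: e => [e||]//=; last by rewrite !addey ?leey.
  rewrite !lee_fin => xy.
  have [H1 H2] : x <= y + e /\ y <= x + e.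
    by move: xy; rewrite ler_norml => /andP[? ?]; split; lra.
  by split; rewrite ?lee_fin ge_max; apply/andP; split;
    do ?[case: (leP _ 0) => ?]; rewrite ?maxElt; do ?[case: ifP]; lra.
have [p1 p2] : (\int[P]_t fp t <= \int[P]_t gp t + \int[P]_t h t)%E /\
    (\int[P]_t gp t <= \int[P]_t fp t + \int[P]_t h t)%E.
  apply: ge0_integral_close => //.
  - by move=> t; rewrite /gp P0 ltry.
  - by apply: measurable_funepos; exact/measurable_EFinP.
  - by move=> t; rewrite /fp /gp !P0; case: (key _ _ _ (fg t)).
  - by move=> t; rewrite /fp /gp !P0; case: (key _ _ _ (fg t)).
have [n1 n2] : (\int[P]_t fn t <= \int[P]_t gn t + \int[P]_t h t)%E /\
    (\int[P]_t gn t <= \int[P]_t fn t + \int[P]_t h t)%E.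
  apply: ge0_integral_close => //.
  - by move=> t; rewrite /gn N0 ltry.
  - by apply: measurable_funeneg; exact/measurable_EFinP.
  - by move=> t; rewrite /fn /gn !N0; case: (key _ _ _ (fg t)).
  - by move=> t; rewrite /fn /gn !N0; case: (key _ _ _ (fg t)).
have gpf : (\int[P]_t gp t)%E \is a fin_num by exact: integrable_pos_fin_num.
have gnf : (\int[P]_t gn t)%E \is a fin_num by exact: integrable_neg_fin_num.
have hf : (\int[P]_t h t)%E \is a fin_num.
  by rewrite ge0_fin_numE ?integral_ge0// (le_lt_trans hr)// ltry.
have fpf : (\int[P]_t fp t)%E \is a fin_num.
  rewrite ge0_fin_numE ?integral_ge0//; apply: (le_lt_trans p1).
  by apply: lte_add_pinfty; rewrite -ge0_fin_numE ?integral_ge0.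
have fnf : (\int[P]_t fn t)%E \is a fin_num.
  rewrite ge0_fin_numE ?integral_ge0//; apply: (le_lt_trans n1).
  by apply: lte_add_pinfty; rewrite -ge0_fin_numE ?integral_ge0.
exists (fine (\int[P]_t fp t) - fine (\int[P]_t fn t)).
  by rewrite unlock integralE EFinB !fineK.
have -> : \int[P]_t g t = fine (\int[P]_t gp t) - fine (\int[P]_t gn t).
  by rewrite /Rintegral integralE fineB.
move: hr p1 p2 n1 n2.
rewrite -(fineK gpf) -(fineK gnf) -(fineK fpf) -(fineK fnf) -(fineK hf) -!EFinD !lee_fin !fineK//.
move=> *; rewrite ler_norml; apply/andP; split; lra.
Qed.

Section L2_space.
Context d (T : measurableType d) (R : realType) (mu : {measure set T -> \bar R}).
Local Notation K := (LspaceType2 mu).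
Implicit Types f g h : K.

Lemma L2_measurable f : measurable_fun setT (f : T -> R).
Proof. exact: (measurable_funPT (Lspace_repr f)). Qed.

Lemma L2_sqr_L1 f : L1 mu (fun x => f x ^+ 2).
Proof. exact: (Lfun2_integrable_sqr (Lspace_repr_subproof f)). Qed.

Lemma ae_eq_Rintegral (u v : T -> R) : measurable_fun setT u -> measurable_fun setT v ->
  u = v %[ae mu] -> \int[mu]_x u x = \int[mu]_x v x.
Proof.
move=> m1 m2 uv; rewrite /Rintegral; congr fine; apply: ae_eq_integral => //.
- exact/measurable_EFinP.
- exact/measurable_EFinP.
- by apply: filterS uv => x /= uv _; rewrite uv.
Qed.

Lemma L2_combination_ae (a : R) f g : (a *: f + g : K) = (fun x => a * f x + g x) %[ae mu].
Proof.
have E1 : ((a *: f : K) : T -> R) = a *: (f : T -> R) %[ae mu] by exact: Lspace_piE.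
have E2 : ((a *: f + g : K) : T -> R) = ((a *: f : K) : T -> R) + (g : T -> R) %[ae mu].
  exact: Lspace_piE.
apply: filterS2 E1 E2 => x E1 E2 _.
by rewrite (E2 I) /= -/((a *: f : K) x); congr (_ + _); exact: E1.
Qed.

Lemma L2_dotC f g : L2_dot f g = L2_dot g f.
Proof. by apply: eq_Rintegral => x _; rewrite mulrC. Qed.

Lemma L2_dot_linearl (a : R) f g h : L2_dot (a *: f + g) h = a * L2_dot f h + L2_dot g h.
Proof.
have l1 (u v : K) : L1 mu (fun x => u x * v x).
  by apply: L1_sqr_mul; [exact: L2_measurable|exact: L2_measurable|exact: L2_sqr_L1|exact: L2_sqr_L1].
rewrite /L2_dot -(@RintegralZl _ _ _ mu _ _ _ measurableT (l1 f h)).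
rewrite -(RintegralD measurableT (L1Z a (l1 f h)) (l1 g h)).
apply: ae_eq_Rintegral.
- by apply: measurable_funM; exact: L2_measurable.
- apply: measurable_funD; last by apply: measurable_funM; exact: L2_measurable.
  by apply: measurable_funM => //; apply: measurable_funM; exact: L2_measurable.
- apply: filterS (L2_combination_ae a f g) => x E _.
  by rewrite (E I) mulrDl mulrA.
Qed.

Lemma mem_L2 (u : T -> R) : measurable_fun setT u -> L1 mu (fun x => u x ^+ 2) ->
  u \in Lfun mu 2%:R%:E.
Proof.
move=> m1 l2; apply/andP; split; rewrite inE//= /finite_norm.
apply: (@lty_poweRy _ _ 2%:R); first by rewrite pnatr_eq0.
rewrite powR_Lnorm ?pnatr_eq0//.
move: l2 => /integrableP[_]; apply: le_lt_trans; rewrite le_eqVlt; apply/orP; left; apply/eqP.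
by apply: eq_integral => x _ /=; rewrite powR_mulrn// normrX.
Qed.

Lemma L2_ofE (u : T -> R) : measurable_fun setT u -> L1 mu (fun x => u x ^+ 2) ->
  (L2_of mu u : T -> R) = u %[ae mu].
Proof.
move=> m1 l2; rewrite /L2_of; case: pselect => [uL|]; first exact: Lspace_piE.
by move=> /(_ (mem_L2 m1 l2)).
Qed.

Lemma L2_norm_sqr (u : T -> R) (f : K) : measurable_fun setT u ->
  (f : T -> R) = u %[ae mu] -> `|f| ^+ 2 = \int[mu]_x u x ^+ 2.
Proof.
move=> m1 fu; rewrite -L2_dotE; apply: ae_eq_Rintegral.
- by apply: measurable_funM; exact: L2_measurable.
- exact: measurable_funX.
- by apply: filterS fu => x E _; rewrite (E I) expr2.
Qed.

End L2_space.

(** * Discretisation of a random field *)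

Section grid.
Context (R : realType) (q : nat).
Hypothesis q_gt0 : (0 < q)%N.

(** The single parameter [q] governs both the mesh [1 / q] and the truncation at [|x| < q]. Points
    outside are sent to 0, which is itself a grid point. *)
Definition grid_round (x : R) : R :=
  if `|x| < q%:R then (Num.floor (x * q%:R))%:~R / q%:R else 0.

(** The points run from [- q] to [q] in steps of [1 / q], that is [2 q^2 + 1] of them. *)
Definition grid_size : nat := (2 * (q * q)).+1.

Definition grid_point (j : 'I_grid_size) : R := (j%:R - (q * q)%:R) / q%:R.

Let q0 : 0 < q%:R :> R. Proof. by rewrite ltr0n. Qed.

Lemma grid_round_close (x : R) : `|x| < q%:R -> 0 <= x - grid_round x <= q%:R^-1.
Proof.
move=> xq; rewrite /grid_round xq; have /andP[l1 l2] := floor_itv (x * q%:R).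
rewrite subr_ge0 ler_pdivrMr// l1 /=.
rewrite -(ler_pM2r q0) mulrBl divfK ?gt_eqF// mulVf ?gt_eqF//.
by rewrite lerBlDl ltW//; move: l2; rewrite intrD.
Qed.

(** Inside the window the displacement is at most [1 / q]; outside it is [|x| <= x^2 / q]. This is
    the origin of the factor [(1 + x ^+ 2) ^+ 2] in the moment conditions. *)
Lemma grid_round_dist (x : R) : `|x - grid_round x| <= (1 + x ^+ 2) / q%:R.
Proof.
have [xq|qx] := ltP `|x| q%:R.
  have /andP[h1 h2] := grid_round_close xq.
  by rewrite ger0_norm// (le_trans h2)// ler_peMl ?invr_ge0 ?ler0n// lerDl sqr_ge0.
rewrite /grid_round ltNge qx /= subr0 ler_pdivlMr// -real_normK ?num_real// expr2.
by apply: (@le_trans _ _ (`|x| * `|x|)); rewrite ?ler_wpM2l// lerDr.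
Qed.

(** Keeps the rounded point in the range [1 + |x|] in which the growth bounds at [x] are stated. *)
Lemma grid_round_le (x : R) : `|grid_round x| <= 1 + `|x|.
Proof.
have [xq|qx] := ltP `|x| q%:R; last first.
  by rewrite /grid_round ltNge qx /= normr0 addr_ge0.
have /andP[h1 h2] := grid_round_close xq.
have q1 : q%:R^-1 <= 1 :> R by rewrite invf_le1// ler1n.
rewrite -[grid_round x](subKr x) (le_trans (ler_normB _ _))// addrC lerD2r.
by rewrite ger0_norm// (le_trans h2).
Qed.

Lemma grid_round_point (x : R) : exists j, grid_round x = grid_point j.
Proof.
have [xq|qx] := ltP `|x| q%:R; last first.
  have jq : (q * q < grid_size)%N by rewrite /grid_size ltnS mul2n -addnn leq_addr.
  by exists (Ordinal jq); rewrite /grid_round ltNge qx /grid_point /= subrr mul0r.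
set z := Num.floor (x * q%:R).
have /andP[l1 l2] := floor_itv (x * q%:R); rewrite -/z in l1 l2.
have [z1 z2] : - (q * q)%:Z <= z /\ z <= (q * q)%:Z.
  move: xq; rewrite ltr_norml => /andP[x1 x2]; split.
    have : (- (q * q)%:Z)%:~R < (z + 1)%:~R :> R.
      apply: le_lt_trans l2; rewrite mulrNz -pmulrn natrM -mulNr.
      by rewrite ler_wpM2r// ltW.
    by rewrite ltr_int ltzD1.
  have : z%:~R <= (q * q)%:Z%:~R :> R.
    by apply: (le_trans l1); rewrite -pmulrn natrM ler_wpM2r// ltW.
  by rewrite ler_int.
have z0 : 0 <= z + (q * q)%:Z by rewrite -lerBlDr sub0r.
have jq : (absz (z + (q * q)%:Z)%R < grid_size)%N.
  rewrite /grid_size ltnS -lez_nat gez0_abs// mul2n -addnn PoszD.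
  by rewrite lerD2r.
exists (Ordinal jq); rewrite /grid_round xq /grid_point /= -/z.
by rewrite natr_absz ger0_norm// intrD -pmulrn addrK.
Qed.

Lemma grid_point_inj : injective grid_point.
Proof.
move=> i j /eqP; rewrite /grid_point -subr_eq0 -mulrBl mulf_eq0 invr_eq0 (gt_eqF q0) orbF.
by rewrite subr_eq0 => /eqP /addIr /eqP; rewrite eqr_nat => /eqP /val_inj.
Qed.

Lemma measurable_grid_round : measurable_fun setT grid_round.
Proof.
apply: measurable_fun_ifT => //.
  by apply: measurable_fun_ltr => //; exact: measurableT_comp.
move=> _ B mB; rewrite setTI.
have mq : measurable_fun setT (fun x : R => x * q%:R) by exact: measurable_funM.
have -> : (fun x : R => (Num.floor (x * q%:R))%:~R / q%:R) @^-1` B =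
    \bigcup_(z in [set: int]) (if `[< B (z%:~R / q%:R) >] then
      (fun x : R => x * q%:R) @^-1` `[z%:~R, (z + 1)%:~R[ else set0).
  apply/seteqP; split => x.
    move=> Bx; exists (Num.floor (x * q%:R)) => //=.
    by case: asboolP => //= _; rewrite in_itv/= floor_itv.
  move=> [z _]; case: asboolP => //= Bz.
  by rewrite in_itv/= => zx; rewrite (floor_def zx).
apply: countable_bigcupT_measurable; first exact: countableP.
move=> z; case: asboolP => // _; rewrite -[X in measurable X]setTI.
exact: mq measurableT _ (measurable_itv _).
Qed.

Definition grid_cell (j : 'I_grid_size) (x : R) : R := (grid_round x == grid_point j)%:R.

Lemma grid_cell_sum (f : R -> R) x :
  \sum_j f (grid_point j) * grid_cell j x = f (grid_round x).
Proof.
have [j E] := grid_round_point x.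
rewrite (bigD1 j)//= big1 ?addr0 => [|i ij].
  by rewrite /grid_cell E eqxx mulr1.
by rewrite /grid_cell E (inj_eq grid_point_inj) eq_sym (negbTE ij) mulr0.
Qed.

Lemma measurable_grid_cell j : measurable_fun setT (grid_cell j).
Proof.
apply: measurableT_comp => //.
by apply: measurable_fun_eqr => //; exact: measurable_grid_round.
Qed.

Lemma grid_cellM i j x : grid_cell i x * grid_cell j x = (i == j)%:R * grid_cell j x.
Proof.
rewrite /grid_cell; have [->|ij] := eqVneq i j; first by case: eqP; rewrite ?mulr1 ?mulr0.
case: eqP => [->|_]; last by rewrite !mul0r.
by rewrite (inj_eq grid_point_inj) (negbTE ij) mulr0 mul0r.
Qed.

End grid.

Lemma L2_sum_ae d (T : measurableType d) (R : realType) (mu : {measure set T -> \bar R})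
    (J : Type) (s : seq J) (c : J -> R) (f : J -> LspaceType2 mu) (u : J -> T -> R) :
  (forall j, (f j : T -> R) = u j %[ae mu]) ->
  (\sum_(j <- s) c j *: f j : LspaceType2 mu) = (fun x => \sum_(j <- s) c j * u j x) %[ae mu].
Proof.
move=> fu; elim: s => [|j s ih].
  rewrite big_nil.
  have E0 : ((0 : LspaceType2 mu) : T -> R) = 0 %[ae mu] by exact: Lspace_piE.
  by apply: filterS E0 => x E _; rewrite (E I) big_nil.
rewrite big_cons.
have := L2_combination_ae (c j) (f j) (\sum_(j <- s) c j *: f j : LspaceType2 mu).
move=> H; apply: filterS3 H (fu j) ih => x H1 H2 H3 _.
by rewrite (H1 I) (H2 I) (H3 I) big_cons.
Qed.

Section grid_L2.
Context (R : realType) (nu : {finite_measure set R -> \bar R}) (q : nat).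
Hypothesis q_gt0 : (0 < q)%N.
Local Notation K := (LspaceType2 nu).
Local Notation N := (grid_size q).
Local Notation point := (@grid_point R q).
Local Notation cell := (@grid_cell R q).
Local Notation rnd := (@grid_round R q).

Definition grid_weight (j : 'I_N) : R := \int[nu]_x cell j x.

Let mcell j : measurable_fun setT (cell j). Proof. exact: measurable_grid_cell. Qed.

Let cell01 j x : 0 <= cell j x <= 1.
Proof. by rewrite /grid_cell; case: eqP; rewrite lexx ler01. Qed.

Let cell_L1 j : L1 nu (cell j).
Proof.
apply: (@L1_bounded _ _ _ nu _ 1) => // x.
by have /andP[? ?] := cell01 j x; rewrite ger0_norm.
Qed.

Let cell_sqr j x : cell j x ^+ 2 = cell j x.
Proof. by rewrite expr2 grid_cellM// eqxx mul1r. Qed.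

Lemma grid_weight_ge0 j : 0 <= grid_weight j.
Proof. by apply: Rintegral_ge0 => x _; case/andP: (cell01 j x). Qed.

(** A function of the rounded point is a finite combination of cell indicators, hence integrable
    whatever [f] is. *)
Lemma grid_round_integral (f : R -> R) : L1 nu (fun x => f (rnd x)) /\
  \int[nu]_x f (rnd x) = \sum_j f (point j) * grid_weight j.
Proof.
have lj j : L1 nu (fun x => f (point j) * cell j x) by exact: L1Z.
split.
  have l : L1 nu (fun x => \sum_j f (point j) * cell j x) by apply: L1_sum => j _.
  by apply: eq_L1 l => x; exact: grid_cell_sum.
transitivity (\int[nu]_x \sum_j f (point j) * cell j x).
  by apply: eq_Rintegral => x _; rewrite grid_cell_sum.
rewrite Rintegral_sumr//; apply: eq_bigr => j _.
by rewrite (@RintegralZl _ _ _ nu _ _ _ measurableT (cell_L1 j)).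
Qed.

(* A null cell gives [0], since [0^-1 = 0]. *)
Definition grid_basis (j : 'I_N) : K :=
  L2_of nu (fun x => (Num.sqrt (grid_weight j))^-1 * cell j x).

Let basis_ae j : (grid_basis j : R -> R) =
  (fun x => (Num.sqrt (grid_weight j))^-1 * cell j x) %[ae nu].
Proof.
apply: L2_ofE; first exact: measurable_funM.
apply: eq_L1 (L1Z ((Num.sqrt (grid_weight j))^-1 ^+ 2) (cell_L1 j)) => x.
by rewrite exprMn cell_sqr.
Qed.

Lemma grid_basis_dot i j :
  L2_dot (grid_basis i) (grid_basis j) = ((i == j) && (0 < grid_weight j))%:R.
Proof.
pose r k := (Num.sqrt (grid_weight k))^-1.
have -> : L2_dot (grid_basis i) (grid_basis j) =
    \int[nu]_x (r i * r j * (i == j)%:R * cell j x).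
  apply: ae_eq_Rintegral.
  - by apply: measurable_funM; exact: L2_measurable.
  - exact: measurable_funM.
  - apply: filterS2 (basis_ae i) (basis_ae j) => x E1 E2 _.
    by rewrite (E1 I) (E2 I) mulrACA grid_cellM// mulrA.
rewrite (@RintegralZl _ _ _ nu _ _ _ measurableT (cell_L1 j)) -/(grid_weight j).
have [->|] := eqVneq i j; last by rewrite mulr0 mul0r.
rewrite mulr1 -expr2 /r exprVn sqr_sqrtr ?grid_weight_ge0//=.
have := grid_weight_ge0 j; rewrite le_eqVlt => /predU1P[<-|w0].
  by rewrite mulr0 ltxx.
by rewrite w0 mulVf// gt_eqF.
Qed.

(** The class of the step function equal to [y j] on cell [j], written in the normalised basis so
    that Hilbert-Schmidt bounds on the Hessian apply to its coordinates. *)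
Definition grid_embed (y : 'I_N -> R) : K :=
  \sum_j (y j * Num.sqrt (grid_weight j)) *: grid_basis j.

Lemma grid_embed_ae y :
  (grid_embed y : R -> R) = (fun x => \sum_j y j * cell j x) %[ae nu].
Proof.
have -> : grid_embed y = \sum_j y j *: (Num.sqrt (grid_weight j) *: grid_basis j).
  by apply: eq_bigr => j _; rewrite scalerA.
apply: L2_sum_ae => j.
have E0 : ((Num.sqrt (grid_weight j) *: grid_basis j : K) : R -> R) =
    Num.sqrt (grid_weight j) *: (grid_basis j : R -> R) %[ae nu] by exact: Lspace_piE.
have := grid_weight_ge0 j; rewrite le_eqVlt => /predU1P[w0|w0]; last first.
  apply: filterS2 E0 (basis_ae j) => x E1 E2 _.
  rewrite (E1 I); transitivity (Num.sqrt (grid_weight j) * (grid_basis j : R -> R) x) => //.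
  by rewrite (E2 I) mulrA divff ?mul1r// gt_eqF// sqrtr_gt0.
(* On a null cell the basis vector is 0, and so is the indicator almost everywhere. *)
have c0 : ae_eq nu setT (EFin \o cell j) (cst 0).
  apply/(ae_eq_integral_abs nu measurableT); first exact/measurable_EFinP.
  transitivity ((\int[nu]_x cell j x)%:E); last by rewrite -/(grid_weight j) -w0.
  rewrite EFin_Rintegral//; apply: eq_integral => x _ /=.
  by rewrite ger0_norm//; case/andP: (cell01 j x).
apply: filterS2 E0 c0 => x E1 E2 _.
have -> : cell j x = 0 by apply/EFin_inj; exact: (E2 I).
rewrite (E1 I).
transitivity (Num.sqrt (grid_weight j) * (grid_basis j : R -> R) x) => //.
by rewrite -w0 sqrtr0 mul0r.
Qed.

Lemma grid_embed_dist (y z : 'I_N -> R) :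
  `|grid_embed y - grid_embed z| <=
  (\sum_j Num.sqrt (grid_weight j) * `|grid_basis j|) * \sum_j `|y j - z j|.
Proof.
rewrite /grid_embed -sumrB; apply: (le_trans (ler_norm_sum _ _ _)).
rewrite mulr_suml; apply: ler_sum => j _; rewrite -scalerBl -mulrBl normrZ normrM.
rewrite [`|Num.sqrt _|]ger0_norm ?sqrtr_ge0// -[leLHS]mulrA [leLHS]mulrC.
rewrite ler_wpM2l ?mulr_ge0 ?sqrtr_ge0// (bigD1 j)//= lerDl.
exact: sumr_ge0.
Qed.

(* If [u] is not square integrable the right-hand side is [+oo], so the junk
   value [L2_of nu u = 0] is harmless. *)
Lemma L2_discretisation_le (u : R -> R) (ep : R) : measurable_fun setT u -> 0 < ep ->
  (`|L2_of nu u - grid_embed (fun j => u (point j))|%:E <=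
  (2^-1)%:E * (ep%:E + (ep^-1)%:E * \int[nu]_x ((u x - u (rnd x)) ^+ 2)%:E))%E.
Proof.
move=> mu ep0.
pose v x := u (rnd x).
have mv : measurable_fun setT v by apply: (measurableT_comp mu); exact: measurable_grid_round.
have lv2 : L1 nu (fun x => v x ^+ 2) := (grid_round_integral (fun y => u y ^+ 2)).1.
have muv : measurable_fun setT (fun x => u x - v x) by exact: measurable_funB.
have [Doo|] := ltP (\int[nu]_x ((u x - v x) ^+ 2)%:E)%E +oo%E; last first.
  rewrite leye_eq => /eqP ->.
  by rewrite mulry gtr0_sg ?invr_gt0// mul1e addey// mulry gtr0_sg ?invr_gt0// mul1e leey.
have lD : L1 nu (fun x => (u x - v x) ^+ 2).
  by apply: L1_ge0 => //; [exact: measurable_funX|move=> x; exact: sqr_ge0].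
have lu2 : L1 nu (fun x => u x ^+ 2).
  by apply: eq_L1 (L1_sqr_add muv mv lD lv2) => x; rewrite subrK.
have E : ((L2_of nu u - grid_embed (fun j => u (point j)) : K) : R -> R) =
    (fun x => u x - v x) %[ae nu].
  rewrite addrC -scaleN1r.
  have H := L2_combination_ae (-1) (grid_embed (fun j => u (point j))) (L2_of nu u).
  apply: filterS3 H (L2_ofE mu lu2) (grid_embed_ae (fun j => u (point j))) => x H1 H2 H3 _.
  by rewrite (H1 I) (H2 I) (H3 I) grid_cell_sum// mulN1r addrC.
have nE := L2_norm_sqr muv E.
set n := `|_| in nE *.
have -> : (\int[nu]_x ((u x - u (rnd x)) ^+ 2)%:E = (n ^+ 2)%:E)%E.
  by rewrite nE EFin_Rintegral.
rewrite -(EFinM ep^-1) -(EFinD ep) -(EFinM 2^-1) lee_fin.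
rewrite -(ler_pM2l (_ : 0 < 2 * ep)) ?mulr_gt0//.
have -> : 2 * ep * (2^-1 * (ep + ep^-1 * n ^+ 2)) = ep ^+ 2 + n ^+ 2.
  by field; rewrite gt_eqF.
by have := sqr_ge0 (ep - n); nra.
Qed.

(** The mean-square increments of the field, integrated over [nu] by Tonelli, control the mean
    squared distance to the step function. [G x] bounds the increments from [x] relative to the
    squared displacement, and [ep] trades the norm for its square. *)
Lemma expectation_discretisation d (T : measurableType d) (P : probability T R)
    (Y : R -> T -> R) (phi : K -> R) (G : R -> R) (ep : R) :
  measurable_fun [set: R * T] (fun xt => Y xt.1 xt.2) ->
  (forall f g, `|phi f - phi g| <= `|f - g|) ->
  L1 P (fun t => phi (grid_embed (fun j => Y (point j) t))) ->
  (forall x, 0 <= G x) ->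
  (forall x y : R, `|y| <= 1 + `|x| ->
    (\int[P]_t ((Y x t - Y y t) ^+ 2)%:E <= ((x - y) ^+ 2 * G x)%:E)%E) ->
  L1 nu (fun x => (1 + x ^+ 2) ^+ 2 * G x) -> 0 < ep ->
  exists2 m : R, 'E_P[fun t => phi (L2_of nu (Y ^~ t))]%E = m%:E &
    `|m - \int[P]_t phi (grid_embed (fun j => Y (point j) t))| <=
    ep + ep^-1 * (\int[nu]_x ((1 + x ^+ 2) ^+ 2 * G x) / q%:R ^+ 2).
Proof.
move=> mY phiL lphi G0 YG lG ep0.
set J := \int[nu]_x _.
have mYr : measurable_fun [set: R * T] (fun xt => Y (rnd xt.1) xt.2).
  apply: (measurableT_comp (f := fun xt => Y xt.1 xt.2) (g := fun xt : R * T => (rnd xt.1, xt.2))) => //.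
  apply: measurable_fun_pair => //=.
  by apply: measurableT_comp => //; exact: measurable_grid_round.
pose F (xt : R * T) : \bar R := ((Y xt.1 xt.2 - Y (rnd xt.1) xt.2) ^+ 2)%:E.
have mF : measurable_fun setT F.
  by apply/measurable_EFinP; apply: measurable_funX; exact: measurable_funB.
have F0 xt : (0 <= F xt)%E by rewrite lee_fin sqr_ge0.
pose h t := ((2^-1)%:E * (ep%:E + (ep^-1)%:E * \int[nu]_x F (x, t)))%E.
have I0 t : (0 <= \int[nu]_x F (x, t))%E by exact: integral_ge0.
have mI : measurable_fun setT (fun t => \int[nu]_x F (x, t))%E.
  exact: (@measurable_fun_fubini_tonelli_G _ _ _ _ _ nu F).
have h0 t : (0 <= h t)%E.
  by rewrite mule_ge0 ?adde_ge0 ?mule_ge0// ?lee_fin ?invr_ge0 ?ltW.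
have mh : measurable_fun setT h.
  by apply: measurable_funeM; apply: emeasurable_funD => //; exact: measurable_funeM.
have IJ : (\int[P]_t \int[nu]_x F (x, t) <= (J / q%:R ^+ 2)%:E)%E.
  rewrite -(fubini_tonelli (m1 := nu) (m2 := P) F)//.
  have lG' := L1Z (q%:R ^- 2) lG.
  rewrite mulrC -(@RintegralZl _ _ _ nu _ _ _ measurableT lG) EFin_Rintegral//.
  apply: ge0_integral_homo => [x|x]; first exact: integral_ge0.
  apply: (le_trans (YG _ _ (grid_round_le q_gt0 x))).
  rewrite lee_fin [leRHS]mulrA ler_wpM2r// [leRHS]mulrC -exprVn -exprMn.
  rewrite -[leLHS]real_normK ?num_real//.
  rewrite ler_pXn2r ?nnegrE ?mulr_ge0 ?invr_ge0 ?addr_ge0 ?sqr_ge0//.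
  exact: grid_round_dist.
have Ih : (\int[P]_t h t <= (2^-1 * (ep + ep^-1 * (J / q%:R ^+ 2)))%:E)%E.
  rewrite ge0_integralZl//; last 2 first.
  - by apply: emeasurable_funD => //; exact: measurable_funeM.
  - by move=> t _; rewrite adde_ge0 ?mule_ge0// ?lee_fin ?invr_ge0 ?ltW.
  rewrite ge0_integralD//; last 3 first.
  - by move=> t _; rewrite lee_fin ltW.
  - by move=> t _; rewrite mule_ge0// lee_fin invr_ge0 ltW.
  - exact: measurable_funeM.
  rewrite ge0_integralZl ?lee_fin ?invr_ge0 ?(ltW ep0)//.
  have -> : (\int[P]_t ep%:E = ep%:E)%E by rewrite integral_cst//= probability_setT mule1.
  rewrite EFinM EFinD [(ep^-1 * _)%:E]EFinM.
  apply: lee_wpmul2l; first by rewrite lee_fin.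
  by apply: leeD => //; apply: lee_wpmul2l => //; rewrite lee_fin invr_ge0 ltW.
have close t : (`|phi (L2_of nu (Y ^~ t)) - phi (grid_embed (fun j => Y (point j) t))|%:E
    <= h t)%E.
  apply: (@le_trans _ _ (`|L2_of nu (Y ^~ t) - grid_embed (fun j => Y (point j) t)|%:E)).
    by rewrite lee_fin.
  apply: (L2_discretisation_le (u := Y ^~ t)) => //.
  exact: (measurable_fun_pair1 (f := fun xt => Y xt.1 xt.2)).
have [m Em mB] := expectation_close lphi mh h0 close Ih.
exists m => //; apply: (le_trans mB).
(* The half in [h] cancels the factor 2 of [expectation_close]. *)
by rewrite mulrA divff// mul1r.
Qed.

End grid_L2.

(** * Growth of the activation *)

Section growth.
Context (R : realType) (gamma : R).
Hypothesis gamma_gt0 : 0 < gamma.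

(** The rate [1/16] in the exponent is chosen for fourth powers: they grow like [expR (z^2 / 4)],
    which is Gaussian integrable since [1/4 < 1/2]. *)
Definition growth_envelope (z : R) : R :=
  2 * expR (8 * gamma ^+ 2 + 8) * expR (16^-1 * z ^+ 2).

Lemma growth_envelope_gt0 z : 0 < growth_envelope z.
Proof. by rewrite !mulr_gt0// expR_gt0. Qed.

(** [|z|^gamma <= expR (gamma |z|)] and [1 + |z| <= expR |z|], followed by
    [c |z| <= 8 c^2 + z^2 / 32] with [c = gamma] and [c = 1]. The factor [1 + |z|] makes room for
    the one produced by the mean value theorem in [x |-> tau (x z)]. *)
Lemma growth_envelope_le (z : R) :
  (1 + `|z| `^ gamma) * (1 + `|z|) <= growth_envelope z.
Proof.
have sq (c : R) : c * `|z| <= 8 * c ^+ 2 + 32^-1 * z ^+ 2.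
  have := sqr_ge0 (`|z| - 16 * c); rewrite -[z ^+ 2]real_normK ?num_real//.
  by lra.
have e1 : 1 <= expR (8 * gamma ^+ 2 + 32^-1 * z ^+ 2).
  rewrite -[leLHS]expR0 ler_expR.
  have := sqr_ge0 gamma; have := sqr_ge0 z; lra.
have e2 : `|z| `^ gamma <= expR (8 * gamma ^+ 2 + 32^-1 * z ^+ 2).
  apply: (@le_trans _ _ (expR `|z| `^ gamma)).
    rewrite ge0_ler_powR ?nnegrE ?(ltW gamma_gt0) ?expR_ge0//.
    by rewrite (le_trans _ (expR_ge1Dx _))// lerDr.
  by rewrite -expRM ler_expR mulrC sq.
have e3 : 1 + `|z| <= expR (8 + 32^-1 * z ^+ 2).
  apply: (le_trans (expR_ge1Dx _)); rewrite ler_expR.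
  by have := sq 1; rewrite mul1r expr1n mulr1.
have -> : growth_envelope z = 2 * expR (8 * gamma ^+ 2 + 32^-1 * z ^+ 2) *
    expR (8 + 32^-1 * z ^+ 2).
  by rewrite /growth_envelope -!mulrA -!expRD; congr (_ * expR _); field.
have h0 : 0 <= 1 + `|z| `^ gamma by rewrite addr_ge0 ?powR_ge0.
by rewrite ler_pM ?addr_ge0// mulr_natl mulr2n lerD.
Qed.

Lemma growth_envelope_X_L1 (k : nat) : (k <= 4)%N ->
  L1 (@std_normal R) (fun z => growth_envelope z ^+ k).
Proof.
move=> k4; pose c : R := 2 * expR (8 * gamma ^+ 2 + 8).
have l : L1 (@std_normal R) (fun z => expR (k%:R / 16 * z ^+ 2)).
  apply: L1_std_normal_expR.
  have k4' : k%:R <= 4 :> R by rewrite ler_nat.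
  lra.
apply: eq_L1 (L1Z (c ^+ k) l) => z; rewrite /growth_envelope -/c [RHS]exprMn.
by rewrite -expRM_natl; congr (_ * expR _); ring.
Qed.

Lemma powR_scale_le (a b s u z : R) : 0 <= a -> 0 <= b -> 1 <= s -> `|u| <= s * `|z| ->
  a + b * `|u| `^ gamma <= (a + b) * s `^ gamma * (1 + `|z| `^ gamma).
Proof.
move=> a0 b0 s1 us.
have s0 : 0 <= s by exact: le_trans s1.
have sg1 : 1 <= s `^ gamma.
  have : 1 `^ gamma <= s `^ gamma by rewrite ge0_ler_powR ?nnegrE ?(ltW gamma_gt0).
  by rewrite powR1.
have ug : `|u| `^ gamma <= s `^ gamma * `|z| `^ gamma.
  by rewrite -powRM// ge0_ler_powR ?nnegrE ?(ltW gamma_gt0)// mulr_ge0.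
have z0 : 0 <= `|z| `^ gamma := powR_ge0 _ _.
set S := s `^ gamma in sg1 ug *; set Z := `|z| `^ gamma in ug z0 *.
rewrite -mulrA mulrDl lerD//.
  rewrite ler_peMr// (le_trans sg1)// ler_peMr ?lerDl//.
  exact: le_trans sg1.
rewrite ler_wpM2l// (le_trans ug)// ler_wpM2l ?lerDr//.
exact: le_trans sg1.
Qed.

Section activation.
Variables (tau : R -> R) (a b : R).
Hypotheses (a_gt0 : 0 < a) (b_gt0 : 0 < b) (tau_C2 : C2 tau).
Hypothesis tau_le : forall (l : nat) (x : R), (l <= 2)%N ->
  `|(tau^`(l))%classic x| <= a + b * `|x| `^ gamma.

Let dtau (x : R) : is_derive x 1 tau ((tau^`(1))%classic x).
Proof.
case: tau_C2 => /(_ 0%N x isT) dx _.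
by apply: DeriveDef => //; rewrite /= derive1E.
Qed.

Lemma activation_continuous : continuous tau.
Proof.
by move=> x; apply/differentiable_continuous/derivable1_diffP; case: (dtau x).
Qed.

Lemma activation_le (s u z : R) : 1 <= s -> `|u| <= s ->
  `|tau (u * z)| <= (a + b) * s `^ gamma * growth_envelope z.
Proof.
move=> s1 us; apply: (le_trans (@tau_le 0%N (u * z) isT)).
apply: (le_trans (powR_scale_le (ltW a_gt0) (ltW b_gt0) s1 (_ : `|u * z| <= s * `|z|))).
  by rewrite normrM ler_wpM2r.
rewrite ler_wpM2l ?mulr_ge0 ?addr_ge0 ?powR_ge0 ?(ltW a_gt0) ?(ltW b_gt0)//.
apply: le_trans (growth_envelope_le z).
by rewrite ler_peMr ?lerDl ?addr_ge0 ?powR_ge0.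
Qed.

(** Mean value theorem on the segment between [u z] and [v z], where the first derivative obeys the
    growth bound; its length [|u - v| |z|] supplies the extra factor [|z|]. *)
Lemma activation_dist_le (s u v z : R) : 1 <= s -> `|u| <= s -> `|v| <= s ->
  `|tau (u * z) - tau (v * z)| <=
  `|u - v| * ((a + b) * s `^ gamma * growth_envelope z).
Proof.
move=> s1 us vs.
have key (x y : R) : x <= y -> `|x| <= s * `|z| -> `|y| <= s * `|z| ->
    `|tau y - tau x| <= (a + b) * s `^ gamma * (1 + `|z| `^ gamma) * `|y - x|.
  move=> xy xs ys.
  have [|c cxy ->] := @MVT_segment _ tau (tau^`(1))%classic x y xy (fun z _ => dtau z).
    by apply: continuous_subspaceT; exact: activation_continuous.
  rewrite normrM ler_wpM2r//; apply: (le_trans (@tau_le 1%N c isT)).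
  apply: powR_scale_le => //; [exact: ltW|exact: ltW|].
  move: cxy xs ys; rewrite in_itv/= !ler_norml => /andP[? ?] /andP[? ?] /andP[? ?].
  by apply/andP; split; lra.
have uz : `|u * z| <= s * `|z| by rewrite normrM ler_wpM2r.
have vz : `|v * z| <= s * `|z| by rewrite normrM ler_wpM2r.
have D0 : 0 <= (a + b) * s `^ gamma.
  by rewrite mulr_ge0 ?addr_ge0 ?powR_ge0 ?(ltW a_gt0) ?(ltW b_gt0).
apply: (@le_trans _ _ ((a + b) * s `^ gamma * (1 + `|z| `^ gamma) * `|u * z - v * z|)).
  have [uv|vu] := leP (u * z) (v * z).
    by rewrite distrC [`|u * z - _|]distrC; exact: key.
  by apply: key => //; exact: ltW.
rewrite -mulrBl normrM.
have -> : (a + b) * s `^ gamma * (1 + `|z| `^ gamma) * (`|u - v| * `|z|) =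
    `|u - v| * ((a + b) * s `^ gamma * ((1 + `|z| `^ gamma) * `|z|)) by ring.
apply: ler_wpM2l => //; apply: ler_wpM2l => //.
apply: le_trans (growth_envelope_le z).
by rewrite ler_wpM2l ?addr_ge0 ?powR_ge0// lerDr.
Qed.

End activation.

(** [(1 + |x|)^p <= 2^p (1 + |x|^p)], by comparing [|x|] with 1; finiteness of [nu] takes care of
    the constant. *)
Lemma moment_shift (nu : {finite_measure set R -> \bar R}) (p : R) : 0 <= p ->
  (\int[nu]_x (`|x| `^ p)%:E < +oo)%E -> L1 nu (fun x => (1 + `|x|) `^ p).
Proof.
move=> p0 fin.
have mp : measurable_fun setT (fun x : R => `|x| `^ p).
  by apply: (@measurableT_comp _ _ _ _ _ _ (@powR R ^~ p)).
have lp : L1 nu (fun x => `|x| `^ p) by apply: L1_ge0 => // x; exact: powR_ge0.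
apply: (L1_dominated _ (L1Z (2 `^ p) (L1D (@L1_cst _ _ _ nu 1) lp))).
  by apply: (@measurableT_comp _ _ _ _ _ _ (@powR R ^~ p)) => //; exact: measurable_funD.
move=> x; rewrite ger0_norm ?powR_ge0//.
have [x1|x1] := leP `|x| 1.
  apply: (@le_trans _ _ (2 `^ p)).
    by rewrite ge0_ler_powR ?nnegrE ?addr_ge0//; lra.
  by rewrite ler_peMr ?powR_ge0// lerDl powR_ge0.
apply: (@le_trans _ _ (2 `^ p * `|x| `^ p)).
  rewrite -powRM// ge0_ler_powR ?nnegrE ?addr_ge0 ?mulr_ge0//; lra.
by rewrite ler_wpM2l ?powR_ge0// lerDr.
Qed.

End growth.

(** * The Gaussian field *)

Section gaussian_field.
Context (R : realType) d (T : measurableType d) (P : probability T R).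
Variables (tau : R -> R) (B : R -> T -> R).
Hypothesis gfB : centered_gaussian_field P B (network_cov tau).
Hypothesis tau_cont : continuous tau.
Hypothesis tau_sqr : forall x, L1 (@std_normal R) (fun z => tau (x * z) ^+ 2).
Local Notation gamma := (@std_normal R).

Let field_gaussian x : exists m s : R, has_law P (B x) (gaussian_law m s).
Proof.
case: gfB => _ /(_ 1%N (fun=> 1) (fun=> x)) [m [s H]] _ _; exists m, s.
by move: H; congr has_law; apply/funext => t; rewrite big_ord1 mul1r.
Qed.

Lemma field_mean x : L1 P (B x) /\ \int[P]_t B x t = 0.
Proof.
have [m [s H]] := field_gaussian x; have [l _] := gaussian_law_mean H; split=> //.
case: gfB => _ _ /(_ x) E _; apply: EFin_inj; rewrite EFin_Rintegral//.
by move: E; rewrite unlock => ->.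
Qed.

Lemma field_sqr_L1 x : L1 P (fun t => B x t ^+ 2).
Proof.
have [m [s H]] := field_gaussian x; have [_ E] := gaussian_law_mean H.
by case: (gaussian_law_sqr H _) => //; rewrite -E (field_mean x).2.
Qed.

Lemma field_measurable x : measurable_fun setT (B x).
Proof. exact: L1_measurable (field_mean x).1. Qed.

Lemma field_law (m : nat) (c x : 'I_m -> R) :
  exists s, has_law P (fun t => \sum_(i < m) c i * B (x i) t) (gaussian_law 0 s).
Proof.
case: gfB => _ /(_ m c x) [mean [s H]] _ _; exists s.
(* The mean parameter of a Gaussian law equals the expectation, which is 0 by linearity. *)
have [_ E] := gaussian_law_mean H; rewrite -{1}E in H.
have E0 : \int[P]_t (\sum_(i < m) c i * B (x i) t) = 0.
  rewrite Rintegral_sumr => [|i _]; last exact: L1Z (field_mean _).1.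
  rewrite big1// => i _.
  by rewrite (@RintegralZl _ _ _ P _ _ _ measurableT (field_mean _).1) (field_mean _).2 mulr0.
by rewrite E0 in H.
Qed.

Let mtau x : measurable_fun setT (fun z : R => tau (x * z)).
Proof.
apply: (@measurableT_comp _ _ _ _ _ _ tau); last exact: measurable_funM.
exact: continuous_measurable_fun.
Qed.

Let BB x y : L1 P (fun t => B x t * B y t).
Proof.
by apply: L1_sqr_mul; [exact: field_measurable|exact: field_measurable|
  exact: field_sqr_L1|exact: field_sqr_L1].
Qed.

Let tautau x y : L1 gamma (fun z : R => tau (x * z) * tau (y * z)).
Proof. exact: L1_sqr_mul. Qed.

Lemma field_cov x y :
  \int[P]_t (B x t * B y t) = \int[gamma]_z (tau (x * z) * tau (y * z)).
Proof.
case: gfB => _ _ B0 /(_ x y).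
rewrite covarianceE; last 3 first.
- by apply/Lfun1_integrable; exact: (field_mean x).1.
- by apply/Lfun1_integrable; exact: (field_mean y).1.
- by apply/Lfun1_integrable; exact: BB.
rewrite (B0 x) mul0e sube0 /network_cov => /(congr1 fine).
rewrite Rintegral_normal_law; last exact: measurable_funM.
by rewrite unlock.
Qed.

Lemma field_sum_sqr (m : nat) (c x : 'I_m -> R) :
  \int[P]_t (\sum_(i < m) c i * B (x i) t) ^+ 2 =
  \int[gamma]_z (\sum_(i < m) c i * tau (x i * z)) ^+ 2.
Proof.
have E (v : 'I_m -> R) : (\sum_(i < m) c i * v i) ^+ 2 =
    \sum_(i < m) \sum_(j < m) c i * c j * (v i * v j).
  rewrite expr2 big_distrlr; apply: eq_bigr => i _; apply: eq_bigr => j _.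
  exact: mulrACA.
under eq_Rintegral do rewrite (E (fun i => B (x i) _)).
under [RHS]eq_Rintegral do rewrite (E (fun i => tau (x i * _))).
have l1 i j : L1 P (fun t => c i * c j * (B (x i) t * B (x j) t)) by exact: L1Z.
have l2 i j : L1 gamma (fun z => c i * c j * (tau (x i * z) * tau (x j * z))) by exact: L1Z.
rewrite !Rintegral_sumr; [|by move=> i _; apply: L1_sum => j _..].
apply: eq_bigr => i _; rewrite !Rintegral_sumr//; apply: eq_bigr => j _.
rewrite (@RintegralZl _ _ _ P _ _ _ measurableT (BB _ _)).
by rewrite (@RintegralZl _ _ _ gamma _ _ _ measurableT (tautau _ _)) field_cov.
Qed.

Lemma field_increment x y : L1 P (fun t => (B x t - B y t) ^+ 2) /\
  \int[P]_t (B x t - B y t) ^+ 2 = \int[gamma]_z (tau (x * z) - tau (y * z)) ^+ 2.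
Proof.
(* An increment is a two-term combination with coefficients [1] and [-1]. *)
pose c (i : 'I_2) : R := if i == ord0 then 1 else -1.
pose p (i : 'I_2) : R := if i == ord0 then x else y.
have E (v : R -> R) : \sum_(i < 2) c i * v (p i) = v x - v y.
  by rewrite big_ord_recl big_ord1 /c /p /= mul1r mulN1r.
have [s H] := field_law c p; have [l _] := gaussian_law_sqr H erefl.
split; first by apply: eq_L1 l => t; rewrite (E (B^~ t)).
have := field_sum_sqr c p.
under eq_Rintegral do rewrite (E (B^~ _)).
by under [RHS]eq_Rintegral do rewrite (E (fun x => tau (x * _))).
Qed.

End gaussian_field.

(** * Comparison of the network with the field *)

Lemma dist_chain (R : realDomainType) (m1 m2 i1 i2 i3 r e : R) :
  `|m1 - i1| <= 2 * e -> `|i1 - i2| <= r -> `|i2 - i3| <= e -> `|m2 - i3| <= 2 * e ->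
  `|m1 - m2| <= r + 5 * e.
Proof.
rewrite !ler_norml => /andP[? ?] /andP[? ?] /andP[? ?] /andP[? ?].
by apply/andP; split; lra.
Qed.

Section grid_network.
Context (R : realType) (nu : {finite_measure set R -> \bar R}) (a b gamma : R).
Hypotheses (a_gt0 : 0 < a) (b_gt0 : 0 < b) (gamma_gt0 : 0 < gamma).
Hypothesis nu_moment : (\int[nu]_x (`|x| `^ (2 * gamma + 4))%:E < +oo)%E.
Local Notation normal := (@std_normal R).
Local Notation beta := (growth_envelope gamma).
Local Notation K := (LspaceType2 nu).

(** The spatial factor of the separated bound [|tau (x z)| <= growth_scale x * beta z]. *)
Definition growth_scale (x : R) : R := (a + b) * (1 + `|x|) `^ gamma.

Definition weight_moment : R := \int[nu]_x (1 + `|x|) `^ (2 * gamma + 4).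

Definition envelope_moment (k : nat) : R := \int[normal]_z beta z ^+ k.

(** The squared factor bounds the sum of [growth_scale ^+ 2] over the weighted grid; [2 ^ (2 gamma)]
    is the price of rounding, and 4 comes from the two blocks of neurons. *)
Definition rate_constant : R :=
  1 + 4 * (((a + b) ^+ 2 * 2 `^ (2 * gamma) * weight_moment) ^+ 2 * envelope_moment 4).

Let ab0 : 0 <= a + b. Proof. by rewrite addr_ge0 ?ltW. Qed.

Let scale_ge0 x : 0 <= growth_scale x. Proof. by rewrite mulr_ge0 ?powR_ge0. Qed.

Let one_le (x : R) : 1 <= 1 + `|x|. Proof. by rewrite lerDl. Qed.

Let pow_gt0 (x : R) : 0 < 1 + `|x| :> R. Proof. exact: lt_le_trans (one_le x). Qed.

Let moment_L1 : L1 nu (fun x : R => (1 + `|x|) `^ (2 * gamma + 4)).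
Proof. by apply: moment_shift => //; rewrite addr_ge0// mulr_ge0// ltW. Qed.

Let scale_sqr x : growth_scale x ^+ 2 = (a + b) ^+ 2 * (1 + `|x|) `^ (2 * gamma).
Proof.
rewrite /growth_scale exprMn -(powR_mulrn 2 (powR_ge0 _ _)) -powRrM.
by rewrite [gamma * _]mulrC.
Qed.

Let measurable_norm_powR (p : R) : measurable_fun setT (fun x : R => (1 + `|x|) `^ p).
Proof.
by apply: (@measurableT_comp _ _ _ _ _ _ (@powR R ^~ p)) => //; exact: measurable_funD.
Qed.

(** The full moment is spent here: [(1 + x^2)^2 <= (1 + |x|)^4] meets [(1 + |x|)^{2 gamma}]. *)
Lemma growth_scale_moment (c : R) : 0 <= c ->
  L1 nu (fun x => (1 + x ^+ 2) ^+ 2 * (growth_scale x ^+ 2 * c)).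
Proof.
move=> c0; apply: (L1_dominated _ (L1Z ((a + b) ^+ 2 * c) moment_L1)).
  apply: measurable_funM.
    apply: measurable_funX; apply: measurable_funD => //; exact: measurable_funX.
  apply: measurable_funM => //; under eq_fun do rewrite scale_sqr.
  by apply: measurable_funM.
move=> x; rewrite ger0_norm; last exact: mulr_ge0 (sqr_ge0 _) (mulr_ge0 (sqr_ge0 _) c0).
have -> : (a + b) ^+ 2 * c * (1 + `|x|) `^ (2 * gamma + 4) =
    (1 + `|x|) ^+ 4 * ((a + b) ^+ 2 * (1 + `|x|) `^ (2 * gamma) * c).
  rewrite powRD; last by rewrite gt_eqF// addr_gt0// mulr_gt0.
  by rewrite (powR_mulrn 4 (ltW (pow_gt0 x))); ring.
rewrite scale_sqr ler_wpM2r ?mulr_ge0 ?sqr_ge0 ?powR_ge0//.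
rewrite (_ : 4 = 2 * 2)%N// exprM ler_pXn2r ?nnegrE ?exprn_ge0 ?addr_ge0 ?sqr_ge0//.
by rewrite -(real_normK (num_real x)); have := normr_ge0 x; nra.
Qed.

Let env_L1 k : (k <= 4)%N -> L1 normal (fun z => beta z ^+ k).
Proof. exact: growth_envelope_X_L1. Qed.

Let env_ge0 z : 0 <= beta z. Proof. exact/ltW/growth_envelope_gt0. Qed.

Lemma envelope_moment_ge0 k : 0 <= envelope_moment k.
Proof. by apply: Rintegral_ge0 => z _; rewrite exprn_ge0. Qed.

(** The sum is the integral of [growth_scale ^+ 2] at the rounded point, and
    [1 + |grid_round q x| <= 2 (1 + |x|)]. The bound is independent of [q]. *)
Lemma grid_scale_sum (q : nat) : (0 < q)%N ->
  \sum_(j < grid_size q) growth_scale (grid_point R j) ^+ 2 * grid_weight nu j <=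
  (a + b) ^+ 2 * 2 `^ (2 * gamma) * weight_moment.
Proof.
move=> q0; have [l <-] := grid_round_integral nu q0 (fun y => growth_scale y ^+ 2).
rewrite -(@RintegralZl _ _ _ nu _ _ _ measurableT moment_L1).
apply: le_Rintegral => //; first exact: L1Z.
move=> x _; rewrite scale_sqr -mulrA ler_wpM2l ?sqr_ge0//.
have g0 : 0 <= 2 * gamma by rewrite mulr_ge0// ltW.
apply: (@le_trans _ _ ((2 * (1 + `|x|)) `^ (2 * gamma))).
  have H : 1 + `|grid_round q x| <= 2 * (1 + `|x|).
    by have := grid_round_le q0 x; have := normr_ge0 x; lra.
  by apply: ge0_ler_powR => //; rewrite nnegrE ?mulr_ge0 ?(ltW (pow_gt0 _)).
rewrite powRM ?(ltW (pow_gt0 _))// ler_wpM2l ?powR_ge0// ler_powR// lerDl.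
by [].
Qed.

Section activation.
Variable tau : R -> R.
Hypothesis tau_C2 : C2 tau.
Hypothesis tau_le : forall (l : nat) (x : R), (l <= 2)%N ->
  `|(tau^`(l))%classic x| <= a + b * `|x| `^ gamma.

Let tau_cont : continuous tau := activation_continuous tau_C2.

Let mtau : measurable_fun setT tau. Proof. exact: continuous_measurable_fun. Qed.

Let mh x : measurable_fun setT (fun z : R => tau (x * z)).
Proof. by apply: (measurableT_comp mtau); exact: measurable_funM. Qed.

Let tau_envelope x z : `|tau (x * z)| <= growth_scale x * beta z.
Proof. by apply: (activation_le gamma_gt0 a_gt0 b_gt0 tau_le z (one_le x)); rewrite lerDr. Qed.

Let hX_L1 x k : (k <= 4)%N -> L1 normal (fun z : R => tau (x * z) ^+ k).
Proof.
move=> k4; apply: (L1_dominated _ (L1Z (growth_scale x ^+ k) (env_L1 k4))).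
  exact: measurable_funX.
by move=> z; rewrite normrX -exprMn; apply: lerXn2r; rewrite ?nnegrE ?mulr_ge0.
Qed.

Let hh_L1 x y : L1 normal (fun z : R => (tau (x * z) * tau (y * z)) ^+ 2) /\
  \int[normal]_z (tau (x * z) * tau (y * z)) ^+ 2 <=
  growth_scale x ^+ 2 * growth_scale y ^+ 2 * envelope_moment 4.
Proof.
have le z : `|(tau (x * z) * tau (y * z)) ^+ 2| <=
    growth_scale x ^+ 2 * growth_scale y ^+ 2 * beta z ^+ 4.
  rewrite normrX normrM.
  have -> : growth_scale x ^+ 2 * growth_scale y ^+ 2 * beta z ^+ 4 =
      ((growth_scale x * beta z) * (growth_scale y * beta z)) ^+ 2 by ring.
  by apply: lerXn2r; rewrite ?nnegrE ?mulr_ge0// ler_pM.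
have l : L1 normal (fun z => growth_scale x ^+ 2 * growth_scale y ^+ 2 * beta z ^+ 4).
  by apply: L1Z; exact: env_L1.
have l' : L1 normal (fun z : R => (tau (x * z) * tau (y * z)) ^+ 2).
  by apply: (L1_dominated _ l) => //; apply: measurable_funX; exact: measurable_funM.
split=> //; rewrite -(@RintegralZl _ _ _ normal _ _ _ measurableT (env_L1 (leqnn 4))).
apply: le_Rintegral => // z _; exact: le_trans (ler_norm _) (le z).
Qed.

Lemma activation_increment (x y : R) : `|y| <= 1 + `|x| ->
  L1 normal (fun z : R => (tau (x * z) - tau (y * z)) ^+ 2) /\
  \int[normal]_z (tau (x * z) - tau (y * z)) ^+ 2 <=
  (x - y) ^+ 2 * (growth_scale x ^+ 2 * envelope_moment 2).
Proof.
move=> yx; have l := L1Z ((x - y) ^+ 2 * growth_scale x ^+ 2) (env_L1 (isT : 2 <= 4)%N).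
have le z : `|(tau (x * z) - tau (y * z)) ^+ 2| <=
    (x - y) ^+ 2 * growth_scale x ^+ 2 * beta z ^+ 2.
  rewrite -exprMn -exprMn normrX -[leRHS]ger0_norm ?sqr_ge0// normrX.
  rewrite lerXn2r ?nnegrE// -mulrA normrM [`|growth_scale x * _|]ger0_norm ?mulr_ge0//.
  by apply: (activation_dist_le gamma_gt0 a_gt0 b_gt0 tau_C2 tau_le z (one_le x)); rewrite ?lerDr.
have l' : L1 normal (fun z : R => (tau (x * z) - tau (y * z)) ^+ 2).
  by apply: (L1_dominated _ l) => //; apply: measurable_funX; exact: measurable_funB.
split=> //; rewrite mulrA -(@RintegralZl _ _ _ normal _ _ _ measurableT (env_L1 (isT : 2 <= 4)%N)).
apply: le_Rintegral => // z _; exact: le_trans (ler_norm _) (le z).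
Qed.

Section test_function.
Variables (phi : K -> R) (grad : K -> K).
Hypothesis phi_grad : is_gradient (@L2_dot _ _ R nu) phi grad.
Hypothesis dgrad : forall v, differentiable grad v.
Hypothesis grad_le : (maxe (ereal_sup (range (fun v => `|grad v|%:E)))
  (ereal_sup (range (fun v => tensor2_norm (@L2_dot _ _ R nu) ('d grad v)))) <= 1)%E.

Let dotC := @L2_dotC _ _ R nu.
Let dotl := @L2_dot_linearl _ _ R nu.
Let dotE := @L2_dotE _ _ R nu.

Let phi_lip u v : `|phi u - phi v| <= `|u - v|.
Proof. exact: (test_function_lipschitz dotC dotl dotE phi_grad grad_le). Qed.

Let dphi v : differentiable phi v. Proof. by case: (phi_grad v). Qed.

Let embed_lip q (y z : 'I_(grid_size q) -> R) :
  `|phi (grid_embed nu y) - phi (grid_embed nu z)| <=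
  (\sum_(j < grid_size q) Num.sqrt (grid_weight nu j) * `|grid_basis nu j|) * \sum_j `|y j - z j|.
Proof. by apply: (le_trans (phi_lip _ _)); exact: grid_embed_dist. Qed.

Lemma grid_embed_L1 q d (T : measurableType d) (P : probability T R)
    (Y : 'I_(grid_size q) -> T -> R) :
  (forall j, L1 P (Y j)) -> L1 P (fun t => phi (grid_embed nu (fun j => Y j t))).
Proof.
move=> lY; set L := \sum_(j < grid_size q) Num.sqrt (grid_weight nu j) * `|grid_basis nu j|.
apply: (L1_dominated (g := fun t => `|phi (grid_embed nu (fun=> 0))| +
    L * \sum_(j < grid_size q) `|Y j t|)).
- apply: (@measurable_continuous_combination _ _ R K _ _
    (fun j t => Y j t * Num.sqrt (grid_weight nu j)) (@grid_basis R nu q) (fun v _ => phi v)) => //.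
    by move=> _ v; exact: differentiable_continuous.
  by move=> j; apply: measurable_funM => //; exact: L1_measurable.
- have lc : L1 P (fun=> `|phi (grid_embed nu (fun _ : 'I_(grid_size q) => 0))|).
    exact: (@L1_cst _ _ _ P).
  have ls : L1 P (fun t => \sum_(j < grid_size q) `|Y j t|).
    by apply: L1_sum => j _; exact: L1_abs.
  exact: (L1D lc (L1Z L ls)).
move=> t; have := embed_lip (fun j => Y j t) (fun=> 0).
have -> : \sum_(j < grid_size q) `|Y j t - 0| = \sum_(j < grid_size q) `|Y j t|.
  by apply: eq_bigr => j _; rewrite subr0.
set u := phi _; set v := phi _; move=> uv.
by rewrite -[u](subrK v) addrC (le_trans (ler_normD _ _))// lerD2l.
Qed.

Section network.
Context d (T : measurableType d) (P : probability T R) (w w0 : nat -> T -> R).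
Hypothesis law_w : forall j, has_law P (w j) std_normal.
Hypothesis law_w0 : forall j, has_law P (w0 j) std_normal.
Hypothesis ind : mutually_independent P (network_vars w w0).

Let net s n x := network_sum w w0 s n (fun z => tau (x * z)).

Lemma network_sum_L1 s n x : L1 P (net s n x).
Proof.
case: (posnP n) => [->|n0].
  by apply: eq_L1 (L1_0 P) => t; rewrite /net /network_sum big_ord0 mulr0.
apply: (@L1_of_sqr _ _ _ P); first exact: network_sum_measurable.
by case: (network_sum_moment law_w law_w0 ind s n0 (mh x) (hX_L1 x (isT : 2 <= 4)%N)).
Qed.

Lemma network_expectation (n q : nat) (ep : R) : (0 < n)%N -> (0 < q)%N -> 0 < ep ->
  exists2 m : R, 'E_P[fun t => phi (L2_of nu (network_output tau w w0 n ^~ t))]%E = m%:E &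
    `|m - \int[P]_t phi (grid_embed nu (fun j : 'I_(grid_size q) => net 0 n (grid_point R j) t))| <=
    ep + ep^-1 * (\int[nu]_x ((1 + x ^+ 2) ^+ 2 *
      (growth_scale x ^+ 2 * envelope_moment 2)) / q%:R ^+ 2).
Proof.
move=> n0 q0 ep0.
apply: (@expectation_discretisation R nu q q0 _ T P (net 0 n) phi) => //.
- rewrite /net /network_sum.
  apply: measurable_funM => //; apply: measurable_sum => j.
  have mw : measurable_fun setT (w (0 + j)) by case: (law_w (0 + j)).
  have mw0 : measurable_fun setT (w0 (0 + j)) by case: (law_w0 (0 + j)).
  apply: measurable_funM; first exact: measurableT_comp mw _.
  apply: (measurableT_comp mtau); apply: measurable_funM => //.
  exact: measurableT_comp mw0 _.
- by apply: grid_embed_L1 => j; exact: network_sum_L1.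
- by move=> x; rewrite mulr_ge0 ?sqr_ge0 ?envelope_moment_ge0.
- move=> x y yx; have [l E] := activation_increment yx.
  have mD : measurable_fun setT (fun z : R => tau (x * z) - tau (y * z)).
    exact: measurable_funB.
  have [lN EN] := network_sum_moment law_w law_w0 ind 0 n0 mD l.
  (* An increment of the network is the network whose feature is the increment of [tau], so its
     second moment is bounded by that of the feature. *)
  have NE t : (net 0 n x t - net 0 n y t) ^+ 2 =
      network_sum w w0 0 n (fun z => tau (x * z) - tau (y * z)) t ^+ 2.
    rewrite /net /network_sum -mulrBr -sumrB; congr ((_ * _) ^+ 2).
    by apply: eq_bigr => j _; rewrite mulrBr.
  under eq_integral do rewrite NE.
  by rewrite -(EFin_Rintegral lN) lee_fin (le_trans EN).
- exact/growth_scale_moment/envelope_moment_ge0.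
Qed.

(** In the grid basis the features are [sqrt (weight_j) * tau (point_j z)]. The separated growth
    bound makes entry [(k, l)] at most [t k * t l * envelope_moment 4], so the double sum is at most
    the square of [sum t], which [grid_scale_sum] bounds for every mesh. *)
Lemma grid_network_width (n m q : nat) : (0 < n)%N -> (n <= m)%N -> (0 < q)%N ->
  `|\int[P]_t phi (grid_embed nu (fun j : 'I_(grid_size q) => net 0 n (grid_point R j) t)) -
    \int[P]_t phi (grid_embed nu (fun j : 'I_(grid_size q) => net n m (grid_point R j) t))| <=
  rate_constant * (Num.sqrt n%:R)^-1.
Proof.
move=> n0 nm q0.
pose r (j : 'I_(grid_size q)) := Num.sqrt (grid_weight nu j).
have r2 j : r j ^+ 2 = grid_weight nu j by rewrite sqr_sqrtr// grid_weight_ge0.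
pose h (j : 'I_(grid_size q)) z := r j * tau (grid_point R j * z).
have NE s k t : grid_embed nu (fun j : 'I_(grid_size q) => net s k (grid_point R j) t) =
    \sum_j network_sum w w0 s k (h j) t *: grid_basis nu j.
  apply: eq_bigr => j _; congr (_ *: _); rewrite /net /network_sum /h -mulrA; congr (_ * _).
  by rewrite mulr_suml; apply: eq_bigr => i _; rewrite -mulrA [r j * _]mulrC.
under eq_Rintegral do rewrite NE.
under [X in _ - X]eq_Rintegral do rewrite NE.
have hE k l z : (h k z * h l z) ^+ 2 = grid_weight nu k * grid_weight nu l *
    (tau (grid_point R k * z) * tau (grid_point R l * z)) ^+ 2.
  by rewrite -!r2 /h; ring.
have mhj j : measurable_fun setT (h j) by exact: measurable_funM.
have hhL k l : L1 normal (fun z => (h k z * h l z) ^+ 2).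
  have [l0 _] := hh_L1 (grid_point R k) (grid_point R l).
  by apply: eq_L1 (L1Z (grid_weight nu k * grid_weight nu l) l0) => z; rewrite hE.
have phiD v u : 'd phi v u = L2_dot (grad v) u by case: (phi_grad v) => _ ->.
apply: le_trans (network_sum_width law_w law_w0 ind dphi phiD ler01
  (test_function_dot_le dotC dotl dotE grad_le)
  (gradient_dot_continuous dotC dotl dotE dgrad)
  (is_derive_gradient_line dotC dotl dotE dgrad)
  (hessian_le dotC dotl dotE grad_le)
  (hessian_sum dotC dotl grad (@grid_basis R nu q))
  (fun v => hessian_orthogonal_le dotC dotl dotE grad_le v (grid_basis_dot nu q0))
  n0 nm mhj hhL) _.
rewrite ler_wpM2r ?invr_ge0 ?sqrtr_ge0// lerD2l ler_wpM2l//.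
set A := (a + b) ^+ 2 * 2 `^ (2 * gamma) * weight_moment.
pose t (j : 'I_(grid_size q)) := growth_scale (grid_point R j) ^+ 2 * grid_weight nu j.
have t0 j : 0 <= t j by rewrite mulr_ge0 ?sqr_ge0 ?grid_weight_ge0.
apply: (@le_trans _ _ (\sum_k \sum_l t k * t l * envelope_moment 4)).
  apply: ler_sum => k _; apply: ler_sum => l _.
  have [l0 E0] := hh_L1 (grid_point R k) (grid_point R l).
  under eq_Rintegral do rewrite hE.
  rewrite (@RintegralZl _ _ _ normal _ _ _ measurableT l0).
  apply: (le_trans (ler_wpM2l _ E0)).
    by rewrite mulr_ge0// grid_weight_ge0.
  by rewrite le_eqVlt; apply/orP; left; apply/eqP; rewrite /t; ring.
under eq_bigr do rewrite -mulr_suml.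
rewrite -mulr_suml ler_wpM2r ?envelope_moment_ge0//.
under eq_bigr do rewrite -mulr_sumr.
have tA : \sum_j t j <= A := grid_scale_sum q0.
have T0 : 0 <= \sum_j t j by exact: sumr_ge0.
by rewrite -mulr_suml -expr2; apply: lerXn2r; rewrite // nnegrE// (le_trans T0).
Qed.

Context d' (T' : measurableType d') (P' : probability T' R) (B : R -> T' -> R).
Hypothesis gfB : centered_gaussian_field P' B (network_cov tau).

Let h2 x : L1 normal (fun z : R => tau (x * z) ^+ 2). Proof. exact: hX_L1. Qed.

Lemma field_expectation (q : nat) (ep : R) : (0 < q)%N -> 0 < ep ->
  exists2 m : R, 'E_P'[fun t => phi (L2_of nu (B ^~ t))]%E = m%:E &
    `|m - \int[P']_t phi (grid_embed nu (fun j : 'I_(grid_size q) => B (grid_point R j) t))| <=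
    ep + ep^-1 * (\int[nu]_x ((1 + x ^+ 2) ^+ 2 *
      (growth_scale x ^+ 2 * envelope_moment 2)) / q%:R ^+ 2).
Proof.
move=> q0 ep0.
apply: (@expectation_discretisation R nu q q0 _ T' P' B phi) => //.
- by case: gfB.
- by apply: grid_embed_L1 => j; case: (field_mean gfB (grid_point R j)).
- by move=> x; rewrite mulr_ge0 ?sqr_ge0 ?envelope_moment_ge0.
- move=> x y yx; have [l E] := activation_increment yx.
  have [lB EB] := field_increment gfB tau_cont h2 x y.
  by rewrite -(EFin_Rintegral lB) lee_fin EB.
- exact/growth_scale_moment/envelope_moment_ge0.
Qed.

Lemma grid_network_clt (n q : nat) (ep : R) : (0 < n)%N -> 0 < ep ->
  exists2 m, (n <= m)%N &
  `|\int[P]_t phi (grid_embed nu (fun j : 'I_(grid_size q) => net n m (grid_point R j) t)) -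
    \int[P']_t phi (grid_embed nu (fun j : 'I_(grid_size q) => B (grid_point R j) t))| <= ep.
Proof.
move=> n0 ep0.
have L0 : 0 <= \sum_(j < grid_size q) Num.sqrt (grid_weight nu j) * `|grid_basis nu j|.
  by apply: sumr_ge0 => j _; rewrite mulr_ge0 ?sqrtr_ge0.
have lF m : L1 P (fun t => phi (grid_embed nu
    (fun j : 'I_(grid_size q) => net n m (grid_point R j) t))).
  by apply: grid_embed_L1 => j; exact: network_sum_L1.
have lV : L1 P' (fun t => phi (grid_embed nu (fun j : 'I_(grid_size q) => B (grid_point R j) t))).
  by apply: grid_embed_L1 => j; case: (field_mean gfB (grid_point R j)).
have := lipschitz_clt law_w law_w0 ind (fun j : 'I_(grid_size q) => mh (grid_point R j))
  (fun j => hX_L1 (grid_point R j) (leqnn 4)) (fun j => field_measurable gfB (grid_point R j))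
  (fun c => field_law gfB c (@grid_point R q))
  (fun c => field_sum_sqr gfB tau_cont h2 c (@grid_point R q)) L0 (@embed_lip q) lF lV.
move=> /cvgrPdist_le /(_ _ ep0) [k _ kP]; exists (maxn n k); first exact: leq_maxl.
by rewrite distrC; apply: kP; exact: leq_maxr.
Qed.

(** The grid is fixed first, from [ep], and only then the large width [m]: the central limit step
    may depend on the grid because the width comparison depends on neither the grid nor [m]. *)
Lemma network_field_close (n : nat) (ep : R) : (0 < n)%N -> 0 < ep ->
  (`| 'E_P[fun t => phi (L2_of nu (network_output tau w w0 n ^~ t))] -
     'E_P'[fun t => phi (L2_of nu (B ^~ t))] | <=
  (rate_constant * (Num.sqrt n%:R)^-1)%:E + ep%:E)%E.
Proof.
move=> n0 ep0; pose del := ep / 5.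
have del0 : 0 < del by rewrite divr_gt0.
set J := \int[nu]_x ((1 + x ^+ 2) ^+ 2 * (growth_scale x ^+ 2 * envelope_moment 2)).
have J0 : 0 <= J.
  apply: Rintegral_ge0 => x _.
  exact: mulr_ge0 (sqr_ge0 _) (mulr_ge0 (sqr_ge0 _) (envelope_moment_ge0 _)).
(* [J / del^2 <= q <= q^2], hence each discretisation error is at most [2 del]. With the limit error
   [del], the total is [5 del = ep]. *)
pose q := (Num.truncn (J / del ^+ 2)).+1.
have Jq : del^-1 * (J / q%:R ^+ 2) <= del.
  have q1 : 1 <= q%:R :> R by rewrite ler1n.
  have : J / del ^+ 2 <= q%:R by rewrite ltW// truncnS_gt.
  rewrite ler_pdivrMr ?exprn_gt0// => H.
  rewrite ler_pdivrMl// ler_pdivrMr ?exprn_gt0// -expr2.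
  by rewrite (le_trans H)// mulrC ler_wpM2l ?sqr_ge0// expr2 ler_peMr.
have [m1 E1 B1] := network_expectation n0 (isT : 0 < q)%N del0.
have [m2 E2 B2] := field_expectation (isT : 0 < q)%N del0.
have [m nm B3] := grid_network_clt q n0 del0.
have B4 := grid_network_width n0 nm (isT : 0 < q)%N.
rewrite E1 E2 -EFinB abse_EFin -EFinD lee_fin.
rewrite -/J in B1 B2.
rewrite (_ : ep = 5 * del); last by rewrite /del; field.
have d2 (x : R) : x <= del + del^-1 * (J / q%:R ^+ 2) -> x <= 2 * del.
  by move=> /le_trans; apply; rewrite mulr_natl mulr2n lerD2l.
exact: dist_chain (d2 _ B1) B4 B3 (d2 _ B2).
Qed.

End network.
End test_function.
End activation.
End grid_network.

Theorem theorem3p3 (R : realType) (nu : {finite_measure set R -> \bar R})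
    (a b gamma : R) (a_gt0 : 0 < a) (b_gt0 : 0 < b) (gamma_gt0 : 0 < gamma)
    (nu_atomless : forall A : set R, ~ atom nu A)
    (nu_moment :
      (\int[nu]_x (`|x| `^ (2 * gamma + 4))%:E < +oo)%E) :
  exists Cst : R,
    forall (tau : R -> R),
      C2 tau ->
      (forall (l : nat) (x : R), (l <= 2)%N ->
        `|(tau^`(l))%classic x| <= a + b * `|x| `^ gamma) ->
    forall (d : measure_display) (Omega : measurableType d)
      (P : probability Omega R) (w w0 : nat -> Omega -> R),
      (forall j, has_law P (w j) (normal_prob 0 1)) ->
      (forall j, has_law P (w0 j) (normal_prob 0 1)) ->
      mutually_independent P
        (fun i : nat + nat =>
           match i with inl j => w j | inr j => w0 j end) ->
    forall (d' : measure_display) (Omega' : measurableType d')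
      (P' : probability Omega' R) (B : R -> Omega' -> R),
      centered_gaussian_field P' B (network_cov tau) ->
    forall n : nat, (1 <= n)%N ->
      (d2 (@L2_dot _ _ R nu)
          P (fun t => L2_of nu (network_output tau w w0 n ^~ t))
          P' (fun t => L2_of nu (B ^~ t))
        <= (Cst * (Num.sqrt n%:R)^-1)%:E)%E.
Proof.
exists (rate_constant nu a b gamma) => tau tau_C2 tau_le d Omega P w w0 law_w law_w0 ind
  d' Omega' P' B gfB n n0.
apply: ub_ereal_sup => _ [phi [grad [phi_grad dgrad grad_le]] <-].
(* The rate constant does not involve [ep], so the approximation error is let go to 0 separately for
   each test function. *)
apply/lee_addgt0Pr => ep ep0.
exact: (network_field_close a_gt0 b_gt0 gamma_gt0 nu_moment tau_C2 tau_le phi_grad dgrad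
  grad_le law_w law_w0 ind gfB n0 ep0).
Qed.
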